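(* Fix a positive integer $\ell$, a positive integer $b$, and an integer $a$. For $n\ge 0$ let $h(a,b;n)$ denote the number of partitions $\lambda$ of $n$ such that the number of hooks of $\lambda$ of length exactly $\ell$ is congruent to $a \pmod b$. Then as $n\to\infty$, \[ h(a,b;n)=\frac{p(n)}{b}\left(1+O\left(n^{-\frac12}\right)\right)=\frac{1}{4bn\sqrt{3}}\,e^{\pi\sqrt{\frac{2n}{3}}}\left(1+O\left(n^{-\frac12}\right)\right), \] where $p(n)$ is the number of partitions of $n$.
   Context: A partition $\lambda=(\lambda_1,\dots,\lambda_s)$ of $n$ is a non-increasing sequence of positive integers summing to $n$. In its Ferrers–Young diagram, the node in row $k$ and column $j$ has hook length $h(k,j)=(\lambda_k-k)+(\lambda'_j-j)+1$, where $\lambda'_j$ is the number of nodes in column $j$; $\mathcal{H}(\lambda)$ denotes the multiset of hook lengths of $\lambda$. Equivalently, $\sum_{n\ge0}h(a,b;n)q^n=\frac1b\sum_{k=0}^{b-1}\zeta_b^{-ak}H(\zeta_b^k;q)$ with $\zeta_b=e^{2\pi i/b}$ and $H(\zeta;q)=\sum_{\lambda}q^{|\lambda|}\zeta^{\#\{h\in\mathcal{H}(\lambda):h=\ell\}}=\prod_{n\ge1}\frac{(1+(\zeta-1)q^{\ell n})^\ell}{1-q^n}$. *)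

(* Defs.v *)
From HB Require Import structures.
From mathcomp Require Import all_boot all_algebra.

Set Implicit Arguments.
Unset Strict Implicit.
Unset Printing Implicit Defensive.

Definition is_partition (n : nat) (la : seq nat) : bool :=
  [&& sorted geq la, all (leq 1) la & sumn la == n].

Structure intpart (n : nat) : predArgType :=
  Intpart {intpart_val :> seq nat; _ : is_partition n intpart_val}.

HB.instance Definition _ n := [isSub for @intpart_val n].
HB.instance Definition _ n := [Countable of intpart n by <:].

(* Finiteness of [intpart n]: a partition of [n] has at most [n] parts, each at
   most [n], hence embeds into the sequences of length <= n over {0, .., n}. *)
Section IntpartFinite.
Variable n : nat.

Lemma size_is_partition la : is_partition n la -> size la <= n.
Proof.
case/and3P=> _ la_gt0 /eqP <-.
elim: la la_gt0 => //= m la IHla /andP[m_gt0 /IHla le_la].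
by rewrite -add1n leq_add.
Qed.

Lemma mem_is_partition la m : is_partition n la -> m \in la -> m <= n.
Proof.
case/and3P=> _ _ /eqP <-.
elim: la => //= k la IHla; rewrite inE => /predU1P[->|/IHla le_m].
  exact: leq_addr.
exact: leq_trans le_m (leq_addl _ _).
Qed.

Definition intpart_encode (la : intpart n) : n.-bseq 'I_n.+1 :=
  insub_bseq n [seq inord m | m <- intpart_val la].

Definition intpart_decode (t : n.-bseq 'I_n.+1) : option (intpart n) :=
  insub [seq val i | i <- t].

Lemma intpart_encodeK : pcancel intpart_encode intpart_decode.
Proof.
move=> la; rewrite /intpart_decode /intpart_encode /insub_bseq.
have la_part : is_partition n la := valP la.
have le_la : size [seq @inord n m | m <- intpart_val la] <= n.
  by rewrite size_map size_is_partition.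
rewrite val_insubd le_la -map_comp.
have -> : [seq (val \o @inord n) m | m <- intpart_val la] = la.
  rewrite -[RHS]map_id; apply/eq_in_map => m la_m /=.
  by rewrite inordK // ltnS (mem_is_partition la_part).
exact: valK.
Qed.

HB.instance Definition _ : isFinite (intpart n) := PCanIsFinite intpart_encodeK.

End IntpartFinite.

(* Rows and columns are numbered from 0: [conjpart la j] is the number of nodes
   in column j, i.e. the (j+1)-st part of the conjugate partition. *)
Definition conjpart (la : seq nat) (j : nat) : nat := count (ltn j) la.

(* With rows and columns numbered from 1, the hook length of the node (k, j) is
   (la_k - k) + (la'_j - j) + 1; shifting both indices gives the expression
   below, where the subtraction is never truncated when (k, j) is a node. *)
Definition hook_length (la : seq nat) (k j : nat) : nat :=
  (nth 0 la k + conjpart la j).+1 - (k.+1 + j.+1).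

Definition hook_lengths (la : seq nat) : seq nat :=
  [seq hook_length la k j | k <- iota 0 (size la), j <- iota 0 (nth 0 la k)].

Definition num_hooks (l : nat) (la : seq nat) : nat :=
  count_mem l (hook_lengths la).

Definition npart (n : nat) : nat := #|{: intpart n}|.

Definition npart_hooks (l : nat) (a : int) (b n : nat) : nat :=
  #|[set la : intpart n |
      ((num_hooks l la)%:Z == a %[mod b%:Z])%Z]|.

(* Main.v *)
Require Import Defs.
From HB Require Import structures.
From mathcomp Require Import all_boot all_order all_algebra complex.
From mathcomp Require Import all_classical all_reals all_analysis.
From mathcomp Require Import ring lra zify.
Import Order.TTheory GRing.Theory Num.Theory.
Import numFieldNormedType.Exports.
Set Implicit Arguments.
Unset Strict Implicit.
Unset Printing Implicit Defensive.


(* Fix windows of part sizes ]5lw, 5lw + 5l].  If the only parts of a partition in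
   such a window are s + 4l - 1 and s + l (with s = 5lw), replacing them by
   s + 3l - 1 and s + 2l preserves the size and lowers the number of l-hooks by
   exactly one, whatever the parts outside the window are.  Averaging
   cos (phi * #hooks - psi) over these independent swaps yields a factor
   cos (phi / 2) for every window in one of the two configurations, so for phi a
   nonzero multiple of 2 pi / b, the number of partitions with #hooks = a mod b
   differs from p(n) / b by at most the sum over the partitions of n of
   c ^ (number of windows in the lower configuration), with c < 1.  That sum is
   bounded by Rankin's trick at q = e^-t with t = sqrt (pi^2 / (6 n)): each of the
   about 1/t windows with 5lwt in [1, 2] costs a constant factor, so that the
   deviation is exponentially small in 1/t relative to q^-n prod (1 - q^k)^-1.
   The Hardy-Ramanujan formula with relative error O(t) comes from the saddle point
   method at the same t; Euler's product is expanded by the midpoint rule with the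
   dilogarithm as antiderivative, Stirling's formula providing the term
   ln t / 2 - ln (2 pi) / 2. *)

(** * Swapping two parts inside a window *)

(** A row notices only those later parts that reach into its last [l] columns. This locality
    dictates the four sizes: the sizes from [s + 4l] on are left empty, so that no longer row can
    tell the two configurations apart, and the smallest size used is [s + l], so that the parts up
    to [s] are out of sight. Rankin's bound exceeds the true order of p(n) by a factor t^(-3/2)
    only, which the exponentially small saving of the windows pays for. The saddle point is
    approximate: at [n = zeta2 / t^2] the logarithmic derivative of Euler's product misses [n] by
    O(1/t). On the relevant scale th ~ t^(3/2) this leaves a phase of order t^(1/2), and so does the
    cubic Taylor term. As p(n) is the integral of a real cosine, a phase enters only through its
    square, and both cost O(t), that is O(n^(-1/2)). Euler's product is cut at a finite [N >= n],
    which keeps the coefficient of q^n exact; the estimates are uniform in large [N]. *)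

Definition row_hooks (l x : nat) (la : seq nat) : nat :=
  count (fun j => x - j + count (ltn j) la == l) (iota 0 x).

Lemma count_flatten_allpairs l (f : nat -> nat -> nat) (g : nat -> seq nat) s :
  count_mem l [seq f k j | k <- s, j <- g k] =
  sumn [seq count (fun j => f k j == l) (g k) | k <- s].
Proof.
rewrite count_flatten -map_comp; congr sumn.
by apply: eq_map => k /=; rewrite count_map; apply: eq_count.
Qed.

Lemma num_hooks_cons l x la : all (geq x) la ->
  num_hooks l (x :: la) = row_hooks l x la + num_hooks l la.
Proof.
move=> xla; rewrite /num_hooks /hook_lengths !count_flatten_allpairs /=.
congr (_ + _).
  apply: eq_in_count => j; rewrite mem_iota add0n => /= jx.
  by rewrite /hook_length /conjpart /= jx; congr (_ == _); lia.
rewrite (iotaDl 1 0) -map_comp; congr sumn; apply/eq_in_map => k.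
rewrite mem_iota add0n => /= ks; apply: eq_in_count => j.
rewrite mem_iota add0n => /= jk; rewrite /hook_length /conjpart /=.
have := allP xla _ (mem_nth 0 ks) => /= xk.
by rewrite (leq_trans jk xk) !add0n; congr (_ == _); case: (count _ _) => *; lia.
Qed.

(** A node with hook length [l] has arm shorter than [l], so it lies in one of the last [l] columns
    of its row; elsewhere both indicators vanish. *)
Lemma eq_row_hooks l x la1 la2 :
  (forall j, x <= j + l -> j < x -> count (ltn j) la1 = count (ltn j) la2) ->
  row_hooks l x la1 = row_hooks l x la2.
Proof.
move=> H; apply: eq_in_count => j; rewrite mem_iota add0n /= => jx.
have [jl|jl] := leqP x (j + l); first by rewrite H.
by apply/eqP/eqP; lia.
Qed.

Lemma count_ltn_small j la : all (geq j) la -> count (ltn j) la = 0.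
Proof.
move=> H; apply/eqP; rewrite eqn0Ngt -has_count -all_predC.
by apply: sub_all H => y /=; rewrite -leqNgt.
Qed.

Lemma row_hooks_nil l x : 0 < l -> l <= x -> row_hooks l x [::] = 1.
Proof.
move=> l0 lx; rewrite /row_hooks.
rewrite (eq_in_count (a2 := pred1 (x - l))).
  by rewrite count_uniq_mem ?iota_uniq// mem_iota; lia.
by move=> j; rewrite mem_iota /= => H; lia.
Qed.

(** The last [l] columns of the row start at [x - l >= y], past the end of the part [y], so the row
    behaves as if nothing lay below it. *)
Lemma row_hooks_gap l x y : 0 < l -> l + y <= x -> row_hooks l x [:: y] = 1.
Proof.
move=> l0 lx; rewrite -(@row_hooks_nil l x)//; last lia.
by apply: eq_row_hooks => j /= jl jx; lia.
Qed.

(** The only candidate column [x - l] is the last column of [y]: its node gets leg 1 and hook length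
    [l + 1], and the nodes further right have arms too short. *)
Lemma row_hooks_near l x y : x + 1 = l + y -> row_hooks l x [:: y] = 0.
Proof.
move=> lx; apply/eqP; rewrite eqn0Ngt -has_count -all_predC.
apply/allP => j; rewrite mem_iota /= => H; lia.
Qed.

(** In the upper pair the parts differ by at least [l], so each row has one [l]-hook; in the lower
    pair they differ by [l - 1], and the first row loses its [l]-hook. Rows of [u] matter only in
    columns from [s + 4 * l] on, which neither pair reaches; rows of [v] lie below the pair and do
    not see it. *)
Lemma num_hooks_swap l u v s : 0 < l ->
  all (leq (s + 5 * l)) u -> all (geq s) v -> sorted geq u -> sorted geq v ->
  num_hooks l (u ++ [:: s + 4 * l - 1, s + l & v]) =
  (num_hooks l (u ++ [:: s + 3 * l - 1, s + 2 * l & v])).+1.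
Proof.
move=> l0; elim: u => [_ vs _ sv|x u IH] /=.
  have H y : s <= y -> all (geq y) v by move=> sy; apply: sub_all vs => z /=; lia.
  rewrite !num_hooks_cons/= ?H; try lia.
  (* The last [l] columns of a row of length at least [s + l] start at [s] or later, where the parts
     of [v] have no nodes. *)
  have E y w : s + l <= y -> row_hooks l y (w ++ v) = row_hooks l y w.
    move=> sy; apply: eq_row_hooks => j jl jy.
    by rewrite count_cat (count_ltn_small (la := v)) ?addn0// H; lia.
  rewrite (E _ [::]) ?(E _ [::]) ?(E _ [:: _]) ?(E _ [:: _]); try lia.
  rewrite !row_hooks_nil ?(@row_hooks_gap l (s + 4 * l - 1)) ?(@row_hooks_near l (s + 3 * l - 1)); lia.
move=> /andP[sx su] vs xu sv.
have {}IH := IH su vs (path_sorted xu) sv.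
have xu' : all (geq x) u.
  by apply: order_path_min xu => a b c; rewrite /geq /=; lia.
rewrite !num_hooks_cons ?all_cat ?xu'/=; first last.
- by rewrite (sub_all _ vs) => [|z /=]; lia.
- by rewrite (sub_all _ vs) => [|z /=]; lia.
rewrite IH addnS; congr (_ + _).+1; apply: eq_row_hooks => j jl jx.
by rewrite !count_cat /=; lia.
Qed.

Lemma geq_trans : transitive geq.
Proof. by move=> a b c; rewrite /geq /=; lia. Qed.

Lemma geq_anti : antisymmetric geq.
Proof. by move=> a b; rewrite /geq /=; lia. Qed.

Lemma sorted_geq_split s la : sorted geq la ->
  la = [seq x <- la | s < x] ++ [seq x <- la | x <= s].
Proof.
elim: la => //= x la IH xla; rewrite [in LHS](IH (path_sorted xla)).
have [//|xs] := ltnP s x.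
have la_le : all (geq s) la.
  by apply: sub_all (order_path_min geq_trans xla) => y /= yx; apply: leq_trans xs.
have E1 : [seq y <- la | s < y] = [::].
  apply/eqP; rewrite -[_ == _]negbK -has_filter; apply/hasPn => y yla.
  by rewrite -leqNgt; exact: (allP la_le).
have E2 : [seq y <- la | y <= s] = la by apply/all_filterP.
by rewrite E1 E2.
Qed.

Section Window.
Variables l w : nat.
Let s := 5 * l * w.

Definition win_hi (la : seq nat) := [seq x <- la | s + 5 * l < x].
Definition win_mid (la : seq nat) := [seq x <- la | s < x <= s + 5 * l].
Definition win_lo (la : seq nat) := [seq x <- la | x <= s].
Definition stateA := [:: s + 3 * l - 1; s + 2 * l].
Definition stateB := [:: s + 4 * l - 1; s + l].
Definition swap_state (m : seq nat) :=
  if m == stateA then stateB else if m == stateB then stateA else m.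
Definition flip (la : seq nat) := win_hi la ++ swap_state (win_mid la) ++ win_lo la.

Lemma window_split la : sorted geq la ->
  la = win_hi la ++ win_mid la ++ win_lo la.
Proof.
move=> sla; rewrite [LHS](sorted_geq_split (s + 5 * l) sla); congr (_ ++ _).
rewrite [LHS](sorted_geq_split s) ?sorted_filter//; last exact: geq_trans.
rewrite -!filter_predI; congr (_ ++ _); apply: eq_filter => x //=.
by rewrite /s; lia.
Qed.

Hypothesis l_gt0 : 0 < l.

Lemma stateAB : (stateA == stateB) = false.
Proof. by rewrite /stateA /stateB !eqseq_cons; lia. Qed.

Lemma swap_stateK : involutive swap_state.
Proof.
move=> m; rewrite /swap_state.
have [->|mA] := eqVneq m stateA; first by rewrite eqxx eq_sym stateAB.
have [->|mB] := eqVneq m stateB; first by rewrite eqxx.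
by rewrite (negbTE mA) (negbTE mB).
Qed.

Lemma all_swap_state (P : pred nat) m :
  (forall x, s < x <= s + 5 * l -> P x) -> all P m -> all P (swap_state m).
Proof.
move=> H Pm; rewrite /swap_state; case: eqP => _.
  by rewrite /= !H//; lia.
by case: eqP => _ //; rewrite /= !H//; lia.
Qed.

Lemma sorted_swap_state m : sorted geq m -> sorted geq (swap_state m).
Proof.
rewrite /swap_state => sm; case: eqP => _; first by rewrite /= andbT /geq /=; lia.
by case: eqP => _//=; rewrite andbT /geq /=; lia.
Qed.

Lemma sumn_swap_state m : sumn (swap_state m) = sumn m.
Proof.
rewrite /swap_state; case: eqP => [->|_]; first by rewrite /=; lia.
by case: eqP => [->|//]; rewrite /=; lia.
Qed.

Lemma win_mid_all la : all (fun x => s < x <= s + 5 * l) (win_mid la).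
Proof. exact: filter_all. Qed.

Lemma swap_mid_all la : all (fun x => s < x <= s + 5 * l) (swap_state (win_mid la)).
Proof. by apply: all_swap_state => //; exact: filter_all. Qed.

(** The swap changes only parts inside the window, so a filter blind to the window is unaffected.
    This gives both that the flip is an involution and that flips in different windows do not
    interfere. *)
Lemma filter_flip (P : pred nat) la :
  (forall x, s < x <= s + 5 * l -> P x = false) -> sorted geq la ->
  seq.filter P (flip la) = seq.filter P la.
Proof.
move=> H sla; rewrite [in RHS](window_split sla) /flip !filter_cat.
congr (_ ++ (_ ++ _)).
have E m : all (fun x => s < x <= s + 5 * l) m -> seq.filter P m = [::].
  move=> /allP am; apply/eqP; rewrite -(negbK (_ == _)) -has_filter.
  by apply/hasPn => x /am /H ->.
by rewrite !E// ?swap_mid_all ?win_mid_all.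
Qed.

Lemma win_mid_flip la : win_mid (flip la) = swap_state (win_mid la).
Proof.
rewrite {1}/win_mid /flip !filter_cat.
have /all_filterP -> := swap_mid_all la.
rewrite -2!filter_predI (eq_filter (a2 := pred0)) ?filter_pred0 => [|x /=]; last lia.
rewrite (eq_filter (a2 := pred0)) ?filter_pred0 ?cats0// => x /=; lia.
Qed.

Lemma flipK la : sorted geq la -> flip (flip la) = la.
Proof.
move=> sla; rewrite [RHS](window_split sla) [LHS]/flip win_mid_flip swap_stateK.
congr (_ ++ (_ ++ _)); rewrite [LHS]filter_flip // => x; lia.
Qed.

Lemma sorted_geq_cat a b c s1 s2 : s1 <= s2 -> sorted geq a -> sorted geq b -> sorted geq c ->
  all (ltn s2) a -> all (fun x => s1 < x <= s2) b -> all (geq s1) c ->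
  sorted geq (a ++ b ++ c).
Proof.
move=> s12.
rewrite !(sorted_pairwise geq_trans) !pairwise_cat => -> -> -> /allP sa /allP sb /allP sc.
rewrite !andbT; apply/andP; split; apply/allrelP => x y.
  by move=> /sa + ; rewrite mem_cat => /= xs /orP[/sb|/sc] /=; rewrite /geq /=; lia.
by move=> /sb + /sc; rewrite /geq /=; lia.
Qed.

Lemma sorted_flip la : sorted geq la -> sorted geq (flip la).
Proof.
move=> sla; apply: (@sorted_geq_cat _ _ _ s (s + 5 * l)); rewrite ?leq_addr//.
- exact: sorted_filter geq_trans _ _ sla.
- by apply: sorted_swap_state; apply: sorted_filter geq_trans _ _ sla.
- exact: sorted_filter geq_trans _ _ sla.
- exact: filter_all.
- exact: swap_mid_all.
- exact: filter_all.
Qed.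

Lemma flip_is_partition n la : is_partition n la -> is_partition n (flip la).
Proof.
move=> /and3P[sla la1 /eqP <-]; apply/and3P; split; first exact: sorted_flip.
  move: la1; rewrite [in X in X -> _](window_split sla) !all_cat => /and3P[-> m1 ->].
  by rewrite andbT /=; apply: all_swap_state m1 => x; lia.
by rewrite [in X in _ == X](window_split sla) !sumn_cat sumn_swap_state.
Qed.

Lemma num_hooks_flip la : sorted geq la ->
  [/\ win_mid la = stateA -> num_hooks l (flip la) = (num_hooks l la).+1,
      win_mid la = stateB -> (num_hooks l (flip la)).+1 = num_hooks l la &
      win_mid la != stateA -> win_mid la != stateB -> flip la = la].
Proof.
move=> sla.
have H : num_hooks l (win_hi la ++ stateB ++ win_lo la) =
   (num_hooks l (win_hi la ++ stateA ++ win_lo la)).+1.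
  apply: num_hooks_swap => //; try exact: sorted_filter geq_trans _ _ sla.
    by apply: sub_all (filter_all _ _) => x /=; lia.
  exact: filter_all.
split=> [mA|mB|mA mB].
- by rewrite [in RHS](window_split sla) /flip /swap_state mA eqxx H.
- by rewrite [in RHS](window_split sla) /flip /swap_state mB eq_sym stateAB eqxx H.
- by rewrite [RHS](window_split sla) /flip /swap_state (negbTE mA) (negbTE mB).
Qed.

End Window.

Lemma win_mid_flip_neq l w w' la : 0 < l -> w != w' -> sorted geq la ->
  win_mid l w' (flip l w la) = win_mid l w' la.
Proof.
move=> l0 ww sla; apply: filter_flip => // x xw; apply/negP => xw'.
have : w < w' \/ w' < w by lia.
by case=> H; nia.
Qed.

Section IntpartFlip.
Variables (l n : nat).
Hypothesis l_gt0 : 0 < l.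

Definition intpart_flip w (la : intpart n) : intpart n :=
  Intpart (flip_is_partition w l_gt0 (valP la)).

Lemma intpart_sorted (la : intpart n) : sorted geq la.
Proof. by case/and3P: (valP la). Qed.

Lemma intpart_flipK w : involutive (intpart_flip w).
Proof. by move=> la; apply: val_inj; apply: flipK => //; exact: intpart_sorted. Qed.

End IntpartFlip.

Lemma sumn_count (N : nat) la : all (fun x => 0 < x <= N) la ->
  sumn la = \sum_(k < N) k.+1 * count_mem k.+1 la.
Proof.
elim: la => [_|x la IH].
  by rewrite big1 // => k _; rewrite muln0.
rewrite -[all _ _]/((0 < x <= N) && all _ la) => /andP[/andP[x0 xN] /IH E].
rewrite -[sumn _]/(x + sumn la) E.
rewrite [RHS](eq_bigr (fun k : 'I_N => k.+1 * (x == k.+1) + k.+1 * count_mem k.+1 la)).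
  2: by move=> k _; rewrite -mulnDr.
rewrite [RHS]big_split /=; congr (_ + _).
have xN' : x.-1 < N by lia.
rewrite (bigD1 (Ordinal xN')) //= big1 ?addn0 => [|k]; first by rewrite prednK// eqxx muln1.
rewrite -val_eqE /= => kx; case: eqP => [|_]; last by rewrite muln0.
by move=> xk; move: kx; rewrite xk eqxx.
Qed.

Lemma sum_block w L (F : nat -> nat) :
  \sum_(w * L <= j < w.+1 * L) F j = \sum_(i < L) F (w * L + i).
Proof.
rewrite -[X in index_iota X _]add0n big_addn mulSn addnK big_mkord.
by apply: eq_bigr => i _; rewrite addnC.
Qed.

Lemma is_partition_bounds n N la : n <= N -> is_partition n la ->
  all (fun x => 0 < x <= N) la.
Proof.
move=> nN pla; have /and3P[_ /allP la1 _] := pla.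
apply/allP => x xla; rewrite la1//=.
by apply: leq_trans nN; apply: mem_is_partition pla xla.
Qed.

Lemma count_is_partition n la k : is_partition n la -> count_mem k la <= n.
Proof.
move=> /size_is_partition; apply: leq_trans; exact: count_size.
Qed.

Lemma intpart_eq n (la1 la2 : intpart n) :
  (forall k, 0 < k <= n -> count_mem k la1 = count_mem k la2) -> la1 = la2.
Proof.
move=> H; apply: val_inj; apply: (sorted_eq geq_trans geq_anti); try exact: intpart_sorted.
apply/allP => k; rewrite mem_cat => kla /=; apply/eqP/H.
have [b1 b2] := (is_partition_bounds (leqnn n) (valP la1),
                 is_partition_bounds (leqnn n) (valP la2)).
by case/orP: kla => [/(allP b1)|/(allP b2)].
Qed.

(** A partition is its table of multiplicities. Cutting the parts at [N >= n] and the multiplicities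
    below [M > n] loses no partition of [n], and sums over such tables factor into products of
    finite sums. *)
Lemma card_mult_ffun (n N M : nat) : n <= N -> n < M ->
  #|[set m : {ffun 'I_N -> 'I_M} | \sum_(k < N) k.+1 * m k == n]| = npart n.
Proof.
case: M => // M nN nM.
pose mult (la : intpart n) : {ffun 'I_N -> 'I_M.+1} := [ffun k : 'I_N => inord (count_mem k.+1 la)].
have mult_val la k : mult la k = count_mem k.+1 la :> nat.
  by rewrite ffunE inordK// (leq_ltn_trans _ nM)// (count_is_partition _ (valP la)).
have mult_inj : injective mult.
  move=> la1 la2 /ffunP E; apply: intpart_eq => k /andP[k0 kn].
  have kN : k.-1 < N by lia.
  have := congr1 val (E (Ordinal kN)); rewrite /= !mult_val /= prednK//.
rewrite /npart -cardsT -(card_imset _ mult_inj); apply: eq_card => m.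
rewrite inE; apply/eqP/imsetP => [mn|[la _ ->]]; last first.
  under eq_bigr do rewrite mult_val.
  have /and3P[_ _ /eqP sn] := valP la.
  by rewrite -(sumn_count (is_partition_bounds nN (valP la))).
pose s := flatten [seq nseq (m k) k.+1 | k <- enum 'I_N].
have cs (k : 'I_N) : count_mem k.+1 (sort geq s) = m k.
  rewrite (permP (permEl (perm_sort geq s))) count_flatten -map_comp sumnE big_map big_enum /=.
  rewrite (bigD1 k)//= count_nseq /= eqxx mul1n big1 ?addn0// => i ik.
  by rewrite count_nseq /= eqSS (inj_eq val_inj) (negbTE ik).
have bs : all (fun x => 0 < x <= N) (sort geq s).
  rewrite (perm_all _ (permEl (perm_sort geq s))); apply/allP => x /flatten_mapP[k _].
  by rewrite mem_nseq => /andP[_ /eqP ->] /=.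
have ps : is_partition n (sort geq s).
  apply/and3P; split; first by apply: sort_sorted => a b; rewrite /geq /=; lia.
    by apply: sub_all bs => x /andP[].
  by rewrite (sumn_count bs) -mn; apply/eqP/eq_bigr => k _; rewrite cs.
exists (Intpart ps) => //; apply/ffunP => k; apply/ord_inj.
by rewrite mult_val [count_mem _ _]cs.
Qed.

Local Open Scope ring_scope.

Definition in_stateA (l w : nat) (la : seq nat) : bool := win_mid l w la == stateA l w.
Definition in_stateB (l w : nat) (la : seq nat) : bool := win_mid l w la == stateB l w.

(** * Averaging over the swaps *)

Section Switching.
Variables (R : realType) (l n : nat).
Hypothesis l_gt0 : (0 < l)%N.
Variables phi psi : R.

Let sw W (la : seq nat) : nat := (\sum_(w < W) (in_stateA l w la || in_stateB l w la))%N.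
Let sg W (la : seq nat) : R := \sum_(w < W) ((in_stateA l w la)%:R - (in_stateB l w la)%:R).
(* The average of [cos (phi * num_hooks - psi)] over the orbit of [la] under the
   swaps in the first [W] windows. *)
Let F W (la : seq nat) : R :=
  cos (phi / 2) ^+ sw W la * cos (phi * ((num_hooks l la)%:R + sg W la / 2) - psi).

(** The mean of cos x and cos (x + phi) is cos (phi / 2) cos (x + phi / 2). The midpoint of the two
    hook numbers lies half a hook above that of a lower configuration and half a hook below that of
    an upper one, whence the signs in [sg]; in neither configuration the flip is the identity. *)
Lemma switch_flip W (la : intpart n) : let la' := intpart_flip l_gt0 W la in
  (F W la + F W la') / 2 = F W.+1 la.
Proof.
set la' := intpart_flip l_gt0 W la => /=.
have sla := intpart_sorted la.
have E w : (w < W)%N -> win_mid l w la' = win_mid l w la.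
  by move=> wW; rewrite win_mid_flip_neq// gtn_eqF.
have Esw : sw W la' = sw W la.
  by apply: eq_bigr => w _; rewrite /in_stateA /in_stateB E.
have Esg : sg W la' = sg W la.
  by apply: eq_bigr => w _; rewrite /in_stateA /in_stateB E.
rewrite /F Esw Esg /sw /sg !big_ord_recr /= -/(sw W la) -/(sg W la).
have [hA hB hN] := num_hooks_flip W l_gt0 sla.
have halve (x y : R) : (cos (x - y) + cos (x + y)) / 2 = cos y * cos x.
  by rewrite cosB cosD; field.
case: (boolP (in_stateA l W la)) => [|] iA.
  have /negbTE-> : ~~ in_stateB l W la.
    by rewrite /in_stateB (eqP iA) stateAB.
  rewrite [num_hooks l la']hA ?(eqP iA)//= -mulrDr -mulrA.
  rewrite addn1 exprSr -[in RHS]mulrA; congr (_ * _).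
  rewrite -halve; congr ((cos _ + cos _) / _); rewrite -?natr1; by field.
case: (boolP (in_stateB l W la)) => [|] iB /=.
  rewrite -(hB (eqP iB)).
  rewrite -mulrDr -mulrA addn1 exprSr -[in RHS]mulrA; congr (_ * _).
  rewrite -halve [X in X / 2 = _]addrC; congr ((cos _ + cos _) / _); rewrite -?natr1 ?sub0r; by field.
rewrite [num_hooks l la'](_ : _ = num_hooks l la); last by rewrite /la' /= hN.
by rewrite addn0 subr0 addr0; field.
Qed.

Lemma sum_switch W : \sum_(la : intpart n) F W la = \sum_(la : intpart n) F W.+1 la.
Proof.
under [RHS]eq_bigr do rewrite -switch_flip.
rewrite -mulr_suml big_split /= [X in _ + X](reindex_inj (inv_inj (intpart_flipK l_gt0 W))) /=.
rewrite [X in _ + X](eq_bigr (fun la : intpart n => F W la)) => [|la _]; first by field.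
by rewrite flipK// intpart_sorted.
Qed.

Lemma cos_sum_bound (c : R) W : `|cos (phi / 2)| <= c -> c <= 1 ->
  `|\sum_(la : intpart n) cos (phi * (num_hooks l la)%:R - psi)| <=
  \sum_(la : intpart n) c ^+ (\sum_(w < W) in_stateA l w la)%N.
Proof.
move=> phic c1; have c0 : 0 <= c := le_trans (normr_ge0 _) phic.
have -> : \sum_(la : intpart n) cos (phi * (num_hooks l la)%:R - psi) =
          \sum_(la : intpart n) F W la.
  elim: W => [|W ->]; last exact: sum_switch.
  by apply: eq_bigr => la _; rewrite /F /sw /sg !big_ord0 mul0r addr0 expr0 mul1r.
apply: le_trans (ler_norm_sum _ _ _) _; apply: ler_sum => la _.
rewrite /F normrM normrX -[leRHS]mulr1; apply: ler_pM; rewrite ?exprn_ge0 ?cos_max//.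
apply: (@le_trans _ _ (c ^+ sw W la)); first by apply: lerXn2r; rewrite ?nnegrE.
(* Windows in the upper configuration are dropped from the exponent, which only weakens the bound as
   [c <= 1]; Rankin's product then has to modify a single monomial per window. *)
by apply: ler_wiXn2l => //; apply: leq_sum => w _; case: in_stateA; case: in_stateB.
Qed.

End Switching.

(** * Detecting a residue class by cosines *)

Section RootsOfUnity.
Variable R : realType.

Lemma cos_shift_int (x : R) (m : int) : cos (x + m%:~R * (pi *+ 2)) = cos x.
Proof.
case: m => m; first by rewrite -pmulrn mulr_natl (periodicn (@cosD2pi R)).
rewrite NegzE mulrNz mulNr -pmulrn mulr_natl.
by rewrite -[in RHS](subrK (pi *+ 2 *+ m.+1) x) (periodicn (@cosD2pi R)).
Qed.

Lemma sin_shift_int (x : R) (m : int) : sin (x + m%:~R * (pi *+ 2)) = sin x.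
Proof.
by rewrite -!cosBpihalf addrAC cos_shift_int.
Qed.

(** Orthogonality of the [b]-th roots of unity in real form: for [m] not divisible by [b],
    multiplying by 2 sin x with x = pi m / b makes the sum telescope over a whole number of
    turns. *)
Lemma sum_cos_filter (b : nat) (m : int) : (0 < b)%N ->
  \sum_(j < b) cos (pi *+ 2 * j%:R * m%:~R / b%:R : R) = if (b%:Z %| m)%Z then b%:R else 0.
Proof.
move=> b0; have bn0 : (b%:R : R) != 0 by rewrite pnatr_eq0 -lt0n.
case: ifPn => [/dvdzP[k ->]|bm].
  rewrite (eq_bigr (fun=> 1)) => [|j _]; first by rewrite sumr_const card_ord.
  rewrite (_ : _ / _ = 0 + (j%:Z * k)%:~R * (pi *+ 2)) ?cos_shift_int ?cos0//.
  by rewrite !intrM -!pmulrn; field.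
set x : R := pi * m%:~R / b%:R.
(* x = pi m / b is not a multiple of pi: modulo pi it equals pi r / b with 0 < r < b, where the sine
   is positive. *)
have sx : sin x != 0.
  apply/eqP => sx0.
  pose k := (m %/ b)%Z; pose r := (m %% b)%Z.
  have r0 : (0 < r%:~R :> R).
    rewrite ltr0z lt_neqAle eq_sym modz_ge0 ?andbT; last by rewrite eqz_nat -lt0n.
    by apply: contra bm => /eqP rm; apply/dvdz_mod0P.
  have rb : (r%:~R < b%:R :> R) by rewrite pmulrn ltr_int ltz_pmod.
  have sr : 0 < sin (pi * r%:~R / b%:R : R).
    apply: sin_gt0_pi; rewrite !mulr_gt0 ?pi_gt0 ?invr_gt0 ?ltr0n//=.
    by rewrite ltr_pdivrMr ?ltr0n// ltr_pM2l// pi_gt0.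
  have : `|cos x| = 1 by apply: sin0cos1.
  have -> : x = pi * r%:~R / b%:R + k%:~R * pi.
    rewrite /x [in LHS](divz_eq m b) intrD intrM -pmulrn; by field.
  have H (y : R) (j : int) : `|cos (y + j%:~R * pi)| = `|cos y|.
    have Hn (z : R) (i : nat) : `|cos (z + pi *+ i)| = `|cos z|.
      by rewrite (alternatingn (@cosDpi R)) normrM normrX normrN1 expr1n mul1r.
    case: j => j; first by rewrite -pmulrn mulr_natl Hn.
    by rewrite NegzE mulrNz mulNr -pmulrn mulr_natl -[in RHS](subrK (pi *+ j.+1) y) Hn.
  by rewrite H => /cos1sin0 s0; rewrite s0 ltxx in sr.
have tel j : sin x * 2 * cos (pi *+ 2 * j%:R * m%:~R / b%:R) =
    sin (x * 2 * j.+1%:R - x) - sin (x * 2 * j%:R - x).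
  have -> : pi *+ 2 * j%:R * m%:~R / b%:R = x * 2 * j%:R by rewrite /x; field.
  have -> : x * 2 * j.+1%:R - x = x * 2 * j%:R + x by rewrite -natr1; ring.
  rewrite sinB sinD; ring.
have : sin x * 2 * \sum_(j < b) cos (pi *+ 2 * j%:R * m%:~R / b%:R) = 0.
  rewrite mulr_sumr (eq_bigr _ (fun (j : 'I_b) _ => tel j)).
  rewrite -(big_mkord xpredT (fun j => sin (x * 2 * j.+1%:R - x) - sin (x * 2 * j%:R - x))).
  rewrite telescope_sumr//.
  have -> : x * 2 * b%:R - x = - x + m%:~R * (pi *+ 2) by rewrite /x; field.
  by rewrite sin_shift_int mulr0 sub0r subrr.
move/eqP; rewrite !mulf_eq0 (negbTE sx) pnatr_eq0 /=.
by move/eqP.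
Qed.

(** None of the pi j / b with 0 < j < b is a multiple of pi, so the bound is a maximum of finitely
    many values below 1, built up by induction; it is 0 when there is no such j. *)
Lemma cos_pi_frac_lt1 (b : nat) : (0 < b)%N ->
  exists2 c : R, 0 <= c < 1 & forall j, (0 < j < b)%N -> `|cos (pi * j%:R / b%:R)| <= c.
Proof.
move=> b0.
have H j : (0 < j < b)%N -> `|cos (pi * j%:R / b%:R : R)| < 1.
  move=> /andP[j0 jb].
  rewrite lt_neqAle cos_max andbT norm_cos_eq1 gt_eqF// sin_gt0_pi//.
  rewrite !mulr_gt0 ?pi_gt0 ?invr_gt0 ?ltr0n//=.
  by rewrite ltr_pdivrMr ?ltr0n// ltr_pM2l ?pi_gt0// ltr_nat.
suff [c c1 cP] : exists2 c : R, 0 <= c < 1 & forall j, (j < b)%N -> (0 < j)%N ->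
    `|cos (pi * j%:R / b%:R)| <= c.
  by exists c => // j /andP[j0 jb]; apply: cP.
have {}H : forall b', (b' <= b)%N -> exists2 c : R, 0 <= c < 1 &
    forall j, (j < b')%N -> (0 < j)%N -> `|cos (pi * j%:R / b%:R)| <= c.
  elim=> [_|b' IH b'b]; first by exists 0; rewrite ?lexx ?ltr01.
  have [c /andP[c0 c1] cP] := IH (ltnW b'b).
  have [->|b'0] := posnP b'; first by exists 0 => [|[]//]; rewrite ?lexx ?ltr01.
  exists (Num.max c `|cos (pi * b'%:R / b%:R)|).
    by rewrite le_max c0 /= gt_max c1 H// b'0.
  move=> j; rewrite ltnS leq_eqVlt => /predU1P[-> _|jb j0]; rewrite le_max ?lexx ?orbT//.
  by rewrite cP.
exact: H.
Qed.

(** The congruence is detected by averaging cosines over the frequencies 2 pi j / b. Frequency 0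
    contributes p(n) / b; at the others half the frequency is pi j / b, so one [c < 1] serves them
    all, and being fewer than [b] they contribute on average at most the bound for a single one. *)
Lemma npart_hooks_deviation (l b : nat) (a : int) : (0 < l)%N -> (0 < b)%N ->
  exists2 c : R, 0 <= c < 1 & forall n W,
  `|(npart_hooks l a b n)%:R - (npart n)%:R / b%:R| <=
  \sum_(la : intpart n) c ^+ (\sum_(w < W) in_stateA l w la)%N.
Proof.
case: b => [//|b] l0 b0; have [c c01 cP] := cos_pi_frac_lt1 b0; exists c => // n W.
have bn0 : (b.+1%:R : R) != 0 by rewrite pnatr_eq0 -lt0n.
have bp : (0 : R) < b.+1%:R by rewrite ltr0n.
pose x (j : nat) : R := pi *+ 2 * j%:R / b.+1%:R.
pose S j := \sum_(la : intpart n) cos (x j * (num_hooks l la)%:R - x j * a%:~R).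
have E : (npart_hooks l a b.+1 n)%:R = (\sum_(j < b.+1) S j) / b.+1%:R.
  rewrite /S exchange_big /= mulr_suml /npart_hooks cardsE -sum1_card natr_sum big_mkcond /=.
  apply: eq_bigr => la _.
  under eq_bigr => j _.
    rewrite (_ : x j * _ - _ = pi *+ 2 * j%:R * ((num_hooks l la)%:Z - a)%:~R / b.+1%:R); last first.
      rewrite /x intrB -pmulrn; move: (b.+1%:R : R) bn0 => B Bn0; by field.
    over.
  rewrite sum_cos_filter// -eqz_mod_dvd.
  rewrite [la \in _](_ : _ = ((num_hooks l la)%:Z == a %[mod b.+1%:Z])%Z)//.
  by case: ifP => _; rewrite ?divff// mul0r.
have S0 : S 0%N = (npart n)%:R.
  rewrite /S (eq_bigr (fun=> 1)) ?sumr_const /npart ?cardT//.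
  by move=> la _; rewrite /x mulr0 !mul0r subrr cos0.
set T := \sum_(la : intpart n) _.
have T0 : 0 <= T by apply: sumr_ge0 => la _; rewrite exprn_ge0//; case/andP: c01.
rewrite E -mulrBl normrM [`|b.+1%:R^-1|]ger0_norm ?invr_ge0 ?ler0n// ler_pdivrMr//.
rewrite big_ord_recl S0 [X in X - _]addrC addrK.
apply: le_trans (ler_norm_sum _ _ _) _.
apply: (@le_trans _ _ (\sum_(i < b) T)).
  apply: ler_sum => j _; apply: (@cos_sum_bound R l n l0 (x (lift ord0 j))
    (x (lift ord0 j) * a%:~R) c W); last by case/andP: c01 => _ /ltW.
  have -> : x (lift ord0 j) / 2 = pi * (lift ord0 j)%:R / b.+1%:R.
    by rewrite /x; move: (b.+1%:R : R) bn0 => B Bn0; field.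
  by apply: cP; rewrite lift0 /= ltnS.
by rewrite sumr_const card_ord -[leLHS]mulr_natr ler_wpM2l// ler_nat.
Qed.

End RootsOfUnity.

(** * Rankin's bound, window by window *)

Section WindowBound.
Variables (R : realType) (l : nat).
Hypothesis l_gt0 : (0 < l)%N.

(** A sorted list is determined by its multiplicities. Adding the two indicators covers [l = 1],
    where the two parts of [stateA] coincide and the multiplicity is 2. *)
Lemma in_stateA_count w la : sorted geq la ->
  (forall i, (i < 5 * l)%N -> count_mem (5 * l * w + i).+1 la =
    (((5 * l * w + i).+1 == 5 * l * w + 3 * l - 1) +
     ((5 * l * w + i).+1 == 5 * l * w + 2 * l))%N) -> in_stateA l w la.
Proof.
move=> sla H; apply/eqP; apply: (sorted_eq geq_trans geq_anti).
- exact: sorted_filter geq_trans _ _ sla.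
- by rewrite /stateA /= andbT /geq /=; lia.
apply/allP => k kin /=; apply/eqP.
have /andP[k1 k2] : (5 * l * w < k <= 5 * l * w + 5 * l)%N.
  move: kin; rewrite mem_cat => /orP[|].
    by rewrite /win_mid mem_filter => /andP[].
  by rewrite /stateA !inE => /orP[]/eqP ->; lia.
have -> : count_mem k (win_mid l w la) = count_mem k la.
  rewrite /win_mid count_filter; apply: eq_in_count => x _ /=.
  by case: eqP => // ->; rewrite k1 k2.
have := H (k - 5 * l * w).-1.
have -> : (5 * l * w + (k - 5 * l * w).-1).+1 = k by lia.
move=> ->; last lia.
by rewrite /stateA /= addn0 ![k == _]eq_sym.
Qed.

(* Rankin's trick: multiply by [q ^+ n], sum over all multiplicities of the parts up
   to [5 * l * W], and factor over the windows.  The last exponent is the total size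
   [(s + 3 * l - 1) + (s + 2 * l)] of [stateA], where [s = 5 * l * w]. *)
Lemma sum_pow_stateA_le (c q : R) (n W : nat) : 0 <= c <= 1 -> 0 < q < 1 ->
  (n <= W * (5 * l))%N ->
  \sum_(la : intpart n) c ^+ (\sum_(w < W) in_stateA l w la)%N <=
  q ^- n * \prod_(w < W) (\prod_(i < 5 * l) (1 - q ^+ (5 * l * w + i).+1)^-1
      - (1 - c) * q ^+ (10 * l * w + 5 * l - 1)).
Proof.
move=> /andP[c0 c1] /andP[q0 q1] nW.
set L := (5 * l)%N.
(* Multiplicities reach [n] in a partition of [n] and 2 in [stateA]; both must fit below [M]. *)
pose M := n.+3.
pose T := {ffun 'I_L -> 'I_M}.
have pA w : forall i : 'I_L, ((((L * w + i).+1 == L * w + 3 * l - 1) +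
     ((L * w + i).+1 == L * w + 2 * l)) < M)%N.
  by move=> i; case: (_ == _); case: (_ == _).
pose patA w : T := [ffun i => Ordinal (pA w i)].
pose deg w (m : T) := (\sum_(i < L) (L * w + i).+1 * m i)%N.
pose g w (m : T) : R := (if m == patA w then c else 1) * q ^+ deg w m.
have g0 w m : 0 <= g w m.
  by rewrite mulr_ge0 ?exprn_ge0 ?(ltW q0)//; case: ifP.
pose mult (la : intpart n) : {ffun 'I_W -> T} :=
  [ffun w : 'I_W => [ffun i : 'I_L => inord (count_mem (L * w + i).+1 la)]].
have mult_val la w i : mult la w i = count_mem (L * w + i).+1 la :> nat.
  rewrite !ffunE inordK//.
  by apply: leq_ltn_trans (count_is_partition _ (valP la)) _; rewrite /M; lia.
have L0 : (0 < L)%N by rewrite /L; lia.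
have decomp k : (0 < k <= W * L)%N ->
    exists (w : 'I_W) (i : 'I_L), k = (L * w + i).+1.
  move=> /andP[k0 kN].
  have wW : (k.-1 %/ L < W)%N by rewrite ltn_divLR//; lia.
  have iL : (k.-1 %% L < L)%N by rewrite ltn_mod.
  exists (Ordinal wW), (Ordinal iL); rewrite /= mulnC -divn_eq; lia.
have mult_inj : injective mult.
  move=> la1 la2 /ffunP E; apply: intpart_eq => k /andP[k0 kn].
  have /decomp[v [j ->]] : (0 < k <= W * L)%N by lia.
  by rewrite -(mult_val la1 v j) -(mult_val la2 v j) E.
have degE la : (\sum_(w < W) deg w (mult la w))%N = n.
  have /and3P[_ _ /eqP sn] := valP la.
  rewrite -[in RHS]sn (sumn_count (is_partition_bounds nW (valP la))).
  rewrite -(big_mkord xpredT (fun k => k.+1 * count_mem k.+1 la)%N) big_nat_mul/=.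
  rewrite big_mkord; apply: eq_bigr => w _; rewrite /deg.
  by rewrite sum_block; apply: eq_bigr => i _; rewrite mult_val (mulnC w) mulnC.
(* The degrees of the windows add up to [n]. A window whose table is [patA] is in [stateA] and
   carries the factor [c]; in the other windows the power of [c] is bounded by 1. *)
have gE (la : intpart n) : c ^+ (\sum_(w < W) in_stateA l w la)%N * q ^+ n <=
    \prod_(w < W) g w (mult la w).
  rewrite /g big_split /= -expr_sum degE ler_wpM2r ?exprn_ge0 ?(ltW q0)//.
  rewrite expr_sum; apply: ler_prod => w _; rewrite exprn_ge0//=.
  case: eqP => [E|_]; last by rewrite exprn_ile1.
  rewrite in_stateA_count ?expr1 ?intpart_sorted// => i iL.
  have := congr1 (fun m : T => m (Ordinal iL) : nat) E; rewrite mult_val /= => ->.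
  by rewrite ffunE.
rewrite mulrC ler_pdivlMr ?exprn_gt0// mulr_suml.
apply: le_trans (ler_sum _ (fun la _ => gE la)) _.
(* The weights being nonnegative, the sum is extended to all tables of multiplicities, over which it
   becomes a product over the windows. *)
apply: (@le_trans _ _ (\sum_(m : {ffun 'I_W -> T}) \prod_(w < W) g w (m w))).
  rewrite -(big_imset (fun m : {ffun 'I_W -> T} => \prod_(w < W) g w (m w)))/=; last by move=> ? ? _ _; apply: mult_inj.
  rewrite [leRHS](bigID (mem [set mult x | x in intpart n]))/= lerDl.
  by apply: sumr_ge0 => m _; apply: prodr_ge0 => w _.
rewrite -(bigA_distr_bigA (fun (w : 'I_W) (m : T) => g w m)) /=; apply: ler_prod => w _.
rewrite sumr_ge0//=.
rewrite (bigD1 (patA w))//= {1}/g eqxx.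
rewrite (eq_bigr (fun m => q ^+ deg w m)) => [|m /negbTE mA]; last by rewrite /g mA mul1r.
have dA : deg w (patA w) = (10 * l * w + 5 * l - 1)%N.
  rewrite /deg; under eq_bigr do rewrite ffunE /= mulnDr.
  have i1 : (3 * l - 2 < L)%N by rewrite /L; lia.
  have i2 : (2 * l - 1 < L)%N by rewrite /L; lia.
  rewrite big_split /= (bigD1 (Ordinal i1))//= [X in (_ + X + _)%N]big1 => [|i]; last first.
    rewrite -val_eqE /= => ii; case: eqP => [|_]; rewrite ?muln0//; lia.
  rewrite (bigD1 (Ordinal i2))//= [X in (_ + (_ + X))%N]big1 => [|i]; last first.
    rewrite -val_eqE /= => ii; case: eqP => [|_]; rewrite ?muln0//; lia.
  rewrite !addn0.
  have -> : ((L * w + (3 * l - 2)).+1 == L * w + 3 * l - 1)%N by lia.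
  have -> : ((L * w + (2 * l - 1)).+1 == L * w + 2 * l)%N by lia.
  by rewrite /L; nia.
(* With all weights 1 a window gives truncated geometric sums, at most the full ones. Giving the
   term of [patA] the weight [c] saves [1 - c] times its monomial. *)
have full : \sum_(m : T) q ^+ deg w m <= \prod_(i < L) (1 - q ^+ (L * w + i).+1)^-1.
  under eq_bigr => m _.
    rewrite /deg expr_sum; under eq_bigr do rewrite exprM. over.
  rewrite -(bigA_distr_bigA (fun (i : 'I_L) (j : 'I_M) => (q ^+ (L * w + i).+1) ^+ j)) /=.
  apply: ler_prod => i _; set r := q ^+ _.
  have r0 : 0 <= r by rewrite exprn_ge0// ltW.
  have r1 : r < 1 by rewrite exprn_ilt1 ?ltW.
  rewrite sumr_ge0 => [|j _]; last by rewrite exprn_ge0.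
  rewrite /= -[leRHS]mul1r ler_pdivlMr ?subr_gt0// mulrC -opprB mulNr -subrX1 opprB.
  by rewrite gerBl exprn_ge0.
rewrite (bigD1 (patA w))//= in full.
rewrite -dA; move: full; set X := \sum_(_ | _) _; set Y := \prod_(_ < _) _; set Z := q ^+ deg _ _.
by move=> full; lra.
Qed.

End WindowBound.

Local Open Scope classical_set_scope.
Local Open Scope ring_scope.

(** * Trigonometric sums, the Basel problem and Stirling's formula *)

Section PointwiseDerivatives.
Variable R : realType.
Implicit Types (f g : R -> R) (x a b c : R).

Lemma is_derive_pcst x c : is_derive x 1 (fun _ : R => c) 0.
Proof. exact: is_derive_cst. Qed.

Lemma is_derive_pid x : is_derive x 1 (fun y : R => y) 1.
Proof. exact: is_derive_id. Qed.

Lemma is_derive_pD f g x a b : is_derive x 1 f a -> is_derive x 1 g b ->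
  is_derive x 1 (fun y => f y + g y) (a + b).
Proof. by move=> fa gb; apply: is_deriveD. Qed.

Lemma is_derive_pN f x a : is_derive x 1 f a -> is_derive x 1 (fun y => - f y) (- a).
Proof. by move=> fa; apply: is_deriveN. Qed.

Lemma is_derive_pM f g x a b : is_derive x 1 f a -> is_derive x 1 g b ->
  is_derive x 1 (fun y => f y * g y) (f x * b + g x * a).
Proof. by move=> fa gb; apply: is_deriveM. Qed.

Lemma is_derive_pX f n x a : is_derive x 1 f a ->
  is_derive x 1 (fun y => f y ^+ n) (n%:R * f x ^+ n.-1 * a).
Proof.
move=> fa; have := is_deriveX n fa; rewrite /GRing.scale /=.
by congr is_derive; apply/funext => y; rewrite fctE.
Qed.

Lemma is_derive_pV f x a : f x != 0 -> is_derive x 1 f a ->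
  is_derive x 1 (fun y => (f y)^-1) (- (f x ^- 2) * a).
Proof. by move=> f0 fa; exact: is_deriveV. Qed.

Lemma is_derive_pexp f x a : is_derive x 1 f a ->
  is_derive x 1 (fun y => expR (f y)) (expR (f x) * a).
Proof. by move=> fa; apply: (@is_derive1_comp R expR f). Qed.

Lemma is_derive_pln f x a : 0 < f x -> is_derive x 1 f a ->
  is_derive x 1 (fun y => ln (f y)) ((f x)^-1 * a).
Proof. by move=> f0 fa; exact: (is_derive1_comp (is_derive1_ln f0) fa). Qed.

Lemma is_derive_psin f x a : is_derive x 1 f a ->
  is_derive x 1 (fun y => sin (f y)) (cos (f x) * a).
Proof. by move=> fa; apply: (@is_derive1_comp R (@sin R) f). Qed.

Lemma is_derive_pcos f x a : is_derive x 1 f a ->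
  is_derive x 1 (fun y => cos (f y)) (- sin (f x) * a).
Proof. by move=> fa; apply: (@is_derive1_comp R (@cos R) f). Qed.

Lemma is_derive_patan f x a : is_derive x 1 f a ->
  is_derive x 1 (fun y => atan (f y)) ((1 + f x ^+ 2)^-1 * a).
Proof. by move=> fa; apply: (@is_derive1_comp R (@atan R) f). Qed.

Lemma is_derive_cts f x a : is_derive x 1 f a -> {for x, continuous f}.
Proof. by move=> [fx _]; apply/differentiable_continuous; exact/derivable1_diffP. Qed.

Lemma is_derive_within f df a b : (forall x, a <= x <= b -> is_derive x 1 f (df x)) ->
  {within `[a, b], continuous f}.
Proof.
move=> H; apply: continuous_in_subspaceT => x /set_mem /=; rewrite in_itv /= => xab.
exact: is_derive_cts (H x xab).
Qed.

Lemma MVT_le f df a b : a <= b -> (forall x, a <= x <= b -> is_derive x 1 f (df x)) ->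
  exists2 c, a <= c <= b & f b - f a = df c * (b - a).
Proof.
move=> ab H.
have D x : x \in `]a, b[ -> is_derive x 1 f (df x).
  by rewrite in_itv /= => /andP[/ltW ? /ltW ?]; apply: H; apply/andP.
have [c cab E] := MVT_segment ab D (is_derive_within H).
by exists c => //; move: cab; rewrite in_itv.
Qed.

Lemma derive_ge0_le f df a b : a <= b ->
  (forall x, a <= x <= b -> is_derive x 1 f (df x)) ->
  (forall x, a <= x <= b -> 0 <= df x) -> f a <= f b.
Proof.
move=> ab H H0; have [c cab E] := MVT_le ab H.
by rewrite -subr_ge0 E mulr_ge0 ?H0// subr_ge0.
Qed.

Lemma derive_bound f df a b K : a <= b ->
  (forall x, a <= x <= b -> is_derive x 1 f (df x)) ->
  (forall x, a <= x <= b -> `|df x| <= K) -> `|f b - f a| <= K * (b - a).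
Proof.
move=> ab H H0; have [c cab ->] := MVT_le ab H.
by rewrite normrM [X in _ * X]ger0_norm ?subr_ge0// ler_wpM2r ?subr_ge0 ?H0.
Qed.

End PointwiseDerivatives.

Ltac derive_step :=
  first [ eapply is_derive_pcst | eapply is_derive_pid | eapply is_derive_pD
        | eapply is_derive_pN | eapply is_derive_pM | eapply is_derive_pX
        | eapply is_derive_pV | eapply is_derive_pexp | eapply is_derive_pln
        | eapply is_derive_psin | eapply is_derive_pcos | eapply is_derive_patan ].
Ltac derive_tac := eapply is_derive_eq; [ repeat derive_step | ].

Section Trig.
Variable R : realType.
Implicit Types x y : R.

Lemma sin_le_id x : 0 <= x -> sin x <= x.
Proof.
move=> x0; rewrite -subr_ge0.
have D y : is_derive y 1 (fun y : R => y - sin y) (1 - cos y) by derive_tac; ring.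
have := derive_ge0_le x0 (fun y _ => D y).
rewrite sin0 subr0; apply => y _; by rewrite subr_ge0 cos_le1.
Qed.

(** Integration of [sin y <= y]; the next two Taylor bounds arise in the same way, each from the one
    before. *)
Lemma cos_ge_quad x : 1 - x ^+ 2 / 2 <= cos x.
Proof.
wlog x0 : x / 0 <= x => [H|].
  have [/H//|x0] := leP 0 x.
  by rewrite -cosN -sqrrN; apply: H; lra.
have D y : is_derive y 1 (fun y : R => cos y - (1 - y ^+ 2 / 2)) (y - sin y).
  by derive_tac; rewrite /=; field.
have := derive_ge0_le x0 (fun y _ => D y).
rewrite cos0 expr0n /= mul0r subr0 subrr subr_ge0; apply => y /andP[y0 _].
by rewrite subr_ge0 sin_le_id.
Qed.

Lemma sin_ge_cubic x : 0 <= x -> x - x ^+ 3 / 6 <= sin x.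
Proof.
move=> x0.
have D y : is_derive y 1 (fun y : R => sin y - (y - y ^+ 3 / 6)) (cos y - (1 - y ^+ 2 / 2)).
  by derive_tac; rewrite /=; field.
have := derive_ge0_le x0 (fun y _ => D y).
rewrite sin0 expr0n /= mul0r !subr0 subr_ge0; apply => y _.
by rewrite subr_ge0 cos_ge_quad.
Qed.

Lemma cos_le_quart x : cos x <= 1 - x ^+ 2 / 2 + x ^+ 4 / 24.
Proof.
wlog x0 : x / 0 <= x => [H|].
  have [/H//|x0] := leP 0 x.
  by have := H (- x); rewrite cosN sqrrN -[4%N]/(2 * 2)%N !exprM sqrrN; apply; lra.
have D y : is_derive y 1 (fun y : R => (1 - y ^+ 2 / 2 + y ^+ 4 / 24) - cos y)
    (sin y - (y - y ^+ 3 / 6)).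
  by derive_tac; rewrite /=; field.
have := derive_ge0_le x0 (fun y _ => D y).
rewrite cos0 !expr0n /= !mul0r subr0 addr0 subrr subr_ge0; apply => y /andP[y0 _].
by rewrite subr_ge0 sin_ge_cubic.
Qed.

Lemma mul_cos_le_sin x : 0 <= x <= pi -> x * cos x <= sin x.
Proof.
move=> /andP[x0 xpi].
have D y : is_derive y 1 (fun y : R => sin y - y * cos y) (y * sin y).
  by derive_tac; rewrite /=; ring.
have := derive_ge0_le x0 (fun y _ => D y).
rewrite sin0 mul0r subr0 subr_ge0; apply => y /andP[y0 yx].
by rewrite mulr_ge0// sin_ge0_pi// y0 (le_trans yx).
Qed.

(** 1 / sin^2 = 1 + cot^2, and cot x <= 1 / x by [mul_cos_le_sin]. The gap of 1 is negligible in a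
    sum whose total has the order of the square of the number of terms. *)
Lemma inv_sin2_bounds x : 0 < x < pi / 2 ->
  x ^- 2 <= (sin x) ^- 2 <= x ^- 2 + 1.
Proof.
move=> /andP[x0 xpi]; have xp : 0 < x < pi / 2 by apply/andP.
have pi0 := pi_gt0 R.
have s0 : 0 < sin x by apply: sin_gt0_pihalf.
have c0 : 0 < cos x by apply: cos_gt0_pihalf; lra.
have x0' := ltW x0; have s0' := ltW s0.
apply/andP; split.
  by rewrite lef_pV2 ?posrE ?exprn_gt0// ler_sqr ?nnegrE//; apply: sin_le_id.
have -> : (sin x) ^- 2 = 1 + (cos x / sin x) ^+ 2.
  by rewrite expr_div_n cos2sin2; field; rewrite gt_eqF.
rewrite addrC lerD2r -[leRHS]exprVn ler_sqr ?nnegrE ?divr_ge0 ?invr_ge0 ?(ltW c0)//.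
rewrite ler_pdivrMr// mulrC -ler_pdivrMr ?invr_gt0// invrK mulrC.
by apply: mul_cos_le_sin; lra.
Qed.

End Trig.

(** * The Basel sum *)

Section Basel.
Variable R : realType.

Let f n (k : nat) : R := sin (k%:R * pi / 2 ^+ n) ^- 2.

Let pow2_gt0 n : (0 : R) < 2 ^+ n. Proof. by rewrite exprn_gt0. Qed.

Let ang_gt0 n k : (0 < k < 2 ^ n)%N -> 0 < k%:R * @pi R / 2 ^+ n < pi.
Proof.
move=> /andP[k0 kn]; have pi0 := pi_gt0 R.
rewrite !mulr_gt0 ?invr_gt0 ?ltr0n//= ltr_pdivrMr// mulrC ltr_pM2l//.
by rewrite -natrX ltr_nat.
Qed.

(* Induction on [n] by [1 / sin(x)^2 + 1 / cos(x)^2 = 4 / sin(2x)^2]. *)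
Lemma sum_inv_sin2 n : \sum_(1 <= k < 2 ^ n) f n k = (4 ^+ n - 1) / 3.
Proof.
elim: n => [|n IH]; first by rewrite expn0 big_geq// expr0 subrr mul0r.
have p2 : (1 <= 2 ^ n)%N by rewrite expn_gt0.
rewrite (big_cat_nat (n := (2 ^ n)%N))//=; last by rewrite leq_exp2l.
rewrite [X in _ + X]big_ltn ?ltn_exp2l//.
have -> : \sum_((2 ^ n).+1 <= k < 2 ^ n.+1) f n.+1 k =
          \sum_(1 <= k < 2 ^ n) cos (k%:R * pi / 2 ^+ n.+1) ^- 2.
  rewrite -add1n big_addn expnS mul2n -addnn addnK.
  apply: eq_big_nat => k _; rewrite /f natrD natrX.
  rewrite (_ : _ / _ = k%:R * pi / 2 ^+ n.+1 + pi / 2) ?sinDpihalf//.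
  by rewrite exprS; field; rewrite gt_eqF.
rewrite addrCA -big_split /=.
have -> : f n.+1 (2 ^ n) = 1.
  rewrite /f natrX (_ : _ / _ = pi / 2) ?sin_pihalf ?expr1n ?invr1//.
  by rewrite exprS; field; rewrite gt_eqF.
rewrite (eq_big_nat _ _ (F2 := fun k => 4 * f n k)) => [|k kn].
  by rewrite -mulr_sumr IH exprS; field.
rewrite /f; set x : R := k%:R * pi / 2 ^+ n.+1.
have -> : k%:R * pi / 2 ^+ n = x *+ 2 :> R.
  by rewrite /x exprS mulr2n; field; rewrite gt_eqF.
have /andP[s0 spi] := ang_gt0 kn.
have /andP[x0 xpi] : 0 < x < pi / 2.
  move: s0 spi; rewrite /x exprS invfM; lra.
have sx : sin x != 0 by rewrite gt_eqF// sin_gt0_pihalf// x0.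
have cx : cos x != 0 by rewrite gt_eqF// cos_gt0_pihalf//; lra.
rewrite sin_mulr2n.
have -> : sin x ^- 2 + cos x ^- 2 = (cos x ^+ 2 + sin x ^+ 2) / (sin x ^+ 2 * cos x ^+ 2).
  by field; rewrite sx cx.
by rewrite cos2Dsin2; field; rewrite sx cx.
Qed.

(** The full range is symmetric under k -> 2^(n+1) - k and has central term 1; the rest is
    halved. *)
Lemma half_sum_inv_sin2 n :
  \sum_(1 <= k < 2 ^ n) f n.+1 k = (4 ^+ n * 4 - 4) / 6.
Proof.
have p2 : (1 <= 2 ^ n)%N by rewrite expn_gt0.
have := sum_inv_sin2 n.+1.
rewrite (big_cat_nat (n := (2 ^ n)%N))//=; last by rewrite leq_exp2l.
rewrite [X in _ + X]big_ltn ?ltn_exp2l//.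
have -> : f n.+1 (2 ^ n) = 1.
  rewrite /f natrX (_ : _ / _ = pi / 2) ?sin_pihalf ?expr1n ?invr1//.
  by rewrite exprS; field; rewrite gt_eqF.
have -> : \sum_((2 ^ n).+1 <= k < 2 ^ n.+1) f n.+1 k = \sum_(1 <= k < 2 ^ n) f n.+1 k.
  rewrite big_nat_rev -add1n big_addn expnS mul2n -addnn addnK.
  apply: eq_big_nat => k /andP[k1 kn]; rewrite /f; congr (_ ^- 2).
  have -> : (1 + 2 ^ n + (2 ^ n + 2 ^ n) - (k + 2 ^ n).+1 = 2 ^ n.+1 - k)%N.
    by rewrite expnS; lia.
  rewrite natrB ?natrX; last by rewrite expnS; lia.
  rewrite mulrBl mulrBl mulrAC divff ?gt_eqF// mul1r.
  by rewrite sinB cospi sinpi mul0r sub0r mulN1r opprK.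
rewrite exprS => E; lra.
Qed.

Lemma inv_sq_sum_bounds n :
  pi ^+ 2 * (1 - 10 / 2 ^+ n) / 6 <= \sum_(1 <= k < 2 ^ n) (k%:R : R) ^- 2 <= pi ^+ 2 / 6.
Proof.
have pi0 := pi_gt0 R; have p20 := pow2_gt0 n.
set S := \sum_(_ <= _ < _) _.
(* The scale with x^-2 = c k^-2 at the angle x = k pi / 2^(n+1). *)
pose c : R := 4 ^+ n * 4 / pi ^+ 2.
have c0 : 0 < c by rewrite !mulr_gt0 ?invr_gt0 ?exprn_gt0.
have E k : (1 <= k < 2 ^ n)%N -> c * k%:R ^- 2 <= f n.+1 k <= c * k%:R ^- 2 + 1.
  move=> kn; have kn' : (0 < k < 2 ^ n.+1)%N by rewrite expnS; lia.
  have /andP[x0 _] := ang_gt0 kn'.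
  have : k%:R * pi / 2 ^+ n.+1 < pi / 2 :> R.
    have /andP[_] := ang_gt0 kn; rewrite exprS invfM; lra.
  move=> xpi; have := @inv_sin2_bounds R (k%:R * pi / 2 ^+ n.+1); rewrite x0 xpi => /(_ isT).
  rewrite /f (_ : (k%:R * pi / 2 ^+ n.+1) ^- 2 = c * k%:R ^- 2)//.
  have -> : c = 2 ^+ n.+1 ^+ 2 / pi ^+ 2.
    by rewrite /c -exprSr -[in RHS]exprM mulnC exprM -[in RHS](natrX _ 2 2).
  have kn0 : (k%:R : R) != 0 by rewrite pnatr_eq0 -lt0n; case/andP: kn.
  have pn0 : @pi R != 0 by rewrite gt_eqF.
  have tn0 : (2 : R) ^+ n.+1 != 0 by rewrite gt_eqF.
  move: (@pi R) (k%:R : R) (2 ^+ n.+1 : R) kn0 pn0 tn0 => p K T kn0 pn0 tn0.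
  by field; rewrite kn0 pn0 tn0.
have S4 : (4 : R) ^+ n = (2 ^+ n) ^+ 2 by rewrite -exprM mulnC exprM -[in RHS](natrX _ 2 2).
have H := half_sum_inv_sin2 n.
have U : c * S <= (4 ^+ n * 4 - 4) / 6.
  by rewrite -H mulr_sumr; apply: ler_sum_nat => k /E/andP[].
(* One unit of error per term makes less than 2^n in all, against a scale of order 4^n; the constant
   10 of the statement is generous. *)
have L : (4 ^+ n * 4 - 4) / 6 <= c * S + 2 ^+ n.
  rewrite -H; apply: (@le_trans _ _ (\sum_(1 <= k < 2 ^ n) (c * k%:R ^- 2 + 1))).
    by apply: ler_sum_nat => k /E/andP[].
  rewrite big_split /= -mulr_sumr lerD2l sumr_const_nat -natrX ler_nat; lia.
have cE : c * (pi ^+ 2 / 6) = 4 ^+ n * 4 / 6.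
  rewrite /c.
  have pn0 : @pi R != 0 by rewrite gt_eqF.
  by move: (@pi R) pn0 => p pn0; field.
apply/andP; split; rewrite -(ler_pM2l c0).
  have -> : c * (pi ^+ 2 * (1 - 10 / 2 ^+ n) / 6) = c * (pi ^+ 2 / 6) * (1 - 10 / 2 ^+ n) by ring.
  rewrite cE; have -> : 4 ^+ n * 4 / 6 * (1 - 10 / 2 ^+ n) = 4 ^+ n * 4 / 6 - 4 ^+ n * 40 / 6 / 2 ^+ n :> R by ring.
  have -> : 4 ^+ n * 40 / 6 / 2 ^+ n = 40 / 6 * 2 ^+ n :> R by rewrite S4; field; rewrite gt_eqF.
  have : (1 : R) <= 2 ^+ n by rewrite exprn_ege1// ler1n.
  lra.
by rewrite cE; lra.
Qed.

Lemma inv_sq_sum_le N : \sum_(k < N) (k.+1%:R : R) ^- 2 <= pi ^+ 2 / 6.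
Proof.
have /andP[_] := inv_sq_sum_bounds N.+1; apply: le_trans.
rewrite -(big_mkord xpredT (fun k => k.+1%:R ^- 2)) -(big_add1 _ _ 0 N.+1 xpredT (fun k => k%:R ^- 2)).
rewrite [leRHS](@big_cat_nat _ _ _ N.+1)//=; last by rewrite ltnW// ltn_expl.
by rewrite lerDl sumr_ge0// => i _; rewrite invr_ge0 exprn_ge0.
Qed.

Lemma inv_sq_sum_ge (e : R) : 0 < e ->
  exists N, pi ^+ 2 / 6 - e <= \sum_(k < N) (k.+1%:R : R) ^- 2.
Proof.
move=> e0; pose M : R := 10 * pi ^+ 2 / 6 / e.
have M0 : 0 <= M by rewrite /M !mulr_ge0 ?invr_ge0 ?(ltW e0) ?pi_ge0.
exists ((2 ^ (Num.truncn M).+1).-1)%N.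
have /andP[+ _] := inv_sq_sum_bounds (Num.truncn M).+1.
set n := (Num.truncn M).+1 => H.
rewrite -(big_mkord xpredT (fun k => k.+1%:R ^- 2)) -(big_add1 _ _ 0 _ xpredT (fun k => k%:R ^- 2)).
apply: le_trans H.
have nM : M < 2 ^+ n.
  apply: (@lt_le_trans _ _ n%:R); first by rewrite truncnS_gt.
  by rewrite -natrX ler_nat ltnW// ltn_expl.
have : M * e = 10 * pi ^+ 2 / 6 by rewrite /M; field; rewrite gt_eqF.
move=> ME.
have : 10 * pi ^+ 2 / 6 / 2 ^+ n <= e.
  by rewrite ler_pdivrMr// -ME mulrC ler_wpM2l ?ltW.
lra.
Qed.

End Basel.

(** * Wallis integrals *)

Section Integrals.
Variable R : realType.
Notation mu := (@lebesgue_measure R).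

Lemma Rintegral_FTC2 (F f : R -> R) (a b : R) : a < b ->
  (forall x : R, is_derive x 1 F (f x)) -> continuous f ->
  \int[mu]_(x in `[a, b]) f x = F b - F a.
Proof.
move=> ab dF cf; rewrite /Rintegral (@continuous_FTC2 _ f F)//.
- exact: continuous_subspaceT.
- split=> [x _||]; first by case: (dF x).
  + by apply: cvg_at_right_filter; exact: is_derive_cts (dF a).
  + by apply: cvg_at_left_filter; exact: is_derive_cts (dF b).
- by move=> x _; rewrite derive1E; apply: derive_val.
Qed.

Lemma continuous_integrable_itv (f : R -> R) (a b : R) : continuous f ->
  mu.-integrable `[a, b] (EFin \o f).
Proof.
move=> cf; apply: continuous_compact_integrable; first exact: segment_compact.
exact: continuous_subspaceT.
Qed.

Let w n : R := \int[mu]_(x in `[0, pi]) sin x ^+ n.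

Let csin n : continuous (fun x : R => sin x ^+ n).
Proof.
move=> x; apply: (@is_derive_cts _ _ _ (n%:R * sin x ^+ n.-1 * (cos x * 1))).
apply: is_derive_pX; apply: is_derive_psin; exact: is_derive_pid.
Qed.

(** Integration by parts: cos x sin^(n+1) x vanishes at both ends, so its derivative has integral
    0. *)
Let w_rec n : n.+2%:R * w n.+2 = n.+1%:R * w n.
Proof.
have D (x : R) : is_derive x 1 (fun x : R => cos x * sin x ^+ n.+1)
    (n.+1%:R * sin x ^+ n - n.+2%:R * sin x ^+ n.+2).
  have E : cos x * cos x = 1 - sin x * sin x by rewrite -!expr2 cos2sin2.
  derive_tac; rewrite /= !exprS -[n.+2%:R]natr1.
  transitivity (n.+1%:R * sin x ^+ n * (cos x * cos x) - sin x * sin x ^+ n * sin x).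
    by ring.
  by rewrite E; ring.
have C : continuous (fun x : R => n.+1%:R * sin x ^+ n - n.+2%:R * sin x ^+ n.+2).
  by move=> x; apply: cvgB; apply: cvgM; try exact: cvg_cst; exact: csin.
have := Rintegral_FTC2 (pi_gt0 R) D C.
rewrite sinpi sin0 expr0n /= !mulr0 subrr RintegralB//.
- rewrite !RintegralZl//; try exact: continuous_integrable_itv.
  by move/eqP; rewrite subr_eq0 => /eqP.
- apply: continuous_integrable_itv => x; apply: cvgM; [exact: cvg_cst|exact: csin].
- apply: continuous_integrable_itv => x; apply: cvgM; [exact: cvg_cst|exact: csin].
Qed.

Let w0 : w 0 = pi.
Proof.
have D (x : R) : is_derive x 1 (fun y : R => y) (sin x ^+ 0).
  by rewrite expr0; exact: is_derive_pid.
by rewrite /w (Rintegral_FTC2 (pi_gt0 R) D (@csin 0%N)) subr0.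
Qed.

Let w1 : w 1 = 2.
Proof.
have D (x : R) : is_derive x 1 (fun y : R => - cos y) (sin x ^+ 1).
  by derive_tac; rewrite /= expr1; ring.
by rewrite /w (Rintegral_FTC2 (pi_gt0 R) D (@csin 1%N)) cospi cos0; ring.
Qed.

Let w_ge0 n : 0 <= w n.
Proof. by apply: Rintegral_ge0 => // x; rewrite /= in_itv /= => xp; rewrite exprn_ge0// sin_ge0_pi. Qed.

Let w_dec n : w n.+1 <= w n.
Proof.
apply: le_Rintegral => //; try exact: continuous_integrable_itv.
move=> x; rewrite /= in_itv /= => xp; rewrite exprS ler_piMl ?sin_le1//.
by rewrite exprn_ge0// sin_ge0_pi.
Qed.

Let w_mul n : n.+1%:R * w n.+1 * w n = 2 * pi.
Proof.
elim: n => [|n IH]; first by rewrite w0 w1 mul1r.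
by rewrite w_rec -IH; ring.
Qed.

Let w_even N : w N.*2 * (4 ^+ N * (N`!)%:R ^+ 2) = pi * (N.*2`!)%:R.
Proof.
elim: N => [|N IH]; first by rewrite double0 w0 expr0 fact0 expr1n !mulr1.
have N0 : (N.*2.+2%:R : R) != 0 by rewrite pnatr_eq0.
apply: (mulfI N0); rewrite doubleS [LHS]mulrA w_rec !factS !natrM exprS.
transitivity ((N.*2.+1%:R * (4 * N.+1%:R ^+ 2)) * (w N.*2 * (4 ^+ N * (N`!)%:R ^+ 2))).
  by ring.
rewrite IH; have -> : N.*2.+2%:R = 2 * N.+1%:R :> R by rewrite -natrM; congr _%:R; lia.
by ring.
Qed.

(** The middle expression is the logarithm of [w N.*2], by its closed form with a central binomial
    coefficient. As [w] decreases, the square of [w N.*2] lies between its products with the two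
    neighbours, which are 2 pi / (2N + 1) and pi / N. *)
Lemma wallis N : (0 < N)%N ->
  ln (@pi R / N%:R) / 2 - (4 * N%:R)^-1 <=
  ln (@pi R) + ln (N.*2`!)%:R - 2 * N%:R * ln 2 - 2 * ln (N`!)%:R <= ln (@pi R / N%:R) / 2.
Proof.
move=> N0; have pi0 := pi_gt0 R.
have Nr : (0 : R) < N%:R by rewrite ltr0n.
have f0 k : (0 : R) < k`!%:R by rewrite ltr0n fact_gt0.
have wp : 0 < w N.*2.
  rewrite lt_neqAle w_ge0 andbT eq_sym; apply/eqP => w00.
  by have := w_mul N.*2; rewrite w00 mulr0 => /eqP; rewrite eq_sym mulf_eq0 !gt_eqF.
have -> : ln pi + ln (N.*2`!)%:R - 2 * N%:R * ln 2 - 2 * ln (N`!)%:R = ln (w N.*2) :> R.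
  have := congr1 (@ln R) (w_even N).
  rewrite !lnM ?posrE ?mulr_gt0 ?exprn_gt0//.
  rewrite !lnXn// (_ : (4 : R) = 2 ^+ 2) ?lnXn//; last by rewrite -natrX.
  by rewrite -[_ *+ N]mulr_natr; lra.
have sq : ln (w N.*2 ^+ 2) = 2 * ln (w N.*2) by rewrite lnXn// mulr_natl.
have U : w N.*2 ^+ 2 <= pi / N%:R.
  rewrite ler_pdivlMr//; case: N N0 wp Nr {sq} => // N _ wp Nr.
  have := w_mul N.*2.+1; rewrite -doubleS => E.
  have : w N.+1.*2 <= w N.*2.+1 by exact: w_dec.
  have -> : pi = (N.+1.*2%:R * w N.+1.*2 * w N.*2.+1) / 2 :> R by rewrite E; field.
  move=> /(ler_wpM2l (ltW (mulr_gt0 wp Nr))).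
  have -> : N.+1.*2%:R = 2 * N.+1%:R :> R by rewrite -natrM mul2n.
  by move: (w _) (w _) (N.+1%:R : R) => u v z; lra.
have L : pi / N%:R * (1 + (2 * N%:R)^-1)^-1 <= w N.*2 ^+ 2.
  have := w_mul N.*2 => E.
  have : w N.*2.+1 <= w N.*2 by exact: w_dec.
  have E2 : N.*2.+1%:R = 2 * N%:R + 1 :> R by rewrite -natr1 -natrM mul2n.
  rewrite E2 in E.
  have -> : pi / N%:R * (1 + (2 * N%:R)^-1)^-1 = w N.*2.+1 * w N.*2 :> R.
    have -> : pi = (2 * N%:R + 1) * w N.*2.+1 * w N.*2 / 2 :> R by rewrite E; field.
    by field; rewrite !gt_eqF//; lra.
  by move=> H; rewrite expr2 ler_wpM2r.
have U' : ln (w N.*2 ^+ 2) <= ln (pi / N%:R).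
  by rewrite ler_ln ?posrE ?exprn_gt0 ?divr_gt0.
have i0 : (0 : R) < (2 * N%:R)^-1 by rewrite invr_gt0; lra.
have i1 : 0 < 1 + (2 * N%:R)^-1 :> R by lra.
have L' : ln (pi / N%:R) - (2 * N%:R)^-1 <= ln (w N.*2 ^+ 2).
  apply: (@le_trans _ _ (ln (pi / N%:R * (1 + (2 * N%:R)^-1)^-1))).
    rewrite [leRHS]lnM ?posrE ?invr_gt0 ?divr_gt0// lerD2l lnV ?posrE// lerN2.
    by apply: le_ln1Dx; lra.
  by rewrite ler_ln ?posrE ?exprn_gt0// !mulr_gt0 ?invr_gt0.
have -> : (4 * N%:R)^-1 = (2 * N%:R)^-1 / 2 :> R by field; rewrite gt_eqF.
by rewrite sq in U' L'; lra.
Qed.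

End Integrals.

(** * Stirling's formula by the midpoint rule *)

Section Stirling.
Variable R : realType.

(** As a function of the half-width s, the error has derivative A1(x + s) + A1(x - s) - 2 A1(x), a
    second difference that mean values bound by 2 B e^2. *)
Lemma midpoint_rule (A A1 A2 A3 : R -> R) (x e B : R) : 0 <= e ->
  (forall y, x - e <= y <= x + e -> is_derive y 1 A (A1 y)) ->
  (forall y, x - e <= y <= x + e -> is_derive y 1 A1 (A2 y)) ->
  (forall y, x - e <= y <= x + e -> is_derive y 1 A2 (A3 y)) ->
  (forall y, x - e <= y <= x + e -> `|A3 y| <= B) ->
  `|A (x + e) - A (x - e) - 2 * e * A1 x| <= 2 * B * e ^+ 3.
Proof.
move=> e0 dA dA1 dA2 A3B.
have B0 : 0 <= B by apply: le_trans (A3B x _); [exact: normr_ge0|lra].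
have D s : 0 <= s <= e -> is_derive s 1 (fun s => A (x + s) - A (x - s) - 2 * s * A1 x)
    (A1 (x + s) + A1 (x - s) - 2 * A1 x).
  move=> se.
  have d1 : is_derive s 1 (fun s => A (x + s)) (A1 (x + s) * 1).
    apply: is_derive1_comp; first by apply: dA; lra.
    by derive_tac; ring.
  have d2 : is_derive s 1 (fun s => A (x - s)) (A1 (x - s) * - 1).
    apply: (@is_derive1_comp R A (fun s => x - s)); first by apply: dA; lra.
    by derive_tac; ring.
  eapply is_derive_eq; first by repeat first [exact: d1|exact: d2|derive_step].
  by rewrite /=; ring.
have := derive_bound e0 D (K := 2 * B * e ^+ 2).
rewrite !addr0 !subr0 mulr0 mul0r subr0 subrr.
rewrite subr0 => H; apply: (@le_trans _ _ (2 * B * e ^+ 2 * e)); last by rewrite le_eqVlt; apply/orP; left; apply/eqP; ring.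
apply: H => s /andP[s0 se].
have [c1 c1b E1] : exists2 c, x <= c <= x + s & A1 (x + s) - A1 x = A2 c * (x + s - x).
  by apply: MVT_le => [|y yb]; [lra|apply: dA1; lra].
have [c2 c2b E2] : exists2 c, x - s <= c <= x & A1 x - A1 (x - s) = A2 c * (x - (x - s)).
  by apply: MVT_le => [|y yb]; [lra|apply: dA1; lra].
have -> : A1 (x + s) + A1 (x - s) - 2 * A1 x = (A2 c1 - A2 c2) * s.
  have -> : A1 (x + s) + A1 (x - s) - 2 * A1 x = (A1 (x + s) - A1 x) - (A1 x - A1 (x - s)) by ring.
  by rewrite E1 E2; ring.
have H : `|A2 c1 - A2 c2| <= B * (c1 - c2).
  apply: (@derive_bound R A2 A3) => [|y yb|y yb]; first lra.
    by apply: dA2; lra.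
  by apply: A3B; lra.
rewrite normrM [`|s|]ger0_norm//.
apply: (@le_trans _ _ (B * (2 * e) * e)); last by rewrite le_eqVlt; apply/orP; left; apply/eqP; ring.
apply: ler_pM => //; apply: le_trans H _; rewrite ler_wpM2l//; lra.
Qed.

Let A0 (x : R) := x * ln x - x.

Let dA0 (x : R) : 0 < x -> is_derive x 1 A0 (ln x).
Proof.
move=> x0; derive_tac; first exact: x0.
by rewrite /=; field; rewrite gt_eqF.
Qed.

Let ln_midpoint k : (0 < k)%N ->
  `|A0 (k%:R + 2^-1) - A0 (k%:R - 2^-1) - ln k%:R| <= k%:R ^- 2.
Proof.
move=> k0; have kr : 1 <= k%:R :> R by rewrite ler1n.
have := @midpoint_rule A0 (@ln R) (fun y => y^-1) (fun y => - y ^- 2) k%:R 2^-1 (4 / k%:R ^+ 2).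
have -> : 2 * 2^-1 * ln k%:R = ln k%:R :> R by field.
have -> : 2 * (4 / k%:R ^+ 2) * 2^-1 ^+ 3 = k%:R ^- 2 :> R by field; rewrite gt_eqF//; lra.
apply; first lra.
- by move=> y yk; apply: dA0; lra.
- by move=> y yk; apply: is_derive1_ln; lra.
- move=> y yk; derive_tac; first by rewrite gt_eqF//; lra.
  by rewrite /=; ring.
move=> y yk; rewrite normrN ger0_norm ?invr_ge0 ?exprn_ge0//; try lra.
have -> : 4 / k%:R ^+ 2 = (k%:R / 2) ^- 2 :> R by field; rewrite gt_eqF//; lra.
rewrite lef_pV2 ?posrE ?exprn_gt0//; try lra.
by rewrite ler_sqr ?nnegrE//; lra.
Qed.

Let d N : R := ln (N`!)%:R - A0 (N%:R + 2^-1).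

Let d_step N : `|d N.+1 - d N| <= N.+1%:R ^- 2.
Proof.
have -> : d N.+1 - d N = - (A0 (N.+1%:R + 2^-1) - A0 (N.+1%:R - 2^-1) - ln N.+1%:R).
  rewrite /d factS natrM lnM ?posrE ?ltr0n ?fact_gt0//.
  have -> : N.+1%:R - 2^-1 = N%:R + 2^-1 :> R by rewrite -natr1; field.
  by ring.
by rewrite normrN ln_midpoint.
Qed.

(** Each of the [N] steps from [N] to [2N] costs at most N^-2. *)
Let d_double N : (0 < N)%N -> `|d N.*2 - d N| <= N%:R^-1.
Proof.
move=> N0; have Nr : (0 : R) < N%:R by rewrite ltr0n.
have H k : `|d (N + k) - d N| <= k%:R / N%:R ^+ 2.
  elim: k => [|k IH]; first by rewrite addn0 subrr normr0 mul0r.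
  rewrite addnS -(subrK (d (N + k)) (d _)) -addrA.
  apply: le_trans (ler_normD _ _) _; rewrite -natr1 mulrDl [leRHS]addrC mul1r.
  apply: lerD => //; apply: le_trans (d_step _) _.
  rewrite lef_pV2 ?posrE ?exprn_gt0 ?ltr0n// ler_sqr ?nnegrE ?ler_nat//; lia.
have := H N; rewrite addnn => {}H; apply: le_trans H _.
by rewrite le_eqVlt; apply/orP; left; apply/eqP; field; rewrite gt_eqF.
Qed.

Lemma ln1D_ge (y : R) : 0 <= y -> y - y ^+ 2 <= ln (1 + y).
Proof.
move=> y0.
have D z : 0 <= z <= y -> is_derive z 1 (fun z : R => ln (1 + z) - (z - z ^+ 2)) ((z + 2 * z ^+ 2) / (1 + z)).
  move=> zy; derive_tac; first lra.
  by rewrite /=; field; rewrite gt_eqF//; lra.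
have := derive_ge0_le y0 D; rewrite addr0 ln1 expr0n /= !subr0 subr_ge0; apply => z zy.
by apply: divr_ge0; nra.
Qed.

(** Wallis controls d(2N) - 2 d(N) up to explicit terms, and [d_double] controls d(2N) - d(N). Their
    difference is d(N), so the constant ln (2 pi) / 2 comes out without passing to a limit. *)
Lemma stirling N : (0 < N)%N ->
  `|ln (N`!)%:R - ((N%:R + 2^-1) * ln (N%:R + 2^-1) - (N%:R + 2^-1)) - ln (2 * pi) / 2|
     <= 4 / N%:R :> R.
Proof.
move=> N0; have Nr : (1 : R) <= N%:R by rewrite ler1n.
have pi0 := pi_gt0 R.
rewrite -[X in `|X - _|]/(d N).
have := d_double N0; have /andP[] := wallis R N0.
set n : R := N%:R in Nr *.
rewrite /d /A0.
have -> : N.*2%:R = 2 * n :> R by rewrite -mul2n natrM.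
set f1 := ln (N`!)%:R; set f2 := ln _`!%:R.
rewrite !lnM ?posrE ?invr_gt0//; try lra.
rewrite lnV ?posrE; try lra.
(* The relative shift from n to n + 1/2; that from 2n to 2n + 1/2 is y / 2. *)
pose y := (2 * n)^-1.
have yn : y * n = 2^-1 by rewrite /y; field; rewrite gt_eqF//; lra.
have y0 : 0 < y by rewrite invr_gt0; lra.
have -> : n^-1 = 2 * y by rewrite /y; field; rewrite gt_eqF//; lra.
have -> : (4 * n)^-1 = y / 2 by rewrite /y; field; rewrite gt_eqF//; lra.
have -> : ln (2 * n + 2^-1) = ln 2 + ln n + ln (1 + y / 2).
  rewrite -!lnM ?posrE ?mulr_gt0//; try lra.
  by congr ln; rewrite /y; field; rewrite gt_eqF//; lra.
have -> : ln (n + 2^-1) = ln n + ln (1 + y).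
  rewrite -!lnM ?posrE; try lra.
  by congr ln; rewrite /y; field; rewrite gt_eqF//; lra.
have a1 := ln1D_ge (ltW y0); have a2 : ln (1 + y) <= y by apply: le_ln1Dx; lra.
have b0 : 0 <= y / 2 by lra.
have b1 := ln1D_ge b0; have b2 : ln (1 + y / 2) <= y / 2 by apply: le_ln1Dx; lra.
have y1 : y <= 2^-1.
  by rewrite /y lef_pV2 ?posrE; lra.
move: (ln (1 + y)) (ln (1 + y / 2)) (ln n) (ln 2) (ln pi) a1 a2 b1 b2 => u v ln' l2 lp a1 a2 b1 b2 h1 h2.
have nu1 : n * (y - y ^+ 2) <= n * u by rewrite ler_wpM2l//; lra.
have nu2 : n * u <= n * y by rewrite ler_wpM2l//; lra.
have nv1 : n * (y / 2 - (y / 2) ^+ 2) <= n * v by rewrite ler_wpM2l//; lra.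
have nv2 : n * v <= n * (y / 2) by rewrite ler_wpM2l//; lra.
have ny2 : n * y ^+ 2 = y / 2 by rewrite expr2 mulrA [n * y]mulrC yn mulrC.
have y22 : y ^+ 2 <= y / 2 by rewrite expr2; nra.
rewrite !ler_norml => /andP[h3 h4].
apply/andP; split; nra.
Qed.

End Stirling.

(** * Euler's product near q = 1 *)

Section SqueezeDerivative.
Variable R : realType.

(** Every secant slope of [f] is squeezed between two values of -g, as for a convex function. This
    differentiates the dilogarithm without exchanging a derivative with its series. *)
Lemma is_derive_squeeze (f g : R -> R) (x : R) : 0 < x ->
  (forall y z, 0 < y -> y <= z -> (z - y) * g z <= f y - f z <= (z - y) * g y) ->
  {for x, continuous g} -> is_derive x 1 f (- g x).
Proof.
move=> x0 fg gx; apply/is_derive1_caratheodory.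
exists (fun z => if z == x then - g x else (f z - f x) / (z - x)); split; last by rewrite eqxx.
  move=> z; case: eqVneq => [->|zx]; first by rewrite !subrr mulr0.
  by rewrite divfK// subr_eq0.
apply/(@cvgrPdist_le R R) => e e0; rewrite eqxx.
near=> z; case: ifPn => [_|zx]; first by rewrite subrr normr0 ltW.
have z0 : 0 < z by near: z; exact: lt_nbhsr.
have gz : `|g x - g z| <= e.
  by near: z; move/(@cvgrPdist_le R R): gx; apply.
have zxn : z - x != 0 by rewrite subr_eq0.
apply: le_trans gz; rewrite -opprD normrN.
have -> : g x + (f z - f x) / (z - x) = (g x * (z - x) + (f z - f x)) / (z - x) by field.
rewrite normrM normfV ler_pdivrMr ?normr_gt0// -normrM.
have [zx'|xz] := leP z x.
  have /andP[h1 h2] := fg z x z0 zx'.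
  rewrite ler_norml; apply/andP; split.
    by apply: (@le_trans _ _ 0); rewrite ?oppr_le0 ?normr_ge0//; lra.
  by apply: le_trans (ler_norm _); rewrite -mulrNN; lra.
have /andP[h1 h2] := fg x z x0 (ltW xz).
rewrite ler_norml; apply/andP; split.
  by apply: (@le_trans _ _ 0); rewrite ?oppr_le0 ?normr_ge0//; lra.
by apply: le_trans (ler_norm _); lra.
Unshelve. all: by end_near.
Qed.

End SqueezeDerivative.

(** * The dilogarithm of e^-x and its derivative *)

Section Dilogarithm.
Variable R : realType.
Implicit Types x y : R.

Definition zeta2 : R := pi ^+ 2 / 6.

Let S M : R := \sum_(m < M) (m.+1%:R ^- 2).
Let r M := zeta2 - S M.

Let r_ge0 M : 0 <= r M. Proof. by rewrite subr_ge0 inv_sq_sum_le. Qed.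

Let r_small e : 0 < e -> exists M, r M <= e.
Proof. by move=> e0; have [M HM] := inv_sq_sum_ge e0; exists M; rewrite /r /S /zeta2; lra. Qed.

Let D M x : R := \sum_(m < M) expR (- (m.+1%:R * x)) / m.+1%:R ^+ 2.

(* [dilog x] is the dilogarithm Li_2(e^{-x}). *)
Definition dilog x : R := sup [set y | exists M, y = \sum_(m < M) expR (- (m.+1%:R * x)) / m.+1%:R ^+ 2].

Let expN_le1 (m : nat) x : 0 <= x -> expR (- (m%:R * x)) <= 1.
Proof. by move=> x0; rewrite expR_le1 oppr_le0 mulr_ge0. Qed.

Let D_tail M x k : 0 <= x -> D (M + k) x <= D M x + (S (M + k) - S M).
Proof.
move=> x0; elim: k => [|k IH]; first by rewrite addn0 subrr addr0.
have : expR (- ((M + k).+1%:R * x)) / (M + k).+1%:R ^+ 2 <= (M + k).+1%:R ^- 2.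
  by rewrite ler_pdivrMr ?exprn_gt0 ?ltr0n// mulVf ?expN_le1// gt_eqF// exprn_gt0// ltr0n.
rewrite addnS; have -> : D (M + k).+1 x = D (M + k) x +
    expR (- ((M + k).+1%:R * x)) / (M + k).+1%:R ^+ 2 by rewrite /D big_ord_recr.
have -> : S (M + k).+1 = S (M + k) + (M + k).+1%:R ^- 2 by rewrite /S big_ord_recr.
move: (expR (- ((M + k).+1%:R * x)) / (M + k).+1%:R ^+ 2) ((M + k).+1%:R ^- 2 : R) => a b.
by move: IH; lra.
Qed.

Let D_mono M k x : D M x <= D (M + k) x.
Proof.
elim: k => [|k IH]; first by rewrite addn0.
rewrite addnS [leRHS]/D big_ord_recr /= -/(D _ _); apply: le_trans IH _.
by rewrite lerDl divr_ge0 ?expR_ge0 ?exprn_ge0.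
Qed.

Let D_ub M M' x : 0 <= x -> D M' x <= D M x + r M.
Proof.
move=> x0; have [MM|/ltnW MM] := leqP M M'.
  rewrite -(subnKC MM); apply: le_trans (D_tail _ _ x0) _.
  by rewrite lerD2l lerD2r inv_sq_sum_le.
apply: (@le_trans _ _ (D M x)); first by rewrite -(subnKC MM) D_mono.
by rewrite lerDl r_ge0.
Qed.

(** For [x >= 0] the tail of the series is at most the tail of the Basel sum, uniformly in [x]. *)
Let dilog_bounds M x : 0 <= x -> D M x <= dilog x <= D M x + r M.
Proof.
move=> x0; apply/andP; split.
  apply: ub_le_sup; last by exists M.
  by exists (D 0 x + r 0) => _ [M' ->]; apply: D_ub.
apply: ge_sup; first by exists (D 0 x), 0%N.
by move=> _ [M' ->]; apply: D_ub.
Qed.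

Let h x := - ln (1 - expR (- x)).
Let H M x : R := \sum_(m < M) expR (- (m.+1%:R * x)) / m.+1%:R.

Lemma expRN_bounds x : 0 < x -> 0 < expR (- x) < 1.
Proof. by move=> x0; rewrite expR_gt0 expR_lt1 oppr_lt0. Qed.

(** [H] is the Taylor polynomial of -ln (1 - v) at v = e^-x. The difference vanishes at v = 0 and
    has the nonnegative, increasing derivative v^M / (1 - v). *)
Let H_bounds M x : 0 < x -> H M x <= h x <= H M x + expR (- x) ^+ M / (1 - expR (- x)).
Proof.
move=> x0; have /andP[u0 u1] := expRN_bounds x0.
set u := expR (- x) in u0 u1 *.
have HE : H M x = \sum_(m < M) u ^+ m.+1 / m.+1%:R.
  by apply: eq_bigr => m _; rewrite -mulrN expRM_natl.
have d v : 0 <= v <= u -> is_derive v 1 (fun v : R => - ln (1 - v) - \sum_(m < M) v ^+ m.+1 / m.+1%:R)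
    (v ^+ M / (1 - v)).
  move=> vu; have v1 : 0 < 1 - v by lra.
  have ds : is_derive v 1 (fun v : R => \sum_(m < M) v ^+ m.+1 / m.+1%:R) (\sum_(m < M) v ^+ m).
    elim: M {HE} => [|M IH].
      by rewrite big_ord0; under eq_fun do rewrite big_ord0; exact: is_derive_pcst.
    rewrite big_ord_recr /=; under eq_fun do rewrite big_ord_recr /=.
    apply: is_derive_pD => //.
    derive_tac; rewrite /= mulr0 add0r mulr1.
    by field; rewrite gt_eqF// ltr0n.
  eapply is_derive_eq; first by repeat first [exact: ds|derive_step].
  rewrite /=; have := subrX1 v M; rewrite -[X in _ = _ * X]opprK.
  move=> E; have E2 : \sum_(i < M) v ^+ i = (1 - v ^+ M) / (1 - v).
    have vn : v - 1 != 0 by rewrite lt_eqF// subr_lt0; lra.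
    apply: (mulfI vn); rewrite -(opprK (\sum_(_ < _) _)) -E.
    by field; rewrite gt_eqF//.
  by rewrite E2; field; rewrite gt_eqF.
have u0' := ltW u0.
have F0 : - ln (1 - 0) - \sum_(m < M) 0 ^+ m.+1 / m.+1%:R = 0 :> R.
  by rewrite subr0 ln1 oppr0 sub0r big1 ?oppr0// => m _; rewrite expr0n mul0r.
have := derive_ge0_le u0' d; rewrite F0 HE subr_ge0 => -> /=; last first.
  by move=> v vu; rewrite divr_ge0 ?exprn_ge0//; lra.
have [c cu E] := MVT_le u0' d.
rewrite addrC -lerBlDr; move: E; rewrite F0 subr0 => ->; rewrite subr0.
apply: (@le_trans _ _ (c ^+ M / (1 - c))).
  by rewrite ler_piMr ?(ltW u1)// divr_ge0 ?exprn_ge0//; lra.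
apply: ler_pM; rewrite ?exprn_ge0 ?invr_ge0//; try lra.
  by apply: lerXn2r; rewrite ?nnegrE//; lra.
by rewrite lef_pV2 ?posrE; lra.
Qed.

Let H_small x e : 0 < x -> 0 < e -> exists M0, forall M, (M0 <= M)%N -> h x <= H M x + e.
Proof.
move=> x0 e0; have /andP[u0 u1] := expRN_bounds x0.
have : (fun M => expR (- x) ^+ M) @ \oo --> (0 : R).
  by apply: cvg_expr; rewrite ger0_norm ?ltW.
move/(@cvgrPdist_le R R)/(_ (e * (1 - expR (- x)))) => /(_ _)[].
  by rewrite mulr_gt0// subr_gt0.
move=> M0 _ HM; exists M0 => M MM.
have /andP[_] := H_bounds M x0; move/le_trans; apply; rewrite lerD2l.
rewrite ler_pdivrMr ?subr_gt0//; have := HM _ MM.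
by rewrite /= sub0r normrN ger0_norm// exprn_ge0// ltW.
Qed.

(** Term by term this is 1 + z <= e^z, at z = m (y - x) for the lower bound and at its opposite for
    the upper one; the tails of the series are then made arbitrarily small. *)
Lemma dilog_diff x y : 0 < x -> x <= y ->
  (y - x) * h y <= dilog x - dilog y <= (y - x) * h x.
Proof.
move=> x0 xy; have y0 := lt_le_trans x0 xy.
have DD M : (y - x) * H M y <= D M x - D M y <= (y - x) * H M x.
  rewrite /D /H -sumrB !mulr_sumr; apply/andP; split; apply: ler_sum => m _;
  have m0 : (0 : R) < m.+1%:R by rewrite ltr0n.
    have := expR_ge1Dx (m.+1%:R * (y - x)).
    have -> : expR (- (m.+1%:R * x)) = expR (- (m.+1%:R * y)) * expR (m.+1%:R * (y - x)).
      by rewrite -expRD; congr expR; ring.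
    set E := expR (- _); set F := expR (m.+1%:R * _) => EF.
    have E0 : 0 <= E := expR_ge0 _.
    rewrite -subr_ge0; have -> : E * F / m.+1%:R ^+ 2 - E / m.+1%:R ^+ 2 - (y - x) * (E / m.+1%:R) =
       E / m.+1%:R ^+ 2 * (F - 1 - m.+1%:R * (y - x)) by field; rewrite gt_eqF.
    by rewrite mulr_ge0 ?divr_ge0 ?exprn_ge0//; lra.
  have := expR_ge1Dx (- (m.+1%:R * (y - x))).
  have -> : expR (- (m.+1%:R * y)) = expR (- (m.+1%:R * x)) * expR (- (m.+1%:R * (y - x))).
    by rewrite -expRD; congr expR; ring.
  set E := expR (- (_ * x)); set F := expR (- (m.+1%:R * _)) => EF.
  have E0 : 0 <= E := expR_ge0 _.
  rewrite -subr_ge0; have -> : (y - x) * (E / m.+1%:R) - (E / m.+1%:R ^+ 2 - E * F / m.+1%:R ^+ 2) =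
     E / m.+1%:R ^+ 2 * (F - 1 + m.+1%:R * (y - x)) by field; rewrite gt_eqF.
  by rewrite mulr_ge0 ?divr_ge0 ?exprn_ge0//; lra.
have rM : forall e, 0 < e -> exists M, [/\ r M <= e, h x <= H M x + e & h y <= H M y + e].
  move=> e e0; have [M1 HM1] := H_small x0 e0; have [M2 HM2] := H_small y0 e0.
  have [M3 HM3] := r_small e0; exists (M3 + (M1 + M2))%N.
  split; [|by apply: HM1; lia|by apply: HM2; lia].
  apply: le_trans HM3; rewrite lerD2l lerN2 /S big_split_ord/= lerDl.
  by apply: sumr_ge0 => m _; rewrite invr_ge0 exprn_ge0.
apply/andP; split; apply/ler_addgt0Pr => e e0.
  pose e' := e / (1 + (y - x) + 1).
  have e'0 : 0 < e' by rewrite divr_gt0//; lra.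
  have [M [h1 h2 h3]] := rM _ e'0.
  have /andP[d1 d2] := dilog_bounds M (ltW x0).
  have /andP[d3 d4] := dilog_bounds M (ltW y0).
  have /andP[d5 d6] := DD M.
  have : (y - x) * h y <= (y - x) * (H M y + e') by rewrite ler_wpM2l//; lra.
  have : e = e' * (1 + (y - x) + 1) by rewrite /e'; field; rewrite gt_eqF//; lra.
  by nra.
have [M [h1 h2 h3]] := rM _ e0.
have /andP[d1 d2] := dilog_bounds M (ltW x0).
have /andP[d3 d4] := dilog_bounds M (ltW y0).
have /andP[d5 d6] := DD M.
have /andP[d7 _] := H_bounds M x0.
have : (y - x) * H M x <= (y - x) * h x by rewrite ler_wpM2l//; lra.
by lra.
Qed.

Lemma is_derive_h x : 0 < x -> is_derive x 1 h (- (expR x - 1)^-1).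
Proof.
move=> x0; have /andP[e0 e1] := expRN_bounds x0.
have E : expR x = (expR (-x))^-1 by rewrite expRN invrK.
derive_tac; first lra.
rewrite /= E; set u := expR (- x) in e0 e1 *.
by field; repeat (apply/andP; split); rewrite gt_eqF//; lra.
Qed.

Lemma is_derive_dilog x : 0 < x -> is_derive x 1 dilog (ln (1 - expR (- x))).
Proof.
move=> x0; rewrite -[ln _]opprK -/(h x).
apply: is_derive_squeeze => //; first exact: dilog_diff.
exact: is_derive_cts (is_derive_h x0).
Qed.

Lemma dilog_ge0 x : 0 <= x -> 0 <= dilog x.
Proof. by move=> x0; have := dilog_bounds 0 x0; rewrite /D big_ord0 => /andP[]. Qed.

Lemma dilog_le x : 0 <= x -> dilog x <= zeta2 * expR (- x).
Proof.
move=> x0; apply: ge_sup; first by exists (D 0 x), 0%N.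
move=> _ [M ->]; rewrite mulrC.
apply: (@le_trans _ _ (expR (- x) * S M)); last by rewrite ler_wpM2l ?expR_ge0 ?inv_sq_sum_le.
rewrite mulr_sumr; apply: ler_sum => m _; rewrite ler_wpM2r ?invr_ge0 ?exprn_ge0//.
by rewrite ler_expR lerN2 ler_peMl// ler1n.
Qed.

(** The derivative is known for [x > 0] only, so the value at 0 has its own argument: past [M] terms
    the tail is small, and each of the first [M] terms moves by at most [x]. *)
Lemma dilog_near0 e : 0 < e -> exists2 d, 0 < d & forall x, 0 <= x <= d -> zeta2 - dilog x <= e.
Proof.
move=> e0; have e2 : 0 < e / 2 by lra.
have [M rM] := r_small e2.
exists (e / 2 / M.+1%:R); first by rewrite divr_gt0.
move=> x /andP[x0 xd]; have /andP[d1 _] := dilog_bounds M x0.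
have : S M - D M x <= M%:R * x.
  rewrite /S /D -sumrB (@le_trans _ _ (\sum_(m < M) x))//; last first.
    by rewrite sumr_const card_ord mulr_natl.
  apply: ler_sum => m _; have m0 : (1 : R) <= m.+1%:R by rewrite ler1n.
  have := expR_ge1Dx (- (m.+1%:R * x)); set E := expR _ => HE.
  have -> : m.+1%:R ^- 2 - E / m.+1%:R ^+ 2 = (1 - E) / m.+1%:R ^+ 2 by ring.
  rewrite ler_pdivrMr ?exprn_gt0//.
  apply: (@le_trans _ _ (m.+1%:R * x)); first lra.
  by rewrite [leLHS]mulrC ler_wpM2l// expr2 ler_peMl//; apply: le_trans m0.
have : M%:R * x <= e / 2.
  apply: le_trans (_ : M.+1%:R * x <= _); first by rewrite ler_wpM2r// ler_nat.
  by rewrite mulrC -ler_pdivlMr.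
rewrite /r in rM; lra.
Qed.

End Dilogarithm.

(** * Euler's product and its logarithmic derivatives as t tends to 0 *)

Section Asymptotics.
Variable R : realType.
Implicit Types x y t : R.
Notation u x := (expR (- x)).
Notation z2 := (@zeta2 R).

Lemma zeta2_gt0 : 0 < z2.
Proof. by rewrite /zeta2 divr_gt0// exprn_gt0// pi_gt0. Qed.

Lemma expRN_ge x : 1 - x <= u x.
Proof. by have := expR_ge1Dx (- x); lra. Qed.

Lemma expRN_mul_le x : (1 + x) * u x <= 1.
Proof.
have := expR_ge1Dx x; rewrite -(ler_pM2r (expR_gt0 (- x))) => /le_trans; apply.
by rewrite expRxMexpNx_1.
Qed.

(** This decides the sign of the derivative of [g2] and gives the bound of [A3_bound] near 0. *)
Lemma expRN_pade x : 0 <= x -> 2 - x <= (2 + x) * u x.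
Proof.
move=> x0; rewrite -subr_ge0.
have D y : is_derive y 1 (fun y : R => (2 + y) * u y - (2 - y)) (1 - (1 + y) * u y).
  by derive_tac; rewrite /=; ring.
have := derive_ge0_le x0 (fun y _ => D y); rewrite oppr0 expR0 => H.
by apply: le_trans (H _); [lra|move=> y _; rewrite subr_ge0 expRN_mul_le].
Qed.

(** Multiplied by e^x, this is the square of x <= 2 sinh (x / 2). *)
Lemma sqr_expRN_le x : 0 <= x -> x ^+ 2 * u x <= (1 - u x) ^+ 2.
Proof.
move=> x0; have y0 : 0 <= x / 2 by lra.
have D y : is_derive y 1 (fun y : R => 1 - u y ^+ 2 - 2 * y * u y) (2 * u y * (u y - (1 - y))).
  by derive_tac; rewrite /=; ring.
have := derive_ge0_le y0 (fun y _ => D y); rewrite oppr0 expR0 mulr0 mul0r expr1n !subrr.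
have -> : u x = u (x / 2) ^+ 2 by rewrite -expRM_natl; congr expR; field.
move=> H; have {}H : 0 <= 1 - u (x / 2) ^+ 2 - 2 * (x / 2) * u (x / 2).
  apply: H => y /andP[yy _]; rewrite !mulr_ge0 ?expR_ge0//.
  by have := expRN_ge y; lra.
have {}H : x * u (x / 2) <= 1 - u (x / 2) ^+ 2.
  have -> : x * u (x / 2) = 2 * (x / 2) * u (x / 2) by field.
  lra.
rewrite -exprMn; apply: lerXn2r => //; rewrite nnegrE ?mulr_ge0 ?expR_ge0//.
by apply: le_trans H; rewrite mulr_ge0 ?expR_ge0.
Qed.

Let dens x : 0 < x -> 0 < u x < 1. Proof. exact: expRN_bounds. Qed.

Definition h x := - ln (1 - u x).
(** Adding ln x removes the logarithmic singularity of [h] at 0 and makes the midpoint rule accurate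
    down to the first cell; the sum of the ln (k t) is restored through ln N! and Stirling's
    formula. *)
Local Definition ht x := h x + ln x.
Local Definition g1 x := x * u x / (1 - u x).
Local Definition g2 x := x ^+ 2 * u x / (1 - u x) ^+ 2.
(* [A], [Q1] and [Q2] are antiderivatives of [ht], [g1] and [g2]. *)
Local Definition A x := x * ln x - x - dilog x.
Local Definition Q1 x := - dilog x - x * h x.
Local Definition Q2 x := - (x * g1 x) + 2 * Q1 x.

Let dh x : 0 < x -> is_derive x 1 h (- (u x / (1 - u x))).
Proof.
move=> x0; have /andP[u0 u1] := dens x0.
derive_tac; first lra.
by rewrite /=; field; rewrite gt_eqF//; lra.
Qed.

Let dA x : 0 < x -> is_derive x 1 A (ht x).
Proof.
move=> x0; have dd := is_derive_dilog x0.
eapply is_derive_eq; first by repeat first [exact: dd|derive_step].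
by rewrite /= /ht /h; field; rewrite gt_eqF.
Qed.

Let dht x : 0 < x -> is_derive x 1 ht (x^-1 - u x / (1 - u x)).
Proof.
move=> x0; have dd := dh x0; eapply is_derive_eq.
  exact: (is_derive_pD dd (is_derive1_ln x0)).
by ring.
Qed.

Let dA2 x : 0 < x -> is_derive x 1 (fun x => x^-1 - u x / (1 - u x)) (u x / (1 - u x) ^+ 2 - x ^- 2).
Proof.
move=> x0; have /andP[u0 u1] := dens x0; derive_tac; try (rewrite gt_eqF//; lra).
by rewrite /=; field; rewrite !gt_eqF//; lra.
Qed.

Let dQ1 x : 0 < x -> is_derive x 1 Q1 (g1 x).
Proof.
move=> x0; have dd := is_derive_dilog x0; have d2 := dh x0.
have /andP[u0 u1] := dens x0.
eapply is_derive_eq; first by repeat first [exact: dd|exact: d2|derive_step].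
by rewrite /= /g1 /h; field; rewrite gt_eqF//; lra.
Qed.

Let dg1 x : 0 < x -> is_derive x 1 g1 (u x * (1 - u x - x) / (1 - u x) ^+ 2).
Proof.
move=> x0; have /andP[u0 u1] := dens x0; derive_tac; try (rewrite gt_eqF//; lra).
by rewrite /=; field; rewrite !gt_eqF//; lra.
Qed.

Let dQ2 x : 0 < x -> is_derive x 1 Q2 (g2 x).
Proof.
move=> x0; have d1 := dg1 x0; have d2 := dQ1 x0.
have /andP[u0 u1] := dens x0.
eapply is_derive_eq; first by repeat first [exact: d1|exact: d2|derive_step].
by rewrite /= /g1 /g2; field; rewrite gt_eqF//; lra.
Qed.

Let dg2 x : 0 < x -> is_derive x 1 g2 (x * u x * (2 - x - (2 + x) * u x) / (1 - u x) ^+ 3).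
Proof.
move=> x0; have /andP[u0 u1] := dens x0; derive_tac; try (rewrite ?expf_neq0 ?gt_eqF//; lra).
by rewrite /=; field; rewrite !gt_eqF//; lra.
Qed.

Let g1_dec x y : 0 < x -> x <= y -> g1 y <= g1 x.
Proof.
move=> x0 xy; rewrite -lerN2.
apply: (@derive_ge0_le R (fun x => - g1 x) (fun x => - (u x * (1 - u x - x) / (1 - u x) ^+ 2))) => // z zxy.
  by apply: is_derive_pN; apply: dg1; lra.
have z0 : 0 < z by lra.
have /andP[u0 u1] := dens z0; have := expRN_ge z => uz.
rewrite -mulNr -mulrN divr_ge0 ?exprn_ge0 ?mulr_ge0//; lra.
Qed.

Let g2_dec x y : 0 < x -> x <= y -> g2 y <= g2 x.
Proof.
move=> x0 xy; rewrite -lerN2.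
apply: (@derive_ge0_le R (fun x => - g2 x) (fun x => - (x * u x * (2 - x - (2 + x) * u x) / (1 - u x) ^+ 3))) => // z zxy.
  by apply: is_derive_pN; apply: dg2; lra.
have z0 : 0 < z by lra.
have /andP[u0 u1] := dens z0; have := expRN_pade (ltW z0) => uz.
by rewrite -mulNr -mulrN divr_ge0 ?exprn_ge0 ?mulr_ge0//; lra.
Qed.

Let g1_01 x : 0 < x -> 0 <= g1 x <= 1.
Proof.
move=> x0; have /andP[u0 u1] := dens x0; rewrite /g1 divr_ge0 ?mulr_ge0//=; try lra.
rewrite ler_pdivrMr ?mul1r; last lra.
by have := expRN_mul_le x; lra.
Qed.

Let g2_01 x : 0 < x -> 0 <= g2 x <= 1.
Proof.
move=> x0; have /andP[u0 u1] := dens x0; rewrite /g2 divr_ge0 ?mulr_ge0 ?exprn_ge0//=; try lra.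
rewrite ler_pdivrMr ?mul1r ?exprn_gt0//; last lra.
by apply: sqr_expRN_le; lra.
Qed.

Let ht_bounds x : 0 < x -> 0 <= ht x <= x.
Proof.
move=> x0; have /andP[u0 u1] := dens x0.
have l1 : 1 - u x <= x by have := expRN_ge x; lra.
have l2 : x * u x <= 1 - u x by have := expRN_mul_le x; lra.
rewrite /ht /h; apply/andP; split.
  have : ln (1 - u x) <= ln x by rewrite ler_ln ?posrE//; lra.
  by lra.
have : ln (x * u x) <= ln (1 - u x) by rewrite ler_ln ?posrE ?mulr_gt0//; lra.
by rewrite lnM ?posrE// expRK; lra.
Qed.

(** [A] tends to -zeta2 at 0, and its derivative [ht] lies between 0 and x. *)
Let A_bounds x : 0 < x -> - z2 <= A x <= - z2 + x ^+ 2.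
Proof.
move=> x0.
have inc y : 0 < y -> y <= x -> A y <= A x <= A y + x ^+ 2.
  move=> y0 yx.
  have D z : y <= z <= x -> is_derive z 1 A (ht z) by move=> zz; apply: dA; lra.
  have [c cxy E] := MVT_le yx D.
  have c0 : 0 < c by lra.
  have /andP[c1 c2] := ht_bounds c0.
  by apply/andP; split; nra.
have near0 e : 0 < e -> exists2 y, 0 < y <= x & `|A y + z2| <= e.
  move=> e0; have e2 : 0 < e / 2 by lra.
  have [d d0 Hd] := dilog_near0 e2.
  (* At the point s^2 the logarithmic term of [A] costs at most 2 s, because ln (1 / s) < 1 / s, and
     the linear one s^2 <= s; hence s <= e / 6. *)
  pose s := Num.min 1 (Num.min (e / 6) (Num.min d x)).
  have s0 : 0 < s by rewrite !lt_min ltr01 d0 x0 !andbT; lra.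
  have [s1 s2 s3 s4] : [/\ s <= 1, s <= e / 6, s <= d & s <= x].
    by rewrite /s; split; rewrite !ge_min lexx ?orbT.
  exists (s ^+ 2); first by rewrite exprn_gt0//=; nra.
  have sd : s ^+ 2 <= d by nra.
  have /andP[D1 D2] : z2 - e / 2 <= dilog (s ^+ 2) <= z2.
    have := Hd (s ^+ 2); rewrite sqr_ge0 sd => /(_ isT) h1; apply/andP; split; first lra.
    apply: le_trans (dilog_le (sqr_ge0 s)) _.
    by rewrite ler_piMr ?(ltW zeta2_gt0)// expR_le1 oppr_le0 sqr_ge0.
  have l1 : - s^-1 <= ln s.
    have : ln (s^-1) < s^-1 by apply: ln_sublinear; rewrite invr_gt0.
    by rewrite lnV ?posrE//; lra.
  have l2 : ln s <= 0 by apply: ln_le0.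
  have sl1 : - s <= s ^+ 2 * ln s.
    have : s ^+ 2 * - s^-1 <= s ^+ 2 * ln s by rewrite ler_wpM2l ?sqr_ge0.
    by have -> : s ^+ 2 * - s^-1 = - s by field; rewrite gt_eqF.
  have sl2 : s ^+ 2 * ln s <= 0 by rewrite mulr_ge0_le0 ?sqr_ge0.
  rewrite /A lnXn// -mulr_natl ler_norml.
  rewrite mulrCA.
  have ss : 0 <= s ^+ 2 <= s by rewrite sqr_ge0 /=; nra.
  move: (dilog (s ^+ 2)) (s ^+ 2 * ln s) D1 D2 sl1 sl2 => dl sl D1 D2 sl1 sl2.
  apply/andP; split; lra.
apply/andP; split; apply/ler_addgt0Pr => e /near0[y /andP[y0 yx]];
  have /andP[i1 i2] := inc y y0 yx; rewrite ler_norml => /andP[? ?]; lra.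
Qed.

(** This is the third derivative of [A], whose double poles at 0 cancel. Bounded near 0 and
    integrable at infinity, it keeps the sum of all midpoint errors at O(t^2), hence O(t) after
    division by t. *)
Let A3_bound x : 0 < x -> `|u x / (1 - u x) ^+ 2 - x ^- 2| <= Num.min 1 (x ^- 2).
Proof.
move=> x0; have /andP[u0 u1] := dens x0.
have q0 : 0 < (1 - u x) ^+ 2 by rewrite exprn_gt0//; lra.
have x2 : 0 < x ^+ 2 by rewrite exprn_gt0.
have B1 : u x / (1 - u x) ^+ 2 <= x ^- 2.
  by rewrite ler_pdivrMr// mulrC ler_pdivlMr// mulrC sqr_expRN_le// ltW.
have B2 : 0 <= u x / (1 - u x) ^+ 2 by rewrite divr_ge0// ltW.
rewrite le_min; apply/andP; split; rewrite ler_norml; apply/andP; split; try lra.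
have [x1|x1] := leP 1 x.
  have : x ^- 2 <= 1 by rewrite invf_le1// exprn_ege1.
  by lra.
suff : x ^- 2 - 1 <= u x / (1 - u x) ^+ 2 by lra.
rewrite ler_pdivlMr//.
have -> : (x ^- 2 - 1) * (1 - u x) ^+ 2 = (1 - x ^+ 2) * (1 - u x) ^+ 2 / x ^+ 2 by field; rewrite gt_eqF.
rewrite ler_pdivrMr//.
(* The bound gives (1 - e^-x) (2 + x) <= 2 x; after squaring, the claim reduces to 4 (1 - x^2) <= (2
   + x) (2 - x). *)
have pd := expRN_pade (ltW x0).
have a1 : (1 - u x) * (2 + x) <= 2 * x by nra.
have a2 : ((1 - u x) * (2 + x)) ^+ 2 <= (2 * x) ^+ 2.
  by apply: lerXn2r => //; rewrite nnegrE ?mulr_ge0//; lra.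
have y2 : 0 < (2 + x) ^+ 2 by rewrite exprn_gt0//; lra.
rewrite -(ler_pM2r y2).
apply: (@le_trans _ _ ((1 - x ^+ 2) * (2 * x) ^+ 2)).
  have -> : (1 - x ^+ 2) * (1 - u x) ^+ 2 * (2 + x) ^+ 2 = (1 - x ^+ 2) * ((1 - u x) * (2 + x)) ^+ 2 by ring.
  by rewrite ler_wpM2l//; nra.
have -> : u x * x ^+ 2 * (2 + x) ^+ 2 = x ^+ 2 * ((2 + x) * ((2 + x) * u x)) by ring.
have -> : (1 - x ^+ 2) * (2 * x) ^+ 2 = x ^+ 2 * (4 * (1 - x ^+ 2)) by ring.
rewrite ler_pM2l//.
apply: (@le_trans _ _ ((2 + x) * (2 - x))); first nra.
by rewrite ler_wpM2l//; lra.
Qed.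

(** The midpoint error is put in telescoping form: t / (1 + x)^2 is at most the drop of 1 / (1 + y)
    from the previous grid point to x. *)
Let cell k t : (0 < k)%N -> 0 < t ->
  `|A (k%:R * t + t / 2) - A (k%:R * t - t / 2) - t * ht (k%:R * t)|
   <= 9 / 4 * t ^+ 2 * ((1 + k.-1%:R * t)^-1 - (1 + k%:R * t)^-1).
Proof.
move=> k0 t0; have kr : 1 <= k%:R :> R by rewrite ler1n.
set x := k%:R * t; have x0 : 0 < x by rewrite mulr_gt0//; lra.
have xt : t <= x by rewrite /x ler_peMl// ltW.
have t20 : 0 <= t / 2 by lra.
have M := @midpoint_rule R A ht (fun x => x^-1 - u x / (1 - u x))
  (fun x => u x / (1 - u x) ^+ 2 - x ^- 2) x (t / 2) (9 / (1 + x) ^+ 2) t20.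
have -> : t * ht x = 2 * (t / 2) * ht x by field.
have p1 : 0 < 1 + x - t by lra.
apply: le_trans (M _ _ _ _) _.
- by move=> y yx; apply: dA; lra.
- by move=> y yx; apply: dht; lra.
- by move=> y yx; apply: dA2; lra.
- move=> y yx; have y0 : 0 < y by lra.
  apply: le_trans (A3_bound y0) _.
  rewrite ler_pdivlMr ?exprn_gt0//; last lra.
  (* Up to x = 2, the bound 1 and (1 + x)^2 <= 9 suffice; beyond, y >= x / 2 since t <= x, so that 1
     + x <= 3 y. *)
  have [x2|x2] := leP x 2.
    apply: (@le_trans _ _ (1 * (1 + x) ^+ 2)); last by nra.
    by rewrite ler_wpM2r ?sqr_ge0// ge_min lexx.
  apply: (@le_trans _ _ (y ^- 2 * (1 + x) ^+ 2)).
    by rewrite ler_wpM2r ?sqr_ge0// ge_min lexx orbT.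
  by rewrite mulrC ler_pdivrMr ?exprn_gt0//; nra.
have -> : k.-1%:R * t = x - t by rewrite /x -{2}(prednK k0) -natr1; ring.
have -> : 2 * (9 / (1 + x) ^+ 2) * (t / 2) ^+ 3 = 9 / 4 * t ^+ 2 * (t / (1 + x) ^+ 2) by field; rewrite gt_eqF//; lra.
rewrite ler_wpM2l ?mulr_ge0 ?sqr_ge0//; try lra.
have -> : (1 + (x - t))^-1 - (1 + x)^-1 = t / ((1 + x - t) * (1 + x)).
  by field; rewrite !gt_eqF//; lra.
rewrite ler_wpM2l ?(ltW t0)// lef_pV2 ?posrE ?mulr_gt0 ?exprn_gt0//; try lra.
by rewrite expr2 ler_wpM2r//; lra.
Qed.

(* [logP N t] is the logarithm of [\prod_(k < N) (1 - q ^+ k.+1)^-1] at [q = e^-t];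
   [- kap1] and [kap2] are its first two derivatives in [t]. *)
Definition logP N t := \sum_(k < N) h (k.+1%:R * t).
Definition kap1 N t := \sum_(k < N) k.+1%:R * u (k.+1%:R * t) / (1 - u (k.+1%:R * t)).
Definition kap2 N t := \sum_(k < N) k.+1%:R ^+ 2 * u (k.+1%:R * t) / (1 - u (k.+1%:R * t)) ^+ 2.

Let sum_ht N t : 0 < t ->
  `|A (N%:R * t + t / 2) - A (t / 2) - t * \sum_(k < N) ht (k.+1%:R * t)| <= 9 / 4 * t ^+ 2.
Proof.
move=> t0.
suff : `|A (N%:R * t + t / 2) - A (t / 2) - t * \sum_(k < N) ht (k.+1%:R * t)| <= 9 / 4 * t ^+ 2 * (1 - (1 + N%:R * t)^-1).
  move/le_trans; apply; rewrite ler_piMr ?mulr_ge0 ?sqr_ge0//; try lra.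
  by rewrite gerBl invr_ge0 addr_ge0// mulr_ge0// ltW.
elim: N => [|N IH].
  by rewrite big_ord0 mul0r add0r mulr0 subr0 subrr normr0 addr0 invr1 subrr mulr0.
rewrite big_ord_recr /= mulrDr.
have := @cell N.+1 t isT t0.
have -> : N.+1%:R * t - t / 2 = N%:R * t + t / 2 by rewrite -natr1; field.
rewrite /=.
have -> : A (N.+1%:R * t + t / 2) - A (t / 2) - (t * (\sum_(i < N) ht (i.+1%:R * t)) + t * ht (N.+1%:R * t)) =
  (A (N.+1%:R * t + t / 2) - A (N%:R * t + t / 2) - t * ht (N.+1%:R * t)) +
  (A (N%:R * t + t / 2) - A (t / 2) - t * \sum_(k < N) ht (k.+1%:R * t)) by ring.
move=> c; apply: le_trans (ler_normD _ _) _.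
apply: le_trans (lerD c IH) _.
by rewrite le_eqVlt; apply/orP; left; apply/eqP; ring.
Qed.

(** [logP] is the sum of [ht] minus ln N! and N ln t. At the upper end the antiderivative reproduces
    Stirling's expression for ln N! and (N + 1/2) ln t, which leaves ln t / 2 - ln (2 pi) / 2; the
    lower end gives zeta2 / t. *)
Let logP_bound N t : (0 < N)%N -> 0 < t ->
  `|logP N t - (z2 / t + ln t / 2 - ln (2 * pi) / 2)| <= 5 / 2 * t + 4 / N%:R + dilog (N%:R * t + t / 2) / t.
Proof.
move=> N0 t0; have Nr : 1 <= N%:R :> R by rewrite ler1n.
have S := sum_ht N t0; have St := stirling R N0.
have E : logP N t = \sum_(k < N) ht (k.+1%:R * t) - ln (N`!)%:R - N%:R * ln t.
  rewrite /logP /ht big_split /= -addrA -addrA -[LHS]addr0; congr (_ + _).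
  elim: N {N0 Nr S St} => [|N IH]; first by rewrite big_ord0 fact0 ln1 mul0r !subr0.
  rewrite big_ord_recr /= factS natrM !lnM ?posrE ?ltr0n ?fact_gt0// -natr1; lra.
set y := N%:R * t + t / 2 in S *.
have yE : y = (N%:R + 2^-1) * t by rewrite /y; field.
have N20 : 0 < N%:R + 2^-1 :> R by lra.
have Ay : A y / t = (N%:R + 2^-1) * ln (N%:R + 2^-1) + (N%:R + 2^-1) * ln t - (N%:R + 2^-1) - dilog y / t.
  have -> : ln (N%:R + 2^-1) = ln y - ln t :> R by rewrite yE lnM ?posrE//; ring.
  by rewrite /A {1 3}yE; field; rewrite gt_eqF.
have t20 : 0 < t / 2 by lra.
have /andP[a1 a2] := A_bounds t20.
have y0 : 0 <= y by rewrite yE mulr_ge0// ltW.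
have d0 : 0 <= dilog y / t by rewrite divr_ge0 ?dilog_ge0// ltW.
have S2 : `|A y / t - A (t / 2) / t - \sum_(k < N) ht (k.+1%:R * t)| <= 9 / 4 * t.
  rewrite -(ler_pM2r t0) -[X in `|_| * X](gtr0_norm t0) -normrM.
  have -> : (A y / t - A (t / 2) / t - \sum_(k < N) ht (k.+1%:R * t)) * t =
      A y - A (t / 2) - t * \sum_(k < N) ht (k.+1%:R * t).
    by field; rewrite gt_eqF.
  by have <- : 9 / 4 * t ^+ 2 = 9 / 4 * t * t by ring.
have a1' : - (z2 / t) <= A (t / 2) / t by rewrite -mulNr ler_wpM2r// invr_ge0 ltW.
have a2' : A (t / 2) / t <= - (z2 / t) + t / 4.
  apply: (@le_trans _ _ ((- z2 + (t / 2) ^+ 2) / t)); first by rewrite ler_wpM2r// invr_ge0 ltW.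
  by rewrite le_eqVlt; apply/orP; left; apply/eqP; field; rewrite gt_eqF.
move: S2; rewrite Ay E => S2.
move: St S2; move: (\sum_(_ < _) _) (z2 / t) (A _ / t) (dilog y / t) a1' a2' d0 => s zt At dy a1' a2' d0.
have N4 : 0 <= 4 / N%:R :> R by rewrite divr_ge0//; lra.
move: (4 / N%:R) N4 => N4 N40.
move: (ln (2 * pi)) => lp.
move: (ln (N`!)%:R) ((N%:R + 2^-1) * ln (N%:R + 2^-1)) => lN NN.
rewrite !ler_norml => /andP[s1 s2] /andP[s3 s4].
apply/andP; split; lra.
Qed.

(** Cruder than the midpoint rule, but enough for [kap1] and [kap2], which are wanted up to a
    relative error O(t); [logP] is exponentiated and must be known up to an absolute one. *)
Let riemann (g Q : R -> R) N t : 0 < t ->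
  (forall x, 0 < x -> is_derive x 1 Q (g x)) ->
  (forall x y, 0 < x -> x <= y -> g y <= g x) ->
  Q (N.+2%:R * t) - Q t <= t * (\sum_(k < N.+1) g (k.+1%:R * t)) <= t * g t + Q (N.+1%:R * t) - Q t.
Proof.
move=> t0 dQ gd.
have st k : (0 < k)%N -> t * g (k.+1%:R * t) <= Q (k.+1%:R * t) - Q (k%:R * t) <= t * g (k%:R * t).
  move=> k0; have kt : 0 < k%:R * t by rewrite mulr_gt0// ltr0n.
  have E : k.+1%:R * t = k%:R * t + t by rewrite -natr1; ring.
  rewrite E; have le : k%:R * t <= k%:R * t + t by lra.
  have [c cb ->] := MVT_le le (fun x hx => dQ x (lt_le_trans kt (andP hx).1)).
  rewrite [k%:R * t + t - _]addrC addKr ![t * _]mulrC.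
  have /andP[c1 c2] := cb.
  by rewrite !ler_wpM2r ?(ltW t0)//= gd//; lra.
elim: N => [|N /andP[I1 I2]].
  rewrite big_ord_recr big_ord0 /= add0r; have /andP[_] := @st 1 isT.
  by rewrite mul1r => ->; rewrite /=; lra.
rewrite big_ord_recr /= mulrDr.
have /andP[s1 _] := @st N.+1 isT; have /andP[_ s2] := @st N.+2 isT.
by apply/andP; split; lra.
Qed.

Let Q1_bounds x : 0 < x -> - z2 + x - x ^+ 2 <= Q1 x <= - z2 + x + x ^+ 2.
Proof.
move=> x0; have /andP[a1 a2] := A_bounds x0; have /andP[h1 h2] := ht_bounds x0.
have -> : Q1 x = A x + x - x * ht x by rewrite /Q1 /A /ht; ring.
by apply/andP; split; nra.
Qed.

Let h_bounds x : 0 < x -> 0 <= x * h x <= 2 / x.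
Proof.
move=> x0; have /andP[u0 u1] := dens x0.
have h0 : 0 <= h x by rewrite /h oppr_ge0 ln_le0//; lra.
rewrite mulr_ge0 ?(ltW x0)//=.
have l : h x <= u x / (1 - u x).
  have q : 0 < 1 - u x by lra.
  have i : (1 - u x)^-1 = 1 + u x / (1 - u x) by field; rewrite gt_eqF.
  have : ln (1 + u x / (1 - u x)) <= u x / (1 - u x).
    by apply: le_ln1Dx; apply: (@lt_le_trans _ _ 0); rewrite ?divr_ge0//; lra.
  by rewrite -i lnV ?posrE.
apply: (@le_trans _ _ (x * (u x / (1 - u x)))); first by rewrite ler_wpM2l// ltW.
rewrite ler_pdivlMr// mulrA.
have -> : x * u x / (1 - u x) * x = x ^+ 2 * u x / (1 - u x) by ring.
rewrite ler_pdivrMr; last lra.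
have := @expR_ge1Dxn R x 1 (ltW x0); rewrite -(ler_pM2r u0) expRxMexpNx_1.
rewrite (_ : (2`!)%:R = 2)//; lra.
Qed.

Let xg1_bound x : 0 < x -> 0 <= x * g1 x <= 6 / x.
Proof.
move=> x0; have /andP[u0 u1] := dens x0; have /andP[g0 _] := g1_01 x0.
rewrite mulr_ge0 ?(ltW x0)//= ler_pdivlMr// /g1.
have -> : x * (x * u x / (1 - u x)) * x = x ^+ 3 * u x / (1 - u x) by ring.
rewrite ler_pdivrMr; last lra.
have := @expR_ge1Dxn R x 2 (ltW x0); rewrite -(ler_pM2r u0) expRxMexpNx_1.
rewrite (_ : (3`!)%:R = 6)//; lra.
Qed.

Let dilog_decay x : 0 < x -> 0 <= dilog x <= z2 / x.
Proof.
move=> x0; rewrite dilog_ge0 ?(ltW x0)//=; apply: le_trans (dilog_le (ltW x0)) _.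
rewrite ler_wpM2l ?(ltW zeta2_gt0)// expRN lef_pV2 ?posrE ?expR_gt0//.
by have := expR_ge1Dx x; lra.
Qed.

Lemma partition_sums_asymptotics t : 0 < t <= 1 -> exists N0, forall N, (N0 <= N)%N ->
  [/\ `|logP N t - (z2 / t + ln t / 2 - ln (2 * pi) / 2)| <= 3 * t,
      `|kap1 N t - z2 / t ^+ 2| <= 3 / t &
      `|kap2 N t - 2 * z2 / t ^+ 3| <= 5 / t ^+ 2].
Proof.
move=> /andP[t0 t1].
(* For [N >= K] each tail const / (N t) falls below t^2, the numerator exceeding all the constants
   that occur. *)
pose K : R := (20 + 4 * z2) / t ^+ 3.
have z0 := zeta2_gt0.
have K0 : 0 < K by rewrite divr_gt0 ?exprn_gt0//; lra.
exists (Num.truncn K).+1 => -[//|N] NK.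
have Nr : K <= N.+1%:R.
  by apply: ltW; apply: lt_le_trans (truncnS_gt K) _; rewrite ler_nat.
have N0 : 0 < N.+1%:R :> R by lra.
have x0 : 0 < N.+1%:R * t by rewrite mulr_gt0.
have KE : (20 + 4 * z2) = K * t ^+ 3 by rewrite /K; field; rewrite gt_eqF.
have t2 : 0 < t ^+ 2 by rewrite exprn_gt0.
have t3 : 0 < t ^+ 3 by rewrite exprn_gt0.
have inv_le c y : 0 <= c -> c <= 20 + 4 * z2 -> N.+1%:R * t <= y -> c / y <= t ^+ 2.
  move=> c0 cK yN; rewrite ler_pdivrMr; last lra.
  apply: le_trans cK _; rewrite KE; apply: (@le_trans _ _ (t ^+ 2 * (N.+1%:R * t))).
    by rewrite exprSr mulrCA ler_wpM2l ?(ltW t2)// ler_wpM2r// ltW.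
  by rewrite ler_wpM2l// ltW.
have tk1 : t * \sum_(k < N.+1) g1 (k.+1%:R * t) = t ^+ 2 * kap1 N.+1 t.
  rewrite /kap1 !mulr_sumr; apply: eq_bigr => k _; rewrite /g1; ring.
have tk2 : t * \sum_(k < N.+1) g2 (k.+1%:R * t) = t ^+ 3 * kap2 N.+1 t.
  rewrite /kap2 !mulr_sumr; apply: eq_bigr => k _; rewrite /g2 exprMn; ring.
have y0 : 0 < N.+2%:R * t by rewrite mulr_gt0// ltr0n.
have yx : N.+1%:R * t <= N.+2%:R * t by rewrite ler_wpM2r ?(ltW t0)// ler_nat.
have /andP[q1 q2] := Q1_bounds t0.
have /andP[gt0 gt1] := g1_01 t0; have /andP[gt2 gt3] := g2_01 t0.
have /andP[hx1 hx2] := h_bounds x0; have /andP[hy1 hy2] := h_bounds y0.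
have /andP[dx1 dx2] := dilog_decay x0; have /andP[dy1 dy2] := dilog_decay y0.
have /andP[gx1 gx2] := xg1_bound x0; have /andP[gy1 gy2] := xg1_bound y0.
split.
- apply: le_trans (logP_bound (ltn0Sn N) t0) _.
  have b1 : 4 / N.+1%:R <= t / 4.
    have -> : 4 / N.+1%:R = (16 / (N.+1%:R * t)) * (t / 4) by field; rewrite !gt_eqF.
    rewrite ler_piMl//; first lra.
    by apply: le_trans (inv_le 16 _ _ _ (lexx _)) _; [lra|lra|nra].
  have b2 : dilog (N.+1%:R * t + t / 2) / t <= t / 4.
    have w0 : 0 < N.+1%:R * t + t / 2 by lra.
    have /andP[_ dl] := dilog_decay w0.
    have q : z2 * 4 / (N.+1%:R * t + t / 2) <= t ^+ 2 by apply: inv_le; lra.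
    rewrite ler_pdivrMr//; move: dl q.
    by move: (_ + _)^-1 (dilog _) => w dw; rewrite expr2; lra.
  by apply: le_trans (lerD (lerD (lexx _) b1) b2) _; lra.
- have /andP[r1 r2] := riemann N t0 dQ1 g1_dec.
  rewrite tk1 in r1 r2.
  have b1 : (2 + z2) / (N.+2%:R * t) <= t ^+ 2 by apply: inv_le; lra.
  rewrite -(ler_pM2r t2) -[X in `|_| * X](gtr0_norm t2) -normrM.
  have -> : (kap1 N.+1 t - z2 / t ^+ 2) * t ^+ 2 = t ^+ 2 * kap1 N.+1 t - z2 by field; rewrite gt_eqF.
  have -> : 3 / t * t ^+ 2 = 3 * t by field; rewrite gt_eqF.
  have Qx : Q1 (N.+1%:R * t) <= 0.
    by rewrite /Q1; move: dx1 hx1; move: (dilog _) (_ * h _) => a b; lra.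
  have Qy : - t ^+ 2 <= Q1 (N.+2%:R * t).
    rewrite /Q1; move: dy2 hy2 b1.
    by move: (N.+2%:R * t)^-1 (dilog _) (_ * h _) => w a b; lra.
  have tt : t ^+ 2 <= t by nra.
  have tg : t * g1 t <= t by rewrite ler_piMr// ltW.
  rewrite ler_norml; apply/andP; split; lra.
have /andP[r1 r2] := riemann N t0 dQ2 g2_dec.
rewrite tk2 in r1 r2.
have b1 : (6 + 2 * (2 + z2)) / (N.+2%:R * t) <= t ^+ 2 by apply: inv_le; lra.
rewrite -(ler_pM2r t3) -[X in `|_| * X](gtr0_norm t3) -normrM.
have -> : (kap2 N.+1 t - 2 * z2 / t ^+ 3) * t ^+ 3 = t ^+ 3 * kap2 N.+1 t - 2 * z2 by field; rewrite gt_eqF.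
have -> : 5 / t ^+ 2 * t ^+ 3 = 5 * t by field; rewrite gt_eqF.
have Qx : Q2 (N.+1%:R * t) <= 0.
  rewrite /Q2 /Q1; move: dx1 hx1 gx1.
  by move: (dilog _) (_ * h _) (_ * g1 _) => a b c; lra.
have Qy : - t ^+ 2 <= Q2 (N.+2%:R * t).
  rewrite /Q2 /Q1; move: dy2 hy2 gy2 b1.
  by move: (N.+2%:R * t)^-1 (dilog _) (_ * h _) (_ * g1 _) => w a b c; lra.
have tt : t ^+ 2 <= t by nra.
have tg : t * g2 t <= t by rewrite ler_piMr// ltW.
have tg1 : 0 <= t * g1 t <= t by rewrite mulr_ge0 ?ler_piMr// ltW.
move: tg1 => /andP[tg2 tg3].
have Q2t : Q2 t = - (t * g1 t) + 2 * Q1 t by [].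
rewrite ler_norml; apply/andP; split; lra.
Qed.

End Asymptotics.

(** * Cauchy's formula in real form *)

Section PolarForm.
Variable R : realType.
Implicit Types (r al f x : R).

(* [1 / (1 - r e^(i al)) = pmod r al * e^(i parg r al)] *)
Definition pden r al : R := 1 - 2 * r * cos al + r ^+ 2.
Definition pmod r al : R := expR (- ln (pden r al) / 2).
Definition parg r al : R := atan (r * sin al / (1 - r * cos al)).

Lemma pden_ge r al : 0 < r < 1 -> (1 - r) ^+ 2 <= pden r al.
Proof.
by move=> /andP[r0 r1]; rewrite /pden; have := cos_le1 al; nra.
Qed.

Lemma pden_gt0 r al : 0 < r < 1 -> 0 < pden r al.
Proof.
move=> r01; apply: lt_le_trans (pden_ge al r01).
by rewrite exprn_gt0//; lra.
Qed.

Lemma one_sub_rcos_gt0 r al : 0 < r < 1 -> 0 < 1 - r * cos al.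
Proof. by move=> /andP[r0 r1]; have := cos_le1 al; nra. Qed.

Lemma pmod_gt0 r al : 0 < pmod r al. Proof. exact: expR_gt0. Qed.

Lemma pmod_sqr r al : 0 < r < 1 -> pmod r al ^+ 2 * pden r al = 1.
Proof.
move=> r01; rewrite /pmod -expRM_natl -{2}(@lnK R (pden r al)) ?posrE ?pden_gt0// -expRD.
by rewrite (_ : _ + _ = 0) ?expR0//; field.
Qed.

Lemma pmod_le r al : 0 < r < 1 -> pmod r al <= (1 - r)^-1.
Proof.
move=> r01; have /andP[r0 r1] := r01.
have p0 : 0 < (1 - r)^-1 by rewrite invr_gt0; lra.
rewrite -(@ler_sqr R) ?nnegrE ?(ltW (pmod_gt0 _ _)) ?(ltW p0)//.
have := pmod_sqr al r01 => E.
rewrite exprVn -[leRHS]mul1r ler_pdivlMr ?exprn_gt0//; last lra.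
by have := ler_wpM2l (sqr_ge0 (pmod r al)) (pden_ge al r01); rewrite E.
Qed.

(** As 1 - r cos al > 0, the arctangent is the correct branch of the argument; both sides are
    nonnegative and may be compared by their squares. *)
Lemma cos_parg r al : 0 < r < 1 -> cos (parg r al) = (1 - r * cos al) * pmod r al.
Proof.
move=> r01; have d0 := one_sub_rcos_gt0 al r01; have D0 := pden_gt0 al r01.
have p0 := pmod_gt0 r al; have ps := pmod_sqr al r01.
apply/eqP; rewrite -(@eqrXn2 _ 2)//; last 2 first.
- by rewrite cos_atan invr_ge0 sqrtr_ge0.
- by rewrite mulr_ge0 ?ltW.
apply/eqP; rewrite cos_atan [LHS]exprVn sqr_sqrtr ?addr_ge0 ?sqr_ge0// [in RHS]exprMn.
have -> : pmod r al ^+ 2 = (pden r al)^-1.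
  by apply: (mulIf (lt0r_neq0 D0)); rewrite ps mulVf ?lt0r_neq0.
have -> : 1 + (r * sin al / (1 - r * cos al)) ^+ 2 = pden r al / (1 - r * cos al) ^+ 2.
  rewrite /pden expr_div_n [X in _ + X / _]exprMn sin2cos2; field; exact: lt0r_neq0.
by rewrite invf_div.
Qed.

Lemma sin_parg r al : 0 < r < 1 -> sin (parg r al) = r * sin al * pmod r al.
Proof.
move=> r01; have d0 := one_sub_rcos_gt0 al r01; have p0 := pmod_gt0 r al.
have c0 : cos (parg r al) != 0 by rewrite cos_parg// mulf_neq0// lt0r_neq0.
have := atanK (r * sin al / (1 - r * cos al)); rewrite /tan -/(parg r al).
move=> E; rewrite -[LHS](divfK c0) E cos_parg//; field; exact: lt0r_neq0.
Qed.

(** The real part of e^(i f) = e^(i f) (1 - r e^(i al)) / (1 - r e^(i al)) with the inverse in polar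
    form; it makes the geometric sum telescope. *)
Lemma polar_step r al f : 0 < r < 1 ->
  pmod r al * cos (f + parg r al) - r * (pmod r al * cos (f + al + parg r al)) = cos f.
Proof.
move=> r01; rewrite [cos (f + al + _)]cosD [cos (f + parg _ _)]cosD cosD sinD.
rewrite cos_parg// sin_parg//.
have E := pmod_sqr al r01; rewrite /pden in E.
have cs := cos2Dsin2 al.
transitivity (cos f * (pmod r al ^+ 2 * (1 - 2 * r * cos al + r ^+ 2 * (cos al ^+ 2 + sin al ^+ 2)))).
  by ring.
by rewrite cs mulr1 E mulr1.
Qed.

Lemma polar_sum r al f M : 0 < r < 1 ->
  \sum_(i < M) r ^+ i * cos (f + i%:R * al) =
  pmod r al * (cos (f + parg r al) - r ^+ M * cos (f + M%:R * al + parg r al)).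
Proof.
move=> r01; elim: M => [|M IH].
  by rewrite big_ord0 expr0 mul0r addr0 mul1r subrr mulr0.
rewrite big_ord_recr /= IH -(polar_step al (f + M%:R * al) r01) exprSr.
have -> : f + M.+1%:R * al = f + M%:R * al + al by rewrite -natr1; ring.
by ring.
Qed.

End PolarForm.

Section GeneratingFunction.
Variable R : realType.
Variable q : R.
Hypothesis q01 : 0 < q < 1.

(* A partition with parts of size at most [N], given by its multiplicities, all less
   than [M]; [mdeg m] is its size. *)
Definition mdeg N M (m : {ffun 'I_N -> 'I_M}) : nat := (\sum_(k < N) k.+1 * m k)%N.

Definition cosgen N M (th x : R) : R :=
  \sum_(m : {ffun 'I_N -> 'I_M}) q ^+ mdeg m * cos ((mdeg m)%:R * th - x).

Let z th : R[i] := (q * cos th +i* (q * sin th))%C.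
Let e x : R[i] := (cos x +i* sin x)%C.

Let eD x y : e (x + y) = e x * e y.
Proof.
by apply/eqP; rewrite eq_complex /= cosD sinD [cos x * sin y]mulrC addrC [sin x * _]mulrC eqxx /=; apply/eqP; ring.
Qed.

Let zX th d : z th ^+ d = (q ^+ d)%:C%C * e (d%:R * th).
Proof.
elim: d => [|d IH].
  by rewrite !expr0 mul0r /e cos0 sin0 mul1r.
rewrite exprSr IH.
have -> : z th = q%:C%C * e th by apply/eqP; rewrite eq_complex /= !mul0r subr0 addr0 !eqxx.
rewrite mulrACA -eD -rmorphM /= -exprSr; congr (_ * e _).
by rewrite -natr1; ring.
Qed.

Let ReM (c : R) (w : R[i]) : complex.Re (c%:C%C * w) = c * complex.Re w.
Proof. by case: w => a b /=; rewrite mul0r subr0. Qed.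

Let cosgenE N M th x :
  cosgen N M th x = complex.Re ((\prod_(k < N) \sum_(i < M) (z th ^+ k.+1) ^+ i) * e (- x)).
Proof.
rewrite bigA_distr_bigA /= mulr_suml raddf_sum /=; apply: eq_bigr => m _.
rewrite (eq_bigr (fun k : 'I_N => z th ^+ (k.+1 * m k))) => [|k _]; last by rewrite exprM.
by rewrite -expr_sum -/(mdeg m) zX -mulrA -eD ReM.
Qed.

Lemma cosgen_rec N M th x : cosgen N.+1 M th x =
  \sum_(i < M) (q ^+ N.+1) ^+ i * cosgen N M th (x - i%:R * (N.+1%:R * th)).
Proof.
rewrite cosgenE big_ord_recr /= -mulrA mulr_suml mulr_sumr raddf_sum /=.
apply: eq_bigr => i _; rewrite cosgenE -ReM; congr complex.Re.
rewrite -!exprM zX -mulrA -eD mulrCA; congr (_ * (_ * e _)).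
by rewrite natrM; ring.
Qed.

Let qk k : 0 < q ^+ k.+1 < 1.
Proof. by case/andP: q01 => q0 q1; rewrite exprn_gt0//= exprn_ilt1// ltW. Qed.

Definition gmod N (th : R) : R := \prod_(k < N) pmod (q ^+ k.+1) (k.+1%:R * th).
Definition garg N (th : R) : R := \sum_(k < N) parg (q ^+ k.+1) (k.+1%:R * th).
Definition gmax N : R := \prod_(k < N) (1 - q ^+ k.+1)^-1.

Lemma gmod_ge0 N th : 0 <= gmod N th.
Proof. by apply: prodr_ge0 => k _; rewrite ltW// pmod_gt0. Qed.

Lemma gmod_le N th : gmod N th <= gmax N.
Proof. by apply: ler_prod => k _; rewrite ltW ?pmod_gt0//= pmod_le. Qed.

Lemma gmax_gt0 N : 0 < gmax N.
Proof. by apply: prodr_gt0 => k _; rewrite invr_gt0 subr_gt0; case/andP: (qk k). Qed.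

(* [gmod] and [garg] are the modulus and the argument of Euler's product, the limit of
   the truncated series [cosgen] as [M] grows. *)
Lemma cosgen_approx N M th x :
  `|cosgen N M th x - gmod N th * cos (garg N th - x)| <= N%:R * gmax N * q ^+ M.
Proof.
have /andP[q0 q1] := q01.
elim: N x => [|N IH] x.
  rewrite mul0r mul0r /gmod /garg !big_ord0 mul1r cosgenE big_ord0 mul1r /= cosN.
  by rewrite add0r cosN subrr normr0.
rewrite cosgen_rec /gmod /garg /gmax !big_ord_recr /= -/(gmod N th) -/(garg N th) -/(gmax N).
set r := q ^+ N.+1; set al := N.+1%:R * th.
have r01 : 0 < r < 1 := qk N; have /andP[r0 r1] := r01.
have rq : r <= q by rewrite /r exprS ler_piMr ?(ltW q0)// exprn_ile1// ltW.
clearbody r.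
have p1 := pmod_le al r01; have p0 := pmod_gt0 r al.
have G0 := gmax_gt0 N.
have i0 : 0 < (1 - r)^-1 by rewrite invr_gt0; lra.
have ps := polar_sum al (garg N th - x) M r01.
(* A new part size multiplies the previous error by at most 1 / (1 - r) and adds one geometric tail,
   with r^M <= q^M; hence the factor [N] in the bound. *)
have E : gmod N th * pmod r al * cos (garg N th + parg r al - x) =
   \sum_(i < M) r ^+ i * (gmod N th * cos (garg N th - (x - i%:R * al)))
   + gmod N th * pmod r al * (r ^+ M * cos (garg N th - x + M%:R * al + parg r al)).
  rewrite (eq_bigr (fun i : 'I_M => gmod N th * (r ^+ i * cos (garg N th - x + i%:R * al)))).
    2: by move=> i _; rewrite mulrCA; congr (_ * (_ * cos _)); ring.
  rewrite -mulr_sumr ps.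
  have -> : garg N th + parg r al - x = garg N th - x + parg r al by ring.
  by ring.
rewrite E opprD addrA -sumrB.
apply: le_trans (ler_normB _ _) _.
have b1 : `|\sum_(i < M) (r ^+ i * cosgen N M th (x - i%:R * al)
      - r ^+ i * (gmod N th * cos (garg N th - (x - i%:R * al))))| <= N%:R * gmax N * q ^+ M * (1 - r)^-1.
  apply: le_trans (ler_norm_sum _ _ _) _.
  apply: (@le_trans _ _ (\sum_(i < M) r ^+ i * (N%:R * gmax N * q ^+ M))).
    apply: ler_sum => i _; rewrite -mulrBr normrM ger0_norm ?exprn_ge0 ?(ltW r0)//.
    by apply: ler_wpM2l; [apply: exprn_ge0; exact: ltW r0|exact: IH].
  have K0 : 0 <= N%:R * gmax N * q ^+ M by rewrite !mulr_ge0 ?exprn_ge0// ltW.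
  rewrite -mulr_suml mulrC; apply: ler_wpM2l => //.
  rewrite -[leRHS]mul1r ler_pdivlMr ?subr_gt0// mulrC -opprB mulNr -subrX1 opprB.
  by rewrite gerBl exprn_ge0// ltW.
have b2 : `|gmod N th * pmod r al * (r ^+ M * cos (garg N th - x + M%:R * al + parg r al))|
    <= gmax N * (1 - r)^-1 * q ^+ M.
  have m0 := gmod_ge0 N th.
  rewrite !normrM [`|gmod _ _|]ger0_norm// [`|pmod _ _|]gtr0_norm//.
  apply: ler_pM; rewrite ?mulr_ge0 ?normr_ge0 ?(ltW p0)//.
    by apply: ler_pM; rewrite ?(ltW p0)// gmod_le.
  rewrite ger0_norm ?exprn_ge0 ?(ltW r0)// -[leRHS]mulr1.
  apply: ler_pM; rewrite ?exprn_ge0 ?normr_ge0 ?cos_max ?(ltW r0)//.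
  by apply: lerXn2r; rewrite ?nnegrE ?(ltW r0) ?(ltW q0).
apply: le_trans (lerD b1 b2) _.
by rewrite le_eqVlt; apply/orP; left; apply/eqP; rewrite -natr1; ring.
Qed.

End GeneratingFunction.

(** * Fourier inversion for p(n) *)

Section Fourier.
Variable R : realType.
Variable q : R.
Hypothesis q01 : 0 < q < 1.
Notation mu := (@lebesgue_measure R).

Let qk k : 0 < q ^+ k.+1 < 1.
Proof. by case/andP: q01 => q0 q1; rewrite exprn_gt0//= exprn_ilt1// ltW. Qed.

Lemma is_derive_psum (I : finType) (F : I -> R -> R) (dF : I -> R) (x : R) :
  (forall i, is_derive x 1 (F i) (dF i)) ->
  is_derive x 1 (fun y => \sum_i F i y) (\sum_i dF i).
Proof.
move=> H; have Hs : forall s : seq I, is_derive x 1 (fun y => \sum_(i <- s) F i y) (\sum_(i <- s) dF i).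
  elim=> [|i s IH].
    by rewrite big_nil; under eq_fun do rewrite big_nil; exact: is_derive_pcst.
  rewrite big_cons; under eq_fun do rewrite big_cons.
  exact: is_derive_pD.
exact: Hs.
Qed.

Lemma continuous_pmod (r c : R) : 0 < r < 1 -> continuous (fun th : R => pmod r (c * th)).
Proof.
move=> r01 th; eapply is_derive_cts; rewrite /pmod /pden; repeat derive_step.
exact: pden_gt0 (c * th) r01.
Qed.

Lemma continuous_parg (r c : R) : 0 < r < 1 -> continuous (fun th : R => parg r (c * th)).
Proof.
move=> r01 th; eapply is_derive_cts; rewrite /parg; repeat derive_step.
by rewrite lt0r_neq0// one_sub_rcos_gt0.
Qed.

Lemma continuous_gmod N : continuous (gmod q N).
Proof.
rewrite /gmod; elim: N => [|N IH].
  by under eq_fun do rewrite big_ord0; exact: cst_continuous.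
under eq_fun do rewrite big_ord_recr; move=> x.
by apply: cvgM; [exact: IH|exact: continuous_pmod].
Qed.

Lemma continuous_garg N : continuous (garg q N).
Proof.
rewrite /garg; elim: N => [|N IH].
  by under eq_fun do rewrite big_ord0; exact: cst_continuous.
under eq_fun do rewrite big_ord_recr; move=> x.
by apply: cvgD; [exact: IH|exact: continuous_parg].
Qed.

Lemma continuous_fourier_integrand N (n : nat) :
  continuous (fun th => gmod q N th * cos (garg q N th - n%:R * th)).
Proof.
move=> x; apply: cvgM; first exact: continuous_gmod.
apply: (@continuous_comp _ _ _ (fun th => garg q N th - n%:R * th) (@cos R)); last exact: continuous_cos.
apply: cvgB; first exact: continuous_garg.
by apply: cvgM; [exact: cvg_cst|exact: cvg_id].
Qed.

Lemma sin_natM_pi (k : nat) : sin (k%:R * pi) = 0 :> R.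
Proof.
elim: k => [|k IH]; first by rewrite mul0r sin0.
by rewrite -natr1 mulrDl mul1r sinDpi IH oppr0.
Qed.

(** Integer frequencies are orthogonal on [-pi, pi]: only the tables of degree [n] survive, and
    these are the partitions of [n]. *)
Lemma integral_cosgen N M (n : nat) : (n <= N)%N -> (n < M)%N ->
  continuous (fun th => cosgen q N M th (n%:R * th)) /\
  \int[mu]_(th in `[(- pi), pi]) cosgen q N M th (n%:R * th) = 2 * pi * (q ^+ n * (npart n)%:R).
Proof.
move=> nN nM; have pi0 := pi_gt0 R.
pose F (d : nat) (th : R) := if d == n then th else sin ((d%:R - n%:R) * th) / (d%:R - n%:R).
have dF d (th : R) : is_derive th 1 (F d) (cos (d%:R * th - n%:R * th)).
  rewrite /F; case: eqVneq => [->|dn].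
    by rewrite subrr cos0; exact: is_derive_pid.
  have dn0 : d%:R - n%:R != 0 :> R by rewrite subr_eq0 eqr_nat.
  derive_tac; rewrite /= -mulrBl.
  by set c := d%:R - n%:R in dn0 *; field.
have C : continuous (fun th => cosgen q N M th (n%:R * th)).
  move=> th; eapply is_derive_cts; rewrite /cosgen.
  by apply: is_derive_psum => m; repeat derive_step.
split=> //.
have D (th : R) : is_derive th 1 (fun th => \sum_(m : {ffun 'I_N -> 'I_M}) q ^+ mdeg m * F (mdeg m) th)
    (cosgen q N M th (n%:R * th)).
  have dFm (m : {ffun 'I_N -> 'I_M}) : is_derive th 1 (fun th => q ^+ mdeg m * F (mdeg m) th)
      (q ^+ mdeg m * cos ((mdeg m)%:R * th - n%:R * th)).
    eapply is_derive_eq; first exact: (is_derive_pM (is_derive_pcst _ _) (dF (mdeg m) th)).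
    by rewrite mulr0 addr0.
  exact: (is_derive_psum dFm).
have ab : - pi < pi :> R by lra.
rewrite (Rintegral_FTC2 ab D C) -sumrB -(card_mult_ffun nN nM).
rewrite -sum1_card natr_sum mulrA [in RHS]big_mkcond /= mulr_sumr.
apply: eq_bigr => m _; rewrite inE -/(mdeg m) -mulrBr /F.
case: eqVneq => [->|mn]; first by rewrite mulr1 opprK mulrC; congr (_ * _); rewrite mulrDl mul1r.
rewrite mulrN sinN.
have -> : sin (((mdeg m)%:R - n%:R) * pi) = 0 :> R.
  have [le|/ltnW le] := leqP n (mdeg m); first by rewrite -natrB// sin_natM_pi.
  by rewrite -opprB -natrB// mulNr sinN sin_natM_pi oppr0.
by rewrite oppr0 mul0r subrr !mulr0.
Qed.

(** The identity is exact: the integral of [cosgen] equals the right side for every [M > n] and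
    differs from the left side, which does not involve [M], by O(q^M). *)
Lemma npart_fourier N (n : nat) : (n <= N)%N ->
  \int[mu]_(th in `[(- pi), pi]) (gmod q N th * cos (garg q N th - n%:R * th))
    = 2 * pi * (q ^+ n * (npart n)%:R).
Proof.
move=> nN; have pi0 := pi_gt0 R; have /andP[q0 q1] := q01.
set f := fun th => gmod q N th * _.
set I := \int[mu]_(th in _) _; set J := (X in _ = X).
have cf : continuous f := @continuous_fourier_integrand N n.
have K0 : 0 <= N%:R * gmax q N :> R by rewrite mulr_ge0// ltW// gmax_gt0.
have B M : (n < M)%N -> `|J - I| <= 2 * pi * (N%:R * gmax q N) * q ^+ M.
  move=> nM; have [cg E] := integral_cosgen nN nM.
  have ig := continuous_integrable_itv (- pi) pi cg.
  have iF := continuous_integrable_itv (- pi) pi cf.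
  rewrite /J -E /I -RintegralB//.
  apply: le_trans (le_normr_Rintegral _ _) _ => //.
    by apply: continuous_integrable_itv => x; apply: cvgB; [exact: cg|exact: cf].
  apply: (@le_trans _ _ (\int[mu]_(th in `[(- pi), pi]) (N%:R * gmax q N * q ^+ M))).
    apply: le_Rintegral => //.
    - apply: continuous_integrable_itv => x; apply: cvg_norm.
      by apply: cvgB; [exact: cg|exact: cf].
    - by apply: continuous_integrable_itv; exact: cst_continuous.
    - by move=> x _; exact: cosgen_approx.
  have mpi : mu `[(- pi), pi] = (2 * pi)%:E.
    rewrite lebesgue_measure_itv /= lte_fin (_ : - pi < pi :> R); last lra.
    by rewrite -EFinB opprK mulrDl mul1r.
  rewrite Rintegral_cst// [X in fine X]mpi /=.
  by rewrite le_eqVlt; apply/orP; left; apply/eqP; move: (@pi R) => p; ring.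
apply/eqP; rewrite eq_sym -subr_eq0 -normr_le0; apply/ler_addgt0Pr => e e0; rewrite add0r.
pose K := 2 * pi * (N%:R * gmax q N) + 1.
have Kp : 0 < K by rewrite ltr_wpDl// mulr_ge0// mulr_ge0// ltW.
have : (fun M => q ^+ M) @ \oo --> (0 : R).
  by apply: cvg_expr; rewrite ger0_norm ?ltW.
move/(@cvgrPdist_le R R)/(_ (e / K)) => /(_ _)[]; first by rewrite divr_gt0.
move=> M0 _ HM; have := HM (n.+1 + M0)%N; rewrite /= leq_addl => /(_ isT).
rewrite sub0r normrN ger0_norm ?exprn_ge0 ?(ltW q0)// => h.
apply: le_trans (B (n.+1 + M0)%N _) _; first by rewrite addSn ltnS leq_addr.
apply: (@le_trans _ _ (K * q ^+ (n.+1 + M0))).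
  by rewrite ler_wpM2r ?exprn_ge0 ?(ltW q0)// /K lerDl.
by rewrite mulrC -ler_pdivlMr.
Qed.

End Fourier.

(** * Decay away from the positive real axis *)

Section SingleFactor.
Variable R : realType.
Implicit Types (r al y : R).

(* [(1 - r) * pmod r al = exp (- pdecay r al)] *)
Definition pdecay r al : R := ln (1 + 2 * r * (1 - cos al) / (1 - r) ^+ 2) / 2.

Let x_ge0 r al : 0 < r < 1 -> 0 <= 2 * r * (1 - cos al) / (1 - r) ^+ 2.
Proof.
move=> /andP[r0 r1]; rewrite divr_ge0 ?sqr_ge0// mulr_ge0//.
by rewrite mulr_ge0// ltW.
Qed.

Lemma pmod_decay r al : 0 < r < 1 -> pmod r al = (1 - r)^-1 * expR (- pdecay r al).
Proof.
move=> r01; have /andP[r0 r1] := r01.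
have d0 : 0 < 1 - r by lra.
have x0 := x_ge0 al r01; have x1 : 0 < 1 + 2 * r * (1 - cos al) / (1 - r) ^+ 2 by lra.
have E : pden r al = (1 - r) ^+ 2 * (1 + 2 * r * (1 - cos al) / (1 - r) ^+ 2).
  by rewrite /pden; field; exact: lt0r_neq0.
rewrite /pmod E lnM ?posrE ?exprn_gt0// lnXn// -[ln _ *+ 2]mulr_natl.
have -> : - (2 * ln (1 - r) + ln (1 + 2 * r * (1 - cos al) / (1 - r) ^+ 2)) / 2 =
   - ln (1 - r) - pdecay r al by rewrite /pdecay; field.
by rewrite expRD expRN lnK.
Qed.

Lemma pdecay_ge0 r al : 0 < r < 1 -> 0 <= pdecay r al.
Proof. by move=> r01; rewrite divr_ge0// ln_ge0// lerDl x_ge0. Qed.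

Lemma pdecay_le r al : 0 < r < 1 -> pdecay r al <= r * al ^+ 2 / (1 - r) ^+ 2 / 2.
Proof.
move=> r01; have /andP[r0 r1] := r01; have x0 := x_ge0 al r01.
rewrite /pdecay ler_wpM2r ?invr_ge0//.
have : ln (1 + 2 * r * (1 - cos al) / (1 - r) ^+ 2) <= 2 * r * (1 - cos al) / (1 - r) ^+ 2.
  by apply: le_ln1Dx; lra.
move/le_trans; apply; rewrite ler_wpM2r ?invr_ge0 ?sqr_ge0//.
by have := cos_ge_quad al; nra.
Qed.

(** With c = r / (1 - r)^2 and v = 2 (1 - cos al), this combines ln (1 + c v) >= c v - (c v)^2 with
    al^2 - al^4 <= v <= al^2. *)
Lemma pdecay_ge r al : 0 < r < 1 ->
  r * al ^+ 2 / (1 - r) ^+ 2 / 2 - (r / (1 - r) ^+ 2 + (r / (1 - r) ^+ 2) ^+ 2) * al ^+ 4 / 2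
   <= pdecay r al.
Proof.
move=> r01; have /andP[r0 r1] := r01; have x0 := x_ge0 al r01.
have := ln1D_ge x0; rewrite /pdecay.
set c := r / (1 - r) ^+ 2.
have c0 : 0 <= c by rewrite divr_ge0 ?sqr_ge0// ltW.
have -> : 2 * r * (1 - cos al) / (1 - r) ^+ 2 = c * (2 * (1 - cos al)) by rewrite /c; ring.
have -> : r * al ^+ 2 / (1 - r) ^+ 2 = c * al ^+ 2 by rewrite /c; ring.
set v := 2 * (1 - cos al) => H.
have v1 : v <= al ^+ 2 by have := cos_ge_quad al; rewrite /v; lra.
have v2 : al ^+ 2 - al ^+ 4 <= v by have := cos_le_quart al; have := sqr_ge0 (al ^+ 2); rewrite /v -exprM; lra.
have v0 : 0 <= v by rewrite /v mulr_ge0// subr_ge0 cos_le1.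
have v3 : v ^+ 2 <= al ^+ 4.
  by rewrite -[4%N]/(2 * 2)%N exprM; apply: lerXn2r; rewrite ?nnegrE ?sqr_ge0.
have m1 : c * (al ^+ 2 - al ^+ 4) <= c * v by rewrite ler_wpM2l.
have m2 : c ^+ 2 * v ^+ 2 <= c ^+ 2 * al ^+ 4 by rewrite ler_wpM2l ?sqr_ge0.
move: H; rewrite exprMn; move: (ln _) (v ^+ 2) (al ^+ 4) (al ^+ 2) m1 m2 => L v' a4 a2 m1 m2 H; lra.
Qed.

Lemma ln1D_ge_frac y : 0 <= y -> y / (1 + y) <= ln (1 + y).
Proof.
move=> y0; have y1 : 0 < 1 + y by lra.
have : ln (1 - y / (1 + y)) <= - (y / (1 + y)).
  apply: le_ln1Dx; rewrite ltrN2 ltr_pdivrMr//; lra.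
have -> : 1 - y / (1 + y) = (1 + y)^-1 by field; exact: lt0r_neq0.
by rewrite lnV ?posrE// lerN2.
Qed.

(** The logarithm is at least ln (1 + y) with y = 2/3 (1 - cos al) <= 4/3, and ln (1 + y) >= y / (1
    + y) >= 3 y / 7; half of this is the claim. *)
Lemma pdecay_ge_cos r al : 1 / 3 <= r < 1 -> (1 - cos al) / 7 <= pdecay r al.
Proof.
move=> /andP[r3 r1]; have r01 : 0 < r < 1 by lra.
have y0 : 0 <= 1 - cos al by rewrite subr_ge0 cos_le1.
have y2 : 1 - cos al <= 2 by have := cos_geN1 al; lra.
set y := 2 / 3 * (1 - cos al).
have yx : y <= 2 * r * (1 - cos al) / (1 - r) ^+ 2.
  rewrite ler_pdivlMr ?exprn_gt0//; last lra.
  have : (1 - r) ^+ 2 <= 1 by apply: exprn_ile1; lra.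
  rewrite /y => H; apply: (@le_trans _ _ (2 / 3 * (1 - cos al))); last nra.
  by rewrite ler_piMr// mulr_ge0.
have y00 : 0 <= y by rewrite /y; lra.
rewrite /pdecay ler_pdivlMr//; apply: (@le_trans _ _ (ln (1 + y))); last first.
  by rewrite ler_ln ?posrE; lra.
apply: le_trans (ln1D_ge_frac y00).
rewrite ler_pdivlMr; last lra.
by rewrite /y; nra.
Qed.

Lemma is_derive_parg r al : 0 < r < 1 ->
  is_derive al 1 (fun a : R => parg r a) ((r * cos al - r ^+ 2) / pden r al).
Proof.
move=> r01; have d0 := one_sub_rcos_gt0 al r01; have D0 := pden_gt0 al r01.
rewrite /parg; derive_tac; first exact: lt0r_neq0.
have E : 1 + (r * sin al / (1 - r * cos al)) ^+ 2 = pden r al / (1 - r * cos al) ^+ 2.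
  rewrite /pden expr_div_n [X in _ + X / _]exprMn sin2cos2; field; exact: lt0r_neq0.
rewrite /= E; set c := cos al in d0 D0 E *; set s := sin al.
have ss : s * s = 1 - c * c by rewrite /s /c -!expr2 sin2cos2.
rewrite /pden -/c in D0 *.
have -> : (1 - 2 * r * c + r ^+ 2) / (1 - r * c) ^+ 2 = ((1 - 2 * r * c + r ^+ 2)^-1 * (1 - r * c) ^+ 2)^-1.
  by field; rewrite (lt0r_neq0 d0) lt0r_neq0.
rewrite invrK.
transitivity ((1 - 2 * r * c + r ^+ 2)^-1 * (r * c * (1 - r * c) - r * r * (s * s))).
  by field; rewrite (lt0r_neq0 d0) /= lt0r_neq0.
by rewrite ss; field; exact: lt0r_neq0.
Qed.

(** The derivative of [parg] differs from its value r / (1 - r) at 0 by a multiple of 1 - cos a,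
    hence by O(a^2). *)
Lemma parg_linear r al : 0 < r < 1 ->
  `|parg r al - r / (1 - r) * al| <= r / (1 - r) ^+ 3 * `|al| ^+ 3.
Proof.
move=> r01; have /andP[r0 r1] := r01; have d0 : 0 < 1 - r by lra.
pose K := r / (1 - r) ^+ 3 * al ^+ 2.
have D (a : R) : is_derive a 1 (fun a : R => parg r a - r / (1 - r) * a)
    ((r * cos a - r ^+ 2) / pden r a - r / (1 - r)).
  have dp := is_derive_parg a r01.
  eapply is_derive_eq; first by repeat first [exact: dp|derive_step].
  by rewrite /=; ring.
have B a : `|a| <= `|al| -> `|(r * cos a - r ^+ 2) / pden r a - r / (1 - r)| <= K.
  move=> aal; have D0 := pden_gt0 a r01; have Dge := pden_ge a r01.
  have -> : (r * cos a - r ^+ 2) / pden r a - r / (1 - r) = - (r * (1 + r) * (1 - cos a) / (pden r a * (1 - r))).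
    rewrite /pden in D0 *; field; rewrite (lt0r_neq0 d0) lt0r_neq0//; by apply: le_lt_trans D0; rewrite lexx.
  have c1 : 0 <= 1 - cos a by rewrite subr_ge0 cos_le1.
  have n0 : 0 <= r * (1 + r) * (1 - cos a) by rewrite mulr_ge0// mulr_ge0//; lra.
  rewrite normrN ger0_norm; last by rewrite divr_ge0// mulr_ge0// ltW.
  rewrite ler_pdivrMr ?mulr_gt0// /K.
  have a2 : 1 - cos a <= al ^+ 2 / 2.
    apply: (@le_trans _ _ (a ^+ 2 / 2)); first by have := cos_ge_quad a; lra.
    have : a ^+ 2 <= al ^+ 2.
      by rewrite -(real_normK (num_real a)) -(real_normK (num_real al)) lerXn2r ?nnegrE.
    by lra.
  apply: (@le_trans _ _ (r * al ^+ 2)).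
    apply: (@le_trans _ _ (r * (2 * (1 - cos a)))); first nra.
    by rewrite ler_wpM2l ?(ltW r0)//; lra.
  have -> : r * al ^+ 2 = r / (1 - r) ^+ 3 * al ^+ 2 * ((1 - r) ^+ 2 * (1 - r)) by field; exact: lt0r_neq0.
  have k0 : 0 <= r / (1 - r) ^+ 3 * al ^+ 2.
    by rewrite mulr_ge0 ?sqr_ge0// divr_ge0 ?exprn_ge0// ltW.
  by apply: ler_wpM2l => //; apply: ler_wpM2r => //; exact: ltW.
have p0 : parg r 0 - r / (1 - r) * 0 = 0 by rewrite /parg sin0 !mulr0 mul0r atan0 subrr.
have KE : K * `|al| = r / (1 - r) ^+ 3 * `|al| ^+ 3.
  by rewrite /K -(real_normK (num_real al)); ring.
rewrite -KE.
have [al0|al0] := leP 0 al.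
  have := derive_bound al0 (fun a _ => D a) (K := K); rewrite p0 !subr0 [in X in _ -> X](ger0_norm al0); apply.
  by move=> a /andP[a0 aa]; apply: B; rewrite !ger0_norm.
have := derive_bound (ltW al0) (fun a _ => D a) (K := K); rewrite p0 !sub0r normrN (ltr0_norm al0); apply.
by move=> a /andP[a0 aa]; apply: B; rewrite !ler0_norm ?lerN2// ltW.
Qed.

End SingleFactor.

Lemma poly_exp_bound (R : realType) : exists2 K : R, 0 < K &
  forall x, 0 <= x -> (1 + x) ^+ 4 * expR (- x) <= K * expR (- x / 2).
Proof.
(* (1 + x) e^(-x/8) <= 8 (1 + x/8) e^(-x/8) <= 8, raised to the fourth power. *)
exists (8 ^+ 4) => [|x x0]; first by rewrite exprn_gt0.
have -> : expR (- x) = expR (- x / 2) * expR (- x / 2) by rewrite -expRD; congr expR; field.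
rewrite mulrA ler_wpM2r ?expR_ge0//.
have -> : expR (- x / 2) = expR (- (x / 8)) ^+ 4 by rewrite -expRM_natl; congr expR; field.
rewrite -!exprMn.
apply: lerXn2r; rewrite ?nnegrE ?mulr_ge0 ?expR_ge0//; first lra.
have := expRN_mul_le (x / 8); have := expR_ge0 (- (x / 8)); nra.
Qed.

(** * Sums that control the cubic and quartic Taylor terms *)

Section SumBounds.
Variable R : realType.
Variable t : R.
Variable K : R.
Hypothesis K0 : 0 < K.
Hypothesis HK : forall x, 0 <= x -> (1 + x) ^+ 4 * expR (- x) <= K * expR (- x / 2).
Hypothesis t0 : 0 < t.
Notation u k := (expR (- (k%:R * t))).

Lemma geometric_sum_le N : \sum_(k < N) expR (- (k.+1%:R * t) / 2) <= 2 / t.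
Proof.
set v := expR (- (t / 2)).
have /andP[v0 v1] : 0 < v < 1 by rewrite expR_gt0 expR_lt1 oppr_lt0 divr_gt0.
rewrite (eq_bigr (fun k : 'I_N => v * v ^+ k)) => [|k _]; last first.
  by rewrite -exprS -expRM_natl; congr expR; ring.
rewrite -mulr_sumr.
have : \sum_(k < N) v ^+ k <= (1 - v)^-1.
  rewrite -[leRHS]mul1r ler_pdivlMr ?subr_gt0// mulrC -opprB mulNr -subrX1 opprB.
  by rewrite gerBl exprn_ge0// ltW.
move/(ler_wpM2l (ltW v0))/le_trans; apply.
rewrite ler_pdivrMr; last lra.
rewrite mulrAC ler_pdivlMr//.
have := expRN_mul_le (t / 2); rewrite -/v; lra.
Qed.

Let ubounds k : (0 < k)%N -> let x := k%:R * t in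
  [/\ 0 < x, 0 < u k < 1 & x <= (1 + x) * (1 - u k)].
Proof.
move=> k0 x; have x0 : 0 < x by rewrite mulr_gt0// ltr0n.
split=> //; first exact: expRN_bounds.
by have := expRN_mul_le x; rewrite -/x; lra.
Qed.

(** With x = k t and v = e^-x the term is t^-3 (x / (1 - v))^3 v, and x / (1 - v) <= 1 + x removes
    the pole at 0; about 1 / t values of k matter, whence t^-4. *)
Lemma sum_third_le N :
  \sum_(k < N) k.+1%:R ^+ 3 * (u k.+1 / (1 - u k.+1) ^+ 3) <= 2 * K / t ^+ 4.
Proof.
have t3 : 0 < t ^+ 3 by rewrite exprn_gt0.
apply: (@le_trans _ _ (\sum_(k < N) K / t ^+ 3 * expR (- (k.+1%:R * t) / 2))); last first.
  rewrite -mulr_sumr; have -> : 2 * K / t ^+ 4 = K / t ^+ 3 * (2 / t) by field; exact: lt0r_neq0.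
  by rewrite ler_wpM2l ?divr_ge0 ?(ltW t3) ?(ltW K0)// geometric_sum_le.
apply: ler_sum => k _; have [x0 /andP[u0 u1]] := ubounds (ltn0Sn k).
set x := k.+1%:R * t in x0 *; set v := expR (- x) in u0 u1 * => xv.
have d0 : 0 < 1 - v by lra.
have -> : k.+1%:R = x / t by rewrite /x; field; exact: lt0r_neq0.
have -> : (x / t) ^+ 3 * (v / (1 - v) ^+ 3) = (x / (1 - v)) ^+ 3 * v / t ^+ 3.
  by field; rewrite !lt0r_neq0.
rewrite [leRHS]mulrAC ler_wpM2r ?invr_ge0 ?(ltW t3)//.
apply: le_trans (HK (ltW x0)).
rewrite ler_wpM2r ?(ltW u0)//.
apply: (@le_trans _ _ ((1 + x) ^+ 3)).
  apply: lerXn2r; rewrite ?nnegrE ?divr_ge0 ?(ltW x0) ?(ltW d0)//; first lra.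
  by rewrite ler_pdivrMr.
by rewrite [leRHS]exprS ler_peMl ?exprn_ge0//; lra.
Qed.

Lemma sum_fourth_le N :
  \sum_(k < N) k.+1%:R ^+ 4 * (u k.+1 / (1 - u k.+1) ^+ 2 + (u k.+1 / (1 - u k.+1) ^+ 2) ^+ 2)
   <= 4 * K / t ^+ 5.
Proof.
have t4 : 0 < t ^+ 4 by rewrite exprn_gt0.
apply: (@le_trans _ _ (\sum_(k < N) 2 * K / t ^+ 4 * expR (- (k.+1%:R * t) / 2))); last first.
  rewrite -mulr_sumr; have -> : 4 * K / t ^+ 5 = 2 * K / t ^+ 4 * (2 / t) by field; exact: lt0r_neq0.
  apply: ler_wpM2l; last exact: geometric_sum_le.
  by apply: divr_ge0; [rewrite mulr_ge0 ?(ltW K0)|exact: ltW].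
apply: ler_sum => k _; have [x0 /andP[u0 u1]] := ubounds (ltn0Sn k).
set x := k.+1%:R * t in x0 *; set v := expR (- x) in u0 u1 * => xv.
have d0 : 0 < 1 - v by lra.
have -> : k.+1%:R = x / t by rewrite /x; field; exact: lt0r_neq0.
pose y := x / (1 - v).
have y0 : 0 <= y by rewrite divr_ge0 ?ltW.
have yx : y <= 1 + x by rewrite /y ler_pdivrMr.
have -> : (x / t) ^+ 4 * (v / (1 - v) ^+ 2 + (v / (1 - v) ^+ 2) ^+ 2) =
   (x ^+ 2 * y ^+ 2 * v + y ^+ 4 * (v * v)) / t ^+ 4.
  by rewrite /y; field; rewrite !lt0r_neq0.
rewrite [leRHS]mulrAC ler_wpM2r ?invr_ge0 ?(ltW t4)//.
have := HK (ltW x0); rewrite -/v => P.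
have y4 : y ^+ 4 <= (1 + x) ^+ 4 by apply: lerXn2r; rewrite ?nnegrE//; lra.
have xy : x ^+ 2 * y ^+ 2 <= (1 + x) ^+ 4.
  rewrite -[4%N]/(2 + 2)%N exprD; apply: ler_pM; rewrite ?sqr_ge0//; apply: lerXn2r; rewrite ?nnegrE//; lra.
have b1 : x ^+ 2 * y ^+ 2 * v <= (1 + x) ^+ 4 * v by rewrite ler_wpM2r// ltW.
have b2 : y ^+ 4 * (v * v) <= (1 + x) ^+ 4 * v.
  apply: ler_pM => //; first by rewrite exprn_ge0.
    by rewrite mulr_ge0// ltW.
  by rewrite ler_piMr// ltW.
lra.
Qed.

End SumBounds.

Section Decay.
Variable R : realType.
Variables (t : R) (N : nat).
Hypothesis t0 : 0 < t.
Notation u k := (expR (- (k%:R * t))).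
Let q := expR (- t).

(** Minus the logarithm of |P(q e^(i th))| / P(q), where P is Euler's product over the part sizes up
    to [N]. *)
Definition decay (th : R) : R := \sum_(k < N) pdecay (u k.+1) (k.+1%:R * th).

Let q01 : 0 < q < 1. Proof. exact: expRN_bounds. Qed.

Let uE k : q ^+ k.+1 = u k.+1.
Proof. by rewrite /q -expRM_natl; congr expR; rewrite mulrN. Qed.

Let u01 k : 0 < u k.+1 < 1.
Proof. by apply: expRN_bounds; rewrite mulr_gt0. Qed.

Lemma gmodE th : gmod q N th = gmax q N * expR (- decay th).
Proof.
rewrite /gmod /gmax /decay -sumrN expR_sum -big_split /=; apply: eq_bigr => k _.
by rewrite uE pmod_decay.
Qed.

Lemma gmaxE : gmax q N = expR (logP N t).
Proof.
rewrite /gmax /logP expR_sum; apply: eq_bigr => k _; rewrite uE /h.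
have /andP[_ u1] := u01 k; have d0 : 0 < 1 - u k.+1 by lra.
by rewrite -lnV ?posrE// lnK// posrE invr_gt0.
Qed.

Lemma decay_ge0 th : 0 <= decay th.
Proof. by apply: sumr_ge0 => k _; exact: pdecay_ge0. Qed.

Lemma decay_even th : decay (- th) = decay th.
Proof. by apply: eq_bigr => k _; rewrite mulrN /pdecay cosN. Qed.

Lemma decay_le th : decay th <= kap2 N t * th ^+ 2 / 2.
Proof.
rewrite /decay /kap2 !mulr_suml; apply: ler_sum => k _.
apply: le_trans (pdecay_le _ (u01 k)) _.
by rewrite exprMn le_eqVlt; apply/orP; left; apply/eqP; ring.
Qed.

Variable K : R.
Hypothesis K0 : 0 < K.
Hypothesis HK : forall x, 0 <= x -> (1 + x) ^+ 4 * expR (- x) <= K * expR (- x / 2).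

Lemma decay_ge th : kap2 N t * th ^+ 2 / 2 - 2 * K / t ^+ 5 * th ^+ 4 <= decay th.
Proof.
have S := sum_fourth_le K0 HK t0 N.
have th4 : 0 <= th ^+ 4 / 2 by rewrite divr_ge0// -[4%N]/(2 * 2)%N exprM sqr_ge0.
have := ler_wpM2r th4 S.
have -> : 4 * K / t ^+ 5 * (th ^+ 4 / 2) = 2 * K / t ^+ 5 * th ^+ 4.
  by field; exact: lt0r_neq0.
move=> {}S; apply: (@le_trans _ _ (kap2 N t * th ^+ 2 / 2 -
  (\sum_(k < N) k.+1%:R ^+ 4 * (u k.+1 / (1 - u k.+1) ^+ 2 + (u k.+1 / (1 - u k.+1) ^+ 2) ^+ 2)) * (th ^+ 4 / 2))).
  by rewrite lerD2l lerN2.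
rewrite /decay /kap2 !mulr_suml -sumrB; apply: ler_sum => k _.
apply: le_trans (pdecay_ge _ (u01 k)).
rewrite le_eqVlt; apply/orP; left; apply/eqP; rewrite !exprMn; set v := expR _.
by have := u01 k; rewrite -/v => /andP[v0 v1]; field; rewrite lt0r_neq0//; lra.
Qed.

Lemma garg_linear th : `|garg q N th - kap1 N t * th| <= 2 * K / t ^+ 4 * `|th| ^+ 3.
Proof.
have S := sum_third_le K0 HK t0 N.
apply: le_trans (ler_wpM2r (exprn_ge0 3 (normr_ge0 th)) S).
rewrite /garg /kap1 !mulr_suml -sumrB.
apply: le_trans (ler_norm_sum _ _ _) _; apply: ler_sum => k _.
rewrite uE; have := parg_linear (k.+1%:R * th) (u01 k).
rewrite normrM [`|k.+1%:R|]ger0_norm// exprMn.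
have -> : k.+1%:R * u k.+1 / (1 - u k.+1) * th = u k.+1 / (1 - u k.+1) * (k.+1%:R * th) by ring.
by move/le_trans; apply; rewrite le_eqVlt; apply/orP; left; apply/eqP; ring.
Qed.

(** Only part sizes with k t <= 1 are kept; for them e^(-k t) >= e^-1 >= 1/3. *)
Lemma decay_ge_cos M th : (M <= N)%N -> M%:R * t <= 1 ->
  (\sum_(k < M) (1 - cos (k.+1%:R * th))) / 7 <= decay th.
Proof.
move=> MN Mt; rewrite /decay -(subnKC MN) big_split_ord /=.
apply: (@le_trans _ _ (\sum_(k < M) pdecay (u k.+1) (k.+1%:R * th))); last first.
  by rewrite lerDl; apply: sumr_ge0 => k _; exact: pdecay_ge0 (u01 _).
rewrite mulr_suml; apply: ler_sum => k _; apply: pdecay_ge_cos.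
have /andP[_ ->] := u01 k; rewrite andbT.
apply: (@le_trans _ _ (expR (- 1))).
  by have := @expRN_pade R 1 ler01; lra.
rewrite ler_expR lerN2; apply: le_trans Mt; rewrite ler_wpM2r ?(ltW t0)//.
by rewrite ler_nat.
Qed.

Lemma sum_sq_ge (M : nat) : M%:R ^+ 3 / 3 <= \sum_(k < M) (k.+1%:R : R) ^+ 2.
Proof.
elim: M => [|M IH]; first by rewrite big_ord0 expr0n mul0r.
rewrite big_ord_recr /=; apply: le_trans (lerD IH (lexx _)).
by rewrite -natr1; have : 0 <= M%:R :> R by []; nra.
Qed.

(** With M about 1 / (4 t), the angles k th stay in [-2, 2], where 1 - cos a >= a^2 / 3; the sum of
    the k^2 then gives M^3 / 3 with M >= 1 / (8 t). *)
Lemma decay_ge_near th : t <= 1 / 8 -> 1 <= N%:R * t -> `|th| <= 8 * t ->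
  th ^+ 2 / t ^+ 3 / 8 ^+ 5 <= decay th.
Proof.
move=> t8 Nt tht; have t0' := t0.
pose M := Num.truncn (4 * t)^-1.
have i0 : 0 <= (4 * t)^-1 by rewrite invr_ge0 mulr_ge0// ltW.
have M1 : M%:R <= (4 * t)^-1 by rewrite /M truncn_le.
have M2 : (4 * t)^-1 < M.+1%:R by rewrite /M truncnS_gt.
clearbody M.
have it : (4 * t)^-1 * t = 1 / 4 by field; exact: lt0r_neq0.
have Mt : M%:R * t <= 1 / 4 by rewrite -it ler_wpM2r// ltW.
have MN : (M <= N)%N.
  rewrite -(ler_nat R) -(ler_pM2r t0); lra.
have M8 : (8 * t)^-1 <= M%:R.
  rewrite -[M.+1%:R]natr1 in M2.
  have -> : (8 * t)^-1 = (4 * t)^-1 - (8 * t)^-1 by field; exact: lt0r_neq0.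
  have : 1 <= (8 * t)^-1 by rewrite -div1r ler_pdivlMr ?mul1r ?mulr_gt0//; lra.
  lra.
apply: le_trans (decay_ge_cos _ MN _); last lra.
have S : th ^+ 2 / 3 * (M%:R ^+ 3 / 3) <= \sum_(k < M) (1 - cos (k.+1%:R * th)).
  apply: (@le_trans _ _ (th ^+ 2 / 3 * \sum_(k < M) k.+1%:R ^+ 2)).
    by rewrite ler_wpM2l ?sum_sq_ge// divr_ge0 ?sqr_ge0.
  rewrite mulr_sumr; apply: ler_sum => k _.
  set a := k.+1%:R * th.
  have -> : th ^+ 2 / 3 * k.+1%:R ^+ 2 = a ^+ 2 / 3 by rewrite /a exprMn; ring.
  have a2 : `|a| <= 2.
    rewrite /a normrM ger0_norm//; apply: (@le_trans _ _ (M%:R * (8 * t))); last lra.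
    by apply: ler_pM => //; rewrite ler_nat.
  have a4 : a ^+ 2 <= 4.
    rewrite -(real_normK (num_real a)); have := normr_ge0 a; nra.
  have := cos_le_quart a; rewrite -[a ^+ 4]/(a ^+ (2 * 2)) exprM.
  have := sqr_ge0 a; nra.
apply: (@le_trans _ _ (th ^+ 2 / 3 * (M%:R ^+ 3 / 3) / 7)); last by rewrite ler_wpM2r.
have M3 : (8 * t)^-1 ^+ 3 <= M%:R ^+ 3.
  by apply: lerXn2r; rewrite ?nnegrE ?invr_ge0 ?mulr_ge0 ?(ltW t0).
apply: (@le_trans _ _ (th ^+ 2 / 3 * ((8 * t)^-1 ^+ 3 / 3) / 7)); last first.
  rewrite ler_wpM2r// ler_wpM2l ?divr_ge0 ?sqr_ge0//; lra.
pose w := th ^+ 2 * t^-1 ^+ 3 * 8^-1 ^+ 3.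
have ti0 : 0 <= t^-1 by rewrite invr_ge0 ltW.
have w0 : 0 <= w.
  apply: mulr_ge0; first by apply: mulr_ge0; [exact: sqr_ge0|exact: exprn_ge0].
  by apply: exprn_ge0; rewrite invr_ge0.
have -> : th ^+ 2 / t ^+ 3 / 8 ^+ 5 = w / 64.
  by rewrite /w -!exprVn; move: t^-1 => ti; field.
have -> : th ^+ 2 / 3 * ((8 * t)^-1 ^+ 3 / 3) / 7 = w / 63.
  by rewrite /w invfM; move: t^-1 => ti; field.
lra.
Qed.

(** The Dirichlet kernel: multiplied by 2 sin (th / 2) >= th / 3, the sum telescopes to a difference
    of two sines. *)
Lemma dirichlet_bound M (th : R) : 0 < th <= pi ->
  `|\sum_(k < M) cos (k.+1%:R * th)| <= 6 / th.
Proof.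
move=> /andP[th0 thpi]; have p2 := pihalf_lt2 R.
have s0 : th / 6 <= sin (th / 2).
  have y0 : 0 <= th / 2 by lra.
  have := sin_ge_cubic y0; have y2 : th / 2 < 2 by lra.
  by nra.
have sp : 0 < sin (th / 2) by lra.
have E : sin (th / 2) * 2 * \sum_(k < M) cos (k.+1%:R * th) = sin ((M%:R + 2^-1) * th) - sin (th / 2).
  elim: M => [|M IH].
    by rewrite big_ord0 mulr0 add0r mulrC subrr.
  rewrite big_ord_recr /= mulrDr IH.
  have -> : (M.+1%:R + 2^-1) * th = M.+1%:R * th + th / 2 by ring.
  have -> : (M%:R + 2^-1) * th = M.+1%:R * th - th / 2 by rewrite -natr1; field.
  by rewrite sinB sinD; ring.
have B : `|sin (th / 2) * 2 * \sum_(k < M) cos (k.+1%:R * th)| <= 2.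
  rewrite E; apply: le_trans (ler_normB _ _) _.
  by have := sin_max ((M%:R + 2^-1) * th); have := sin_max (th / 2); lra.
rewrite normrM gtr0_norm in B; last by rewrite mulr_gt0.
rewrite ler_pdivlMr// mulrC.
have := normr_ge0 (\sum_(k < M) cos (k.+1%:R * th)); nra.
Qed.

(** With M about 1 / t, the constant part M >= 7 / (8 t) beats the oscillating part, at most 6 / (8
    t); a seventh of the surplus 1 / (8 t) is the bound. *)
Lemma decay_ge_far th : t <= 1 / 8 -> 1 <= N%:R * t -> 8 * t <= `|th| <= pi ->
  (56 * t)^-1 <= decay th.
Proof.
move=> t8 Nt; have t0' := t0.
wlog th0 : th / 0 <= th => [H|].
  have [/H//|th0] := leP 0 th; move=> h; rewrite -decay_even; apply: H; first lra.
  by rewrite normrN.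
rewrite ger0_norm// => /andP[th8 thpi].
have thp : 0 < th by lra.
pose M := Num.truncn t^-1.
have i0 : 0 <= t^-1 by rewrite invr_ge0 ltW.
have M1 : M%:R <= t^-1 by rewrite /M truncn_le.
have M2 : t^-1 < M.+1%:R by rewrite /M truncnS_gt.
clearbody M.
have it : t^-1 * t = 1 by field; exact: lt0r_neq0.
have Mt : M%:R * t <= 1 by rewrite -[leRHS]it; apply: ler_wpM2r => //; exact: ltW.
have MN : (M <= N)%N by rewrite -(ler_nat R) -(ler_pM2r t0); lra.
apply: le_trans (decay_ge_cos _ MN _) => //.
rewrite sumrB sumr_const card_ord.
have D : \sum_(k < M) cos (k.+1%:R * th) <= 6 / (8 * t).
  apply: le_trans (ler_norm _) _; apply: (@le_trans _ _ (6 / th)).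
    by apply: dirichlet_bound; lra.
  by rewrite ler_wpM2l// lef_pV2 ?posrE//; lra.
have -> : (56 * t)^-1 = t^-1 / 8 / 7 by field; exact: lt0r_neq0.
rewrite ler_wpM2r//.
have e : 6 / (8 * t) = 3 / 4 * t^-1 by field; exact: lt0r_neq0.
rewrite e in D; rewrite -[M.+1%:R]natr1 in M2.
have : 8 <= t^-1 by rewrite -[8]invrK lef_pV2 ?posrE//; lra.
by move: (\sum_(_ < _) _) D => S; lra.
Qed.

End Decay.

(** * Comparison of the integrand with a Gaussian *)

Section Pointwise.
Variable R : realType.
Notation z2 := (@zeta2 R).

Lemma cube_le_exp (y : R) : 0 <= y -> y ^+ 3 <= 6 * expR y.
Proof.
by move=> y0; have := @expR_ge1Dxn R y 2 y0; rewrite (_ : (3`!)%:R = 6)//; lra.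
Qed.

Lemma zeta2_ge : 2 / 3 <= z2.
Proof.
have := pi_ge2 R; rewrite /zeta2; move: (@pi R) => p p2.
have p4 : 4 <= p ^+ 2 by nra.
lra.
Qed.

Lemma poly3_exp (c s : R) : 0 < c -> 0 <= s ->
  (1 + s ^+ 3) * expR (- (2 * c * s)) <= (1 + 6 / c ^+ 3) * expR (- (c * s)).
Proof.
move=> c0 s0; have cs : 0 <= c * s by rewrite mulr_ge0// ltW.
have -> : expR (- (2 * c * s)) = expR (- (c * s)) * expR (- (c * s)).
  by rewrite -expRD; congr expR; ring.
rewrite mulrA ler_wpM2r ?expR_ge0//.
have e1 : 1 <= expR (c * s) by have := expR_ge1Dx (c * s); lra.
have e3 : s ^+ 3 <= 6 / c ^+ 3 * expR (c * s).
  have := cube_le_exp cs; rewrite exprMn => H.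
  by rewrite [leRHS]mulrAC ler_pdivlMr ?exprn_gt0// mulrC.
have : (1 + s ^+ 3) <= (1 + 6 / c ^+ 3) * expR (c * s) by rewrite mulrDl mul1r lerD.
move/(ler_wpM2r (expR_ge0 (- (c * s)))); move/le_trans; apply.
by rewrite -mulrA expRxMexpNx_1 mulr1.
Qed.

(** The natural variable is s = th^2 / t^3. For |th| < 8 t the errors are t times a polynomial in s,
    absorbed by part of the decay; for |th| >= 8 t both functions are small on their own, the term C
    t^3 covering the integrand. The clause beyond pi serves to extend the Gaussian to the whole
    line. *)
Lemma gaussian_comparison : exists C c : R, [/\ 0 < C, 0 < c & forall (t : R) (N n : nat),
  0 < t <= 1 / 16 -> 1 <= N%:R * t -> `|kap1 N t - n%:R| <= 3 / t ->
  `|kap2 N t - 2 * z2 / t ^+ 3| <= 5 / t ^+ 2 -> forall th : R,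
  (`|th| <= pi -> `|expR (- decay t N th) * cos (garg (expR (- t)) N th - n%:R * th)
       - expR (- (kap2 N t / 2 * th ^+ 2))| <= C * t * expR (- (c / t ^+ 3 * th ^+ 2)) + C * t ^+ 3)
  /\ (pi <= `|th| -> expR (- (kap2 N t / 2 * th ^+ 2)) <= C * t * expR (- (c / t ^+ 3 * th ^+ 2)))].
Proof.
have [K K0 HK] := poly_exp_bound R.
(* [decay_ge_near] gives the rate 8^-5 = 2 c in s: one half is kept for the final bound, the other
   absorbs the polynomial. *)
pose c : R := 8^-1 ^+ 5 / 2.
have c0 : 0 < c by rewrite divr_gt0// exprn_gt0// invr_gt0.
have c4 : c <= 1 / 4.
  have : 8^-1 ^+ 5 <= 8^-1 :> R by rewrite exprS ler_piMr ?invr_ge0// exprn_ile1 ?invr_ge0// invf_le1// ler1n.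
  by rewrite /c; lra.
pose P := 9 + 2 * K + 4 * K ^+ 2.
have P0 : 0 < P by rewrite /P; nra.
pose C1 := P * (1 + 6 / c ^+ 3); pose C2 : R := 6 * 56 ^+ 3.
have c30 : 0 <= 6 / c ^+ 3 by rewrite divr_ge0// exprn_ge0// ltW.
have C10 : 0 <= C1 by rewrite /C1 mulr_ge0 ?(ltW P0)// addr_ge0.
have C20 : 0 <= C2 by rewrite /C2 mulr_ge0// exprn_ge0.
exists (1 + C1 + C2), c; split=> //; first by clearbody C1 C2; lra.
move=> t N n /andP[t0 t1] Nt k1 k2 th.
have t3 : 0 < t ^+ 3 by rewrite exprn_gt0.
set s := th ^+ 2 / t ^+ 3.
have s0 : 0 <= s by rewrite divr_ge0 ?sqr_ge0 ?ltW.
have -> : c / t ^+ 3 * th ^+ 2 = c * s by rewrite /s; ring.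
have Ecs := expR_ge0 (- (c * s)).
have k2ge : (t ^+ 3)^-1 <= kap2 N t.
  move: k2; rewrite ler_norml => /andP[k2 _].
  have : (2 * z2 - 5 * t) / t ^+ 3 <= kap2 N t.
    have -> : (2 * z2 - 5 * t) / t ^+ 3 = 2 * z2 / t ^+ 3 - 5 / t ^+ 2 by field; exact: lt0r_neq0.
    lra.
  apply: le_trans; rewrite -[leLHS]mul1r ler_wpM2r ?invr_ge0 ?(ltW t3)//.
  by have := zeta2_ge; lra.
have gauss : 8 * t <= `|th| -> expR (- (kap2 N t / 2 * th ^+ 2)) <= t * expR (- (c * s)).
  move=> th8.
  have s8 : 64 / t <= s.
    have -> : 64 / t = (8 * t) ^+ 2 / t ^+ 3 by field; exact: lt0r_neq0.
    rewrite ler_wpM2r ?invr_ge0 ?(ltW t3)// -(real_normK (num_real th)).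
    by apply: lerXn2r; rewrite ?nnegrE ?normr_ge0//; lra.
  apply: (@le_trans _ _ (expR (- (s / 4)) * expR (- (s / 4)))).
    rewrite -expRD ler_expR -opprD lerN2.
    have -> : s / 4 + s / 4 = (t ^+ 3)^-1 / 2 * th ^+ 2 by rewrite /s; field; exact: lt0r_neq0.
    by rewrite ler_wpM2r ?sqr_ge0//; lra.
  apply: ler_pM; rewrite ?expR_ge0//.
    apply: (@le_trans _ _ (expR (- t^-1))).
      rewrite ler_expR lerN2; have : 0 < t^-1 by rewrite invr_gt0.
      by lra.
    rewrite expRN -[leRHS]invrK lef_pV2 ?posrE ?expR_gt0 ?invr_gt0//.
    by have := expR_ge1Dx t^-1; lra.
  by rewrite ler_expR lerN2 mulrC ler_wpM2l//; lra.
have CC : t * expR (- (c * s)) <= (1 + C1 + C2) * t * expR (- (c * s)).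
  rewrite -mulrA ler_peMl//; first by rewrite mulr_ge0// ltW.
  by clearbody C1 C2; lra.
split; last first.
  move=> thpi; apply: le_trans (gauss _) CC; apply: le_trans thpi.
  by have := pi_ge2 R; lra.
move=> thpi.
have D0 := decay_ge0 N t0 th.
set Y := kap2 N t / 2 * th ^+ 2 in gauss *.
have [far|near] := leP (8 * t) `|th|.
  have dfar : (56 * t)^-1 <= decay t N th by apply: decay_ge_far => //; [lra|apply/andP].
  apply: le_trans (ler_normB _ _) _; rewrite addrC.
  have b1 : `|expR (- Y)| <= (1 + C1 + C2) * t * expR (- (c * s)).
    by rewrite ger0_norm ?expR_ge0//; apply: le_trans (gauss far) CC.
  apply: lerD => //; rewrite normrM ger0_norm ?expR_ge0//.
  apply: (@le_trans _ _ (C2 * t ^+ 3)); last first.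
    by rewrite ler_wpM2r ?(ltW t3)//; clearbody C1 C2; lra.
  apply: (@le_trans _ _ (expR (- decay t N th))); first by rewrite ler_piMr ?expR_ge0 ?cos_max.
  apply: (@le_trans _ _ (expR (- (56 * t)^-1))); first by rewrite ler_expR lerN2.
  have i0 : 0 < (56 * t)^-1 by rewrite invr_gt0 mulr_gt0.
  have := cube_le_exp (ltW i0) => H.
  rewrite expRN -[leLHS]mul1r ler_pdivrMr ?expR_gt0//.
  have i3 : 0 < 56 ^+ 3 * t ^+ 3 by rewrite mulr_gt0// exprn_gt0.
  have := ler_wpM2l (ltW i3) H.
  have -> : 56 ^+ 3 * t ^+ 3 * (56 * t)^-1 ^+ 3 = 1.
    by rewrite -exprMn -exprMn mulfV ?expr1n// mulf_neq0 ?lt0r_neq0.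
  move/le_trans; apply; rewrite /C2 le_eqVlt; apply/orP; left; apply/eqP.
  by move: (56 ^+ 3) => z; ring.
have dn : 2 * c * s <= decay t N th.
  have := decay_ge_near t0 (_ : t <= 1 / 8) Nt (ltW near) => /(_ _) H.
  apply: le_trans (H _); last lra.
  by rewrite -/s /c exprVn; move: (8 ^+ 5)^-1 => z; lra.
have dY : decay t N th <= Y.
  apply: le_trans (decay_le N t0 th) _.
  by rewrite /Y le_eqVlt; apply/orP; left; apply/eqP; ring.
have dY2 : Y - decay t N th <= t * (2 * K * s ^+ 2).
  have := decay_ge N t0 K0 HK th.
  have -> : kap2 N t * th ^+ 2 / 2 = Y by rewrite /Y; ring.
  have -> : 2 * K / t ^+ 5 * th ^+ 4 = t * (2 * K * s ^+ 2) by rewrite /s; field; exact: lt0r_neq0.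
  lra.
set X := expR (- decay t N th).
have X0 : 0 <= X := expR_ge0 _.
have Xs : X <= expR (- (2 * c * s)) by rewrite ler_expR lerN2.
have XY : `|X - expR (- Y)| <= X * (t * (2 * K * s ^+ 2)).
  have YX : expR (- Y) <= X by rewrite ler_expR lerN2.
  rewrite ger0_norm ?subr_ge0//.
  have -> : expR (- Y) = X * expR (- (Y - decay t N th)) by rewrite -expRD; congr expR; ring.
  rewrite -[X in X - _]mulr1 -mulrBr ler_wpM2l//.
  by have := expRN_ge (Y - decay t N th); lra.
set dl := garg _ N th - n%:R * th.
(* [A] bounds the mismatch of [kap1] and [n], [B] the cubic remainder of the phase. Both are of
   order t^(1/2) at bounded s, and 1 - cos dl <= dl^2 / 2 turns this into O(t). *)
have dl2 : dl ^+ 2 / 2 <= t * (9 * s + 4 * K ^+ 2 * s ^+ 3).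
  have : `|dl| <= 3 / t * `|th| + 2 * K / t ^+ 4 * `|th| ^+ 3.
    have -> : dl = (kap1 N t - n%:R) * th + (garg (expR (- t)) N th - kap1 N t * th) by rewrite /dl; ring.
    apply: le_trans (ler_normD _ _) _; apply: lerD; last exact: garg_linear.
    by rewrite normrM ler_wpM2r.
  set A := 3 / t * _; set B := 2 * K / t ^+ 4 * _ => H.
  have A0 : 0 <= A by rewrite /A mulr_ge0// divr_ge0// ltW.
  have B0 : 0 <= B by rewrite /B mulr_ge0 ?exprn_ge0// divr_ge0 ?exprn_ge0 ?mulr_ge0 ?ltW.
  have : dl ^+ 2 <= (A + B) ^+ 2.
    by rewrite -(real_normK (num_real dl)); apply: lerXn2r; rewrite ?nnegrE ?normr_ge0// addr_ge0.
  have A2 : A ^+ 2 = t * (9 * s).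
    by rewrite /A /s -(real_normK (num_real th)); field; exact: lt0r_neq0.
  have B2 : B ^+ 2 = t * (4 * K ^+ 2 * s ^+ 3).
    by rewrite /B /s -(real_normK (num_real th)); field; exact: lt0r_neq0.
  have := sqr_ge0 (A - B); rewrite mulrDr -A2 -B2; nra.
have cosb : `|cos dl - 1| <= t * (9 * s + 4 * K ^+ 2 * s ^+ 3).
  rewrite distrC ger0_norm; first by have := cos_ge_quad dl; lra.
  by rewrite subr_ge0 cos_le1.
apply: (@le_trans _ _ (X * (t * (9 * s + 4 * K ^+ 2 * s ^+ 3)) + X * (t * (2 * K * s ^+ 2)))).
  have -> : X * cos dl - expR (- Y) = X * (cos dl - 1) + (X - expR (- Y)) by ring.
  apply: le_trans (ler_normD _ _) _; apply: lerD => //.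
  by rewrite normrM ger0_norm// ler_wpM2l.
apply: (@le_trans _ _ (C1 * t * expR (- (c * s)))); last first.
  apply: (@le_trans _ _ ((1 + C1 + C2) * t * expR (- (c * s)))).
    apply: ler_wpM2r => //; apply: ler_wpM2r; first exact: ltW.
    by clearbody C1 C2; lra.
  by rewrite lerDl mulr_ge0 ?(ltW t3)//; clearbody C1 C2; lra.
have s3 : 0 <= s ^+ 3 by rewrite exprn_ge0.
have sb1 : s <= 1 + s ^+ 3.
  have [s1|/ltW s1] := leP s 1; first lra.
  have : s <= s ^+ 3 by rewrite ler_eXnr.
  lra.
have sb2 : s ^+ 2 <= 1 + s ^+ 3.
  have [s1|/ltW s1] := leP s 1.
    have : s ^+ 2 <= 1 by rewrite exprn_ile1.
    lra.
  have : s ^+ 2 <= s ^+ 3 by rewrite ler_weXn2l.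
  lra.
have pol : 9 * s + 4 * K ^+ 2 * s ^+ 3 + 2 * K * s ^+ 2 <= P * (1 + s ^+ 3).
  have K2 : 0 <= K ^+ 2 := sqr_ge0 K.
  have := ler_wpM2l (ltW K0) sb2.
  rewrite /P; move: (K ^+ 2) K2 (s ^+ 3) (s ^+ 2) s3 sb1 sb2 => k K2 a b s3' sb1' sb2' h; nra.
rewrite -mulrDr -mulrDr mulrCA.
apply: (@le_trans _ _ (t * (expR (- (2 * c * s)) * (P * (1 + s ^+ 3))))).
  rewrite ler_wpM2l ?(ltW t0)//; apply: ler_pM => //.
  have q1 : 0 <= 4 * K ^+ 2 * s ^+ 3 by rewrite mulr_ge0// mulr_ge0// sqr_ge0.
  have q2 : 0 <= 2 * K * s ^+ 2 by rewrite mulr_ge0 ?sqr_ge0// mulr_ge0// ltW.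
  lra.
have := poly3_exp c0 s0 => H.
have -> : t * (expR (- (2 * c * s)) * (P * (1 + s ^+ 3))) = t * P * ((1 + s ^+ 3) * expR (- (2 * c * s))) by ring.
have -> : C1 * t * expR (- (c * s)) = t * P * ((1 + 6 / c ^+ 3) * expR (- (c * s))) by rewrite /C1; ring.
by rewrite ler_wpM2l// mulr_ge0 ?ltW.
Qed.

End Pointwise.

(** * Integrating the Gaussian comparison *)

Section LocalLimit.
Variable R : realType.
Notation mu := (@lebesgue_measure R).
Notation z2 := (@zeta2 R).

Lemma gaussian_integral (A : R) : 0 < A ->
  mu.-integrable setT (EFin \o (fun x : R => expR (- (A * x ^+ 2)))) /\
  \int[mu]_x expR (- (A * x ^+ 2)) = Num.sqrt (pi / A).
Proof.
move=> A0; have pi0 := pi_gt0 R.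
pose s := Num.sqrt (2 * A)^-1.
have s2 : s ^+ 2 = (2 * A)^-1 by rewrite sqr_sqrtr// invr_ge0 mulr_ge0// ltW.
have s0 : s != 0 by rewrite gt_eqF// sqrtr_gt0 invr_gt0 mulr_gt0.
have pk : normal_peak s = (Num.sqrt (pi / A))^-1.
  rewrite /normal_peak s2; congr (Num.sqrt _)^-1.
  by move: (@pi R) => p; field; exact: lt0r_neq0.
have sp0 : Num.sqrt (pi / A) != 0 by rewrite gt_eqF// sqrtr_gt0 divr_gt0.
have E : (fun x : R => expR (- (A * x ^+ 2))) = (fun x => Num.sqrt (pi / A) * normal_pdf 0 s x).
  apply/funext => x; rewrite normal_pdfE// pk [RHS]mulVKf// /normal_fun s2 subr0.
  by congr expR; field; exact: lt0r_neq0.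
have ip := integrable_normal_pdf (0 : R) s.
split.
  rewrite E; have := integrableZl measurableT (Num.sqrt (pi / A)) ip.
  by apply: eq_integrable => // x _; rewrite /= EFinM.
rewrite E RintegralZl//.
by rewrite /Rintegral integral_normal_pdf mulr1.
Qed.

(** The pointwise bound C t e^(-c s) integrates to order t^(5/2), and the additive t^3 is smaller
    still. The Gaussian integral itself has order t^(3/2), so the error is a relative O(t). *)
Lemma local_limit : exists2 C : R, 0 < C & forall (t : R) (N n : nat),
  0 < t <= 1 / 16 -> 1 <= N%:R * t -> (n <= N)%N -> `|kap1 N t - n%:R| <= 3 / t ->
  `|kap2 N t - 2 * z2 / t ^+ 3| <= 5 / t ^+ 2 ->
  `|2 * pi * (expR (- t) ^+ n * (npart n)%:R) / expR (logP N t) - Num.sqrt (2 * pi / kap2 N t)|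
   <= C * (t ^+ 2 * Num.sqrt t).
Proof.
have [C [c [C0 c0 H]]] := gaussian_comparison R.
have pi0 := pi_gt0 R.
exists (C * Num.sqrt (pi / c) + 2 * pi * C).
  by rewrite addr_gt0// mulr_gt0// ?sqrtr_gt0 ?divr_gt0// mulr_gt0.
move=> t N n t01 Nt nN k1 k2; have {}H := H t N n t01 Nt k1 k2.
have /andP[t0 t1] := t01.
have t3 : 0 < t ^+ 3 by rewrite exprn_gt0.
have k2p : 0 < kap2 N t.
  move: k2; rewrite ler_norml => /andP[k2 _].
  have : 0 < (2 * z2 - 5 * t) / t ^+ 3.
    by rewrite divr_gt0//; have := zeta2_ge R; lra.
  have -> : (2 * z2 - 5 * t) / t ^+ 3 = 2 * z2 / t ^+ 3 - 5 / t ^+ 2 by field; exact: lt0r_neq0.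
  lra.
pose q := expR (- t).
have q01 : 0 < q < 1 by exact: expRN_bounds.
pose I : set R := `[(- pi), pi]%classic.
have mI : measurable I by exact: measurable_itv.
pose G th := expR (- decay t N th) * cos (garg q N th - n%:R * th).
have GE th : gmod q N th * cos (garg q N th - n%:R * th) = gmax q N * G th.
  by rewrite gmodE// /G mulrA.
have gm0 := gmax_gt0 q01 N.
have cG : continuous G.
  have -> : G = fun th => (gmax q N)^-1 * (gmod q N th * cos (garg q N th - n%:R * th)).
    by apply/funext => th; rewrite GE mulrA mulVf ?mul1r// lt0r_neq0.
  move=> x; apply: cvgM; first exact: cvg_cst.
  exact: continuous_fourier_integrand.
have iG : mu.-integrable I (EFin \o G) := continuous_integrable_itv (- pi) pi cG.
have main : 2 * pi * (q ^+ n * (npart n)%:R) / expR (logP N t) = \int[mu]_(th in I) G th.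
  rewrite -(npart_fourier q01 nN) -(gmaxE _ t0) -/q.
  under eq_Rintegral do rewrite GE.
  by rewrite RintegralZl// mulrC mulrA mulVf ?mul1r// lt0r_neq0.
have kA : 0 < kap2 N t / 2 by rewrite divr_gt0.
have cA : 0 < c / t ^+ 3 by rewrite divr_gt0.
have [ig Eg] := gaussian_integral kA; have [ie Ee] := gaussian_integral cA.
set g := fun x : R => expR (- (kap2 N t / 2 * x ^+ 2)) in ig Eg.
set e := fun x : R => expR (- (c / t ^+ 3 * x ^+ 2)) in ie Ee.
have iS (D : set R) (f : R -> R) : measurable D -> mu.-integrable setT (EFin \o f) -> mu.-integrable D (EFin \o f).
  by move=> mD; apply: integrableS.
have mIc : measurable (~` I) by exact: measurableC.
have split_I (f : R -> R) : mu.-integrable setT (EFin \o f) ->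
    \int[mu]_x f x = \int[mu]_(x in I) f x + \int[mu]_(x in ~` I) f x.
  move=> iF; rewrite -Rintegral_setU ?setUv//.
  by apply/disj_setPS; rewrite setICr.
have inI (x : R) : I x -> `|x| <= pi by rewrite /I /= in_itv /= ler_norml.
have outI (x : R) : (~` I) x -> pi <= `|x|.
  move=> nI; rewrite leNgt; apply/negP => xp; apply: nI.
  by rewrite /I /= in_itv /= -ler_norml ltW.
have cst_I (r : R) : mu.-integrable I (EFin \o (fun=> r)).
  by apply: (continuous_integrable_itv (- pi) pi) => x; exact: cvg_cst.
have iCte (D : set R) : measurable D -> mu.-integrable D (EFin \o (fun x => C * t * e x)).
  move=> mD; have : mu.-integrable D (fun x => (C * t)%:E * (e x)%:E)%E.
    by apply: integrableZl => //; exact: iS.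
  by apply: eq_integrable => // x _; rewrite /= EFinM.
have b1 : `|\int[mu]_(th in I) G th - \int[mu]_(th in I) g th| <=
    C * t * (\int[mu]_(x in I) e x) + C * t ^+ 3 * (2 * pi).
  rewrite -RintegralB//; last exact: iS.
  have iD : mu.-integrable I (EFin \o (fun x => G x - g x)).
    by apply: (continuous_integrable_itv (- pi) pi) => x; apply: cvgB;
      [exact: cG|apply: (@is_derive_cts R); rewrite /g; repeat derive_step].
  apply: le_trans (le_normr_Rintegral _ iD) _ => //.
  apply: (@le_trans _ _ (\int[mu]_(x in I) (C * t * e x + C * t ^+ 3))).
    apply: le_Rintegral => //.
    - by have := integrable_norm iD; apply: eq_integrable.
    - have : mu.-integrable I (fun x => (C * t * e x)%:E + (C * t ^+ 3)%:E)%E.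
        by apply: integrableD => //; [exact: iCte|exact: cst_I].
      by apply: eq_integrable.
    - by move=> x Ix; have [h _] := H x; exact: h (inI x Ix).
  rewrite RintegralD//; last exact: iCte.
  rewrite RintegralZl//; last exact: iS.
  rewrite Rintegral_cst// lerD2l.
  have mpi : mu I = (2 * pi)%:E.
    rewrite /I lebesgue_measure_itv /= lte_fin (_ : - pi < pi :> R); last lra.
    by rewrite -EFinB opprK mulrDl mul1r.
  by rewrite [X in fine X]mpi.
have b2 : `|\int[mu]_(th in ~` I) g th| <= C * t * (\int[mu]_(x in ~` I) e x).
  rewrite ger0_norm; last by apply: Rintegral_ge0 => x _; exact: expR_ge0.
  rewrite -RintegralZl//; last exact: iS.
  apply: le_Rintegral => //; [exact: iS|exact: iCte|].
  by move=> x Ix; have [_ h] := H x; exact: h (outI x Ix).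
rewrite main.
have -> : Num.sqrt (2 * pi / kap2 N t) = \int[mu]_x g x.
  rewrite Eg; congr Num.sqrt; move: (@pi R) => p; field; exact: lt0r_neq0.
rewrite (split_I _ ig) opprD addrA.
apply: le_trans (ler_normB _ _) _; apply: le_trans (lerD b1 b2) _.
have -> : C * t * \int[mu]_(x in I) e x + C * t ^+ 3 * (2 * pi) + C * t * \int[mu]_(x in ~` I) e x =
   C * t * Num.sqrt (pi / (c / t ^+ 3)) + C * t ^+ 3 * (2 * pi).
  by rewrite -Ee (split_I _ ie); ring.
have -> : Num.sqrt (pi / (c / t ^+ 3)) = Num.sqrt (pi / c) * (t * Num.sqrt t).
  have -> : pi / (c / t ^+ 3) = pi / c * (t ^+ 2 * t) by move: (@pi R) => p; field; rewrite !lt0r_neq0.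
  rewrite sqrtrM ?divr_ge0 ?(ltW pi0) ?(ltW c0)//.
  by rewrite [Num.sqrt (t ^+ 2 * t)]sqrtrM ?sqr_ge0// sqrtr_sqr ger0_norm// ltW.
rewrite [leRHS]mulrDl; apply: lerD.
  by rewrite le_eqVlt; apply/orP; left; apply/eqP; ring.
have ts : t <= Num.sqrt t.
  have h : t ^+ 2 <= t by rewrite expr2 ler_piMl ?(ltW t0)//; lra.
  by rewrite -[leLHS](ger0_norm (ltW t0)) -sqrtr_sqr; exact: ler_wsqrtr.
have -> : C * t ^+ 3 * (2 * pi) = 2 * pi * C * (t ^+ 2 * t) by move: (@pi R) => p; ring.
apply: ler_wpM2l; first by rewrite !mulr_ge0// ltW.
by apply: ler_wpM2l; rewrite ?sqr_ge0.
Qed.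

End LocalLimit.

(** * The saddle point *)

Section HardyRamanujan.
Variable R : realType.
Notation z2 := (@zeta2 R).

Definition hr_main (n : nat) : R :=
  1 / (4 * n%:R * Num.sqrt 3) * expR (pi * Num.sqrt (2 * n%:R / 3)).

Definition logP_main (t : R) : R := z2 / t + ln t / 2 - ln (2 * pi) / 2.
(** The Gaussian integral sqrt (2 pi / kap2) with [kap2] replaced by its leading term 2 zeta2 /
    t^3. *)
Definition saddle_width (t : R) : R := Num.sqrt (pi / z2) * (t * Num.sqrt t).

Lemma saddle_width_gt0 t : 0 < t -> 0 < saddle_width t.
Proof.
move=> t0; rewrite /saddle_width !mulr_gt0 ?sqrtr_gt0// divr_gt0 ?pi_gt0//.
exact: zeta2_gt0.
Qed.

Lemma expR_half_ln (x : R) : 0 < x -> expR (ln x / 2) = Num.sqrt x.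
Proof.
move=> x0; apply/eqP; rewrite -(@eqrXn2 _ 2) ?expR_ge0 ?sqrtr_ge0//.
rewrite sqr_sqrtr ?ltW// -expRM_natl (_ : 2 * (ln x / 2) = ln x); last by field.
by rewrite lnK ?posrE.
Qed.

(* At the saddle point, the exponent [n t + zeta2 / t] equals [2 n t = pi sqrt(2 n / 3)]. *)
Lemma hr_mainE (n : nat) t : 0 < t -> n%:R = z2 / t ^+ 2 ->
  hr_main n = expR (n%:R * t + logP_main t) * saddle_width t / (2 * pi).
Proof.
move=> t0 nt; have pi0 := pi_gt0 R; have z0 := zeta2_gt0 R.
have n0 : 0 < n%:R :> R by rewrite nt divr_gt0// exprn_gt0.
have E1 : n%:R * t = z2 / t by rewrite nt; field; exact: lt0r_neq0.
have zE : z2 * 6 = pi ^+ 2 by rewrite /zeta2; move: (@pi R) => p; field.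
have E2 : pi * Num.sqrt (2 * n%:R / 3) = z2 / t + z2 / t.
  have h1 : (0 : R) <= pi * Num.sqrt (2 * n%:R / 3) by apply: mulr_ge0; [exact: ltW pi0|exact: sqrtr_ge0].
  have h2 : 0 <= z2 / t + z2 / t by rewrite addr_ge0// divr_ge0// ltW.
  apply/eqP; rewrite -(eqrXn2 (ltn0Sn 1) h1 h2).
  rewrite exprMn sqr_sqrtr; last by rewrite divr_ge0.
  rewrite -zE nt; apply/eqP; move: z2 => z; field; exact: lt0r_neq0.
rewrite /hr_main E2 E1 /logP_main.
have -> : z2 / t + (z2 / t + ln t / 2 - ln (2 * pi) / 2) = (z2 / t + z2 / t) + ln t / 2 - ln (2 * pi) / 2 by ring.
move: (z2 / t + z2 / t) => y.
rewrite expRB expRD !expR_half_ln ?mulr_gt0//.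
have p2 : 0 < 2 * pi :> R by rewrite mulr_gt0.
have S0 := ltW (saddle_width_gt0 t0).
suff E3 : 1 / (4 * n%:R * Num.sqrt 3) =
    Num.sqrt t / Num.sqrt (2 * pi) * saddle_width t / (2 * pi).
  by rewrite E3; ring.
have h1 : (0 : R) <= 1 / (4 * n%:R * Num.sqrt 3).
  by rewrite div1r invr_ge0 !mulr_ge0 ?sqrtr_ge0.
have h2 : 0 <= Num.sqrt t / Num.sqrt (2 * pi) * saddle_width t / (2 * pi).
  by apply: divr_ge0; [apply: mulr_ge0 => //; apply: divr_ge0; exact: sqrtr_ge0|exact: ltW].
apply/eqP; rewrite -(eqrXn2 (ltn0Sn 1) h1 h2) div1r.
rewrite /saddle_width !(exprMn, exprVn) (sqr_sqrtr (ltW p2)).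
rewrite (sqr_sqrtr (ltW t0)) !sqr_sqrtr ?divr_ge0 ?sqr_ge0 ?(ltW pi0) ?(ltW z0)//.
rewrite nt; apply/eqP.
have -> : z2 = pi ^+ 2 / 6 by [].
by move: (@pi R) pi0 => p p0; field; rewrite !lt0r_neq0.
Qed.

Lemma hr_main_gt0 (n : nat) : (0 < n)%N -> 0 < hr_main n.
Proof.
by move=> n0; rewrite mulr_gt0 ?expR_gt0// divr_gt0// !mulr_gt0 ?ltr0n ?sqrtr_gt0.
Qed.

Lemma expR_near0 (d a : R) : `|d| <= a -> a <= 1 / 2 -> `|expR d - 1| <= 2 * a.
Proof.
rewrite !ler_norml => /andP[d1 d2] a2.
have e1 := expR_ge1Dx d; have e2 := expRN_mul_le (- d); rewrite opprK in e2.
have e0 := expR_gt0 d; apply/andP; split; nra.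
Qed.

Lemma inv_sqrt_near1 (e : R) : `|e| <= 1 / 2 -> `|(Num.sqrt (1 + e))^-1 - 1| <= 2 * `|e|.
Proof.
move=> e2; have p : 0 < 1 + e by move: e2; rewrite ler_norml => /andP[]; lra.
set w := (Num.sqrt (1 + e))^-1.
have w0 : 0 < w by rewrite invr_gt0 sqrtr_gt0.
have w2 : w ^+ 2 * (1 + e) = 1 by rewrite exprVn sqr_sqrtr ?ltW// mulVf// lt0r_neq0.
have E : (w - 1) * ((w + 1) * (1 + e)) = - e.
  have -> : (w - 1) * ((w + 1) * (1 + e)) = w ^+ 2 * (1 + e) - (1 + e) by ring.
  by rewrite w2; ring.
have := congr1 Num.norm E; rewrite normrM normrN => {}E.
have q : 1 / 2 <= (w + 1) * (1 + e) by move: e2; rewrite ler_norml => /andP[? ?]; nra.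
rewrite [X in _ * X]ger0_norm in E; last lra.
have := normr_ge0 (w - 1); nra.
Qed.

(** The ratio splits into the local limit quotient [X / S] and the exponential of the error of
    [logP], each of them 1 + O(t). *)
Lemma hardy_ramanujan_saddle : exists2 C : R, 0 < C & exists2 t0 : R, 0 < t0 & forall (n : nat) t,
  0 < t <= t0 -> n%:R = z2 / t ^+ 2 -> `|(npart n)%:R / hr_main n - 1| <= C * t.
Proof.
have [C C0 LL] := local_limit R; have pi0 := pi_gt0 R; have z0 := zeta2_gt0 R.
have zge := zeta2_ge R.
pose D := C / Num.sqrt (pi / z2).
have pz : 0 < Num.sqrt (pi / z2) by rewrite sqrtr_gt0 divr_gt0.
have D0 : 0 < D by rewrite divr_gt0.
exists (D + 8 + 6 * (D + 9)); first lra.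
exists (1 / 16) => [|n t t01 nt]; first lra.
have /andP[t0 t1] := t01.
have t01' : 0 < t <= 1 by apply/andP; split; lra.
have [N0 HN] := partition_sums_asymptotics t01'.
(* [N] must pass the threshold of the asymptotics, [n] for the exact coefficient, and 1 / t for the
   decay estimates. *)
pose N := (N0 + (n + (Num.truncn t^-1).+1))%N.
have [hL hk1 hk2] := HN N (leq_addr _ _).
have nN : (n <= N)%N by rewrite /N addnCA leq_addr.
have Nt : 1 <= N%:R * t.
  rewrite -ler_pdivrMr// div1r; apply: ltW; apply: lt_le_trans (truncnS_gt _) _.
  by rewrite ler_nat; apply: leq_trans (leq_addl _ _); exact: leq_addl.
rewrite -nt in hk1.
have {}LL := LL t N n t01 Nt nN hk1 hk2.
have S0 := saddle_width_gt0 t0.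
set S := saddle_width t in S0.
set X := 2 * pi * _ / _ in LL.
have n0 : 0 < n%:R :> R by rewrite nt divr_gt0// exprn_gt0.
have ratio : (npart n)%:R / hr_main n = X / S * expR (logP N t - logP_main t).
  rewrite (hr_mainE t0 nt) /X -/S -expRM_natl mulrN !expRN [expR (n%:R * t + _)]expRD [expR (logP N t - _)]expRB.
  move: (@pi R) pi0 (expR_gt0 (n%:R * t)) (expR_gt0 (logP N t)) (expR_gt0 (logP_main t)) => p p0.
  move: (expR _) (expR _) (expR _) => a b d a0 b0 d0.
  by field; rewrite !lt0r_neq0.
have t3 : 0 < t ^+ 3 by rewrite exprn_gt0.
(* The relative error of [kap2]; below, 4 bounds 5 / (2 zeta2) because zeta2 >= 2/3. *)
pose e := kap2 N t * t ^+ 3 / (2 * z2) - 1.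
have eb : `|e| <= 4 * t.
  have -> : e = (kap2 N t - 2 * z2 / t ^+ 3) * (t ^+ 3 / (2 * z2)).
    by rewrite /e; move: z0; move: z2 => z z0; field; rewrite !lt0r_neq0.
  have w0 : 0 < t ^+ 3 / (2 * z2) by rewrite divr_gt0// mulr_gt0.
  rewrite normrM (gtr0_norm w0); apply: (@le_trans _ _ (5 / t ^+ 2 * (t ^+ 3 / (2 * z2)))).
    by apply: ler_wpM2r => //; exact: ltW.
  have -> : 5 / t ^+ 2 * (t ^+ 3 / (2 * z2)) = 5 / 2 * t / z2.
    by move: z0; move: z2 => z z0; field; rewrite !lt0r_neq0.
  by rewrite ler_pdivrMr//; nra.
have e2 : `|e| <= 1 / 2 by lra.
have sq : Num.sqrt (2 * pi / kap2 N t) = S * (Num.sqrt (1 + e))^-1.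
  have p1 : 0 < 1 + e by move: e2; rewrite ler_norml => /andP[]; lra.
  rewrite -sqrtrV ?ltW// /S /saddle_width.
  have ts : t * Num.sqrt t = Num.sqrt (t ^+ 3).
    by rewrite exprS mulrC sqrtrM ?(ltW t0)// sqrtr_sqr ger0_norm// ltW.
  have dz : (0 : R) <= pi / z2 by apply: divr_ge0; exact: ltW.
  rewrite ts -[Num.sqrt (pi / z2) * _](sqrtrM _ dz) -sqrtrM ?(mulr_ge0 dz (ltW t3))//.
  congr Num.sqrt.
  have -> : kap2 N t = (1 + e) * (2 * z2) / t ^+ 3.
    by rewrite /e; move: z0; move: z2 => z z0; field; rewrite !lt0r_neq0.
  by move: (@pi R) z0; move: z2 => z p z0; field; rewrite !lt0r_neq0.
have Y1 : `|X / S - 1| <= (D + 8) * t.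
  have -> : X / S - 1 = (X - Num.sqrt (2 * pi / kap2 N t)) / S + ((Num.sqrt (1 + e))^-1 - 1).
    by rewrite sq mulrBl [S * _]mulrC mulfK ?lt0r_neq0// addrA subrK.
  apply: le_trans (ler_normD _ _) _; rewrite [leRHS]mulrDl; apply: lerD; last first.
    by apply: le_trans (inv_sqrt_near1 e2) _; lra.
  rewrite normrM normfV (gtr0_norm S0) ler_pdivrMr//; apply: le_trans LL _.
  rewrite le_eqVlt; apply/orP; left; apply/eqP; rewrite /D /S /saddle_width.
  by field; rewrite lt0r_neq0.
have Ee := expR_near0 hL (_ : 3 * t <= 1 / 2).
have {}Ee : `|expR (logP N t - logP_main t) - 1| <= 6 * t by apply: le_trans (Ee _) _; lra.
rewrite ratio; set y := X / S in Y1 *; set x := expR _ in Ee *.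
have -> : y * x - 1 = y * (x - 1) + (y - 1) by ring.
apply: le_trans (ler_normD _ _) _; rewrite normrM.
have yb : `|y| <= D + 9.
  have -> : y = (y - 1) + 1 by ring.
  apply: le_trans (ler_normD _ _) _; rewrite normr1; nra.
have : `|y| * `|x - 1| <= (D + 9) * (6 * t) by apply: ler_pM.
by lra.
Qed.

End HardyRamanujan.

(** * Rankin's bound at the saddle point *)

Section DeviationBound.
Variable R : realType.
Notation z2 := (@zeta2 R).

Lemma prod_le_window (F : nat -> R) (r : R) (k M W : nat) : (k + M <= W)%N ->
  (forall w, 0 <= F w <= 1) -> (forall w, (k <= w < k + M)%N -> F w <= r) ->
  \prod_(w < W) F w <= r ^+ M.
Proof.
move=> kMW F01 Fr; rewrite -(big_mkord xpredT F).
have kW : (k <= W)%N by lia.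
rewrite (big_cat_nat (n := k))//= (big_cat_nat (m := k) (n := k + M))//=; last exact: leq_addr.
have P01 a c : 0 <= \prod_(a <= w < c) F w <= 1.
  apply/andP; split; first by apply: prodr_ge0 => w _; case/andP: (F01 w).
  by apply: prodr_ile1 => w _; exact: F01.
have [/andP[a0 a1] /andP[c0 c1]] := (P01 0 k, P01 (k + M)%N W).
have [b0 _] := andP (P01 k (k + M)%N).
have br : \prod_(k <= w < k + M) F w <= r ^+ M.
  rewrite -{1}[k]add0n big_addn addKn big_mkord.
  have -> : r ^+ M = \prod_(i < M) r by rewrite prodr_const card_ord.
  apply: ler_prod => i _; have /andP[-> _] := F01 (i + k)%N.
  by apply: Fr; have := ltn_ord i; lia.
apply: le_trans br.
apply: (@le_trans _ _ (1 * (\prod_(k <= w < k + M) F w * 1))); last by rewrite mul1r mulr1.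
by apply: ler_pM => //; [exact: mulr_ge0|exact: ler_wpM2l].
Qed.

Lemma prod_blocks (F : nat -> R) (W L : nat) :
  \prod_(j < W * L) F j = \prod_(w < W) \prod_(i < L) F (L * w + i)%N.
Proof.
rewrite -(big_mkord xpredT F) big_nat_mul/= big_mkord; apply: eq_bigr => w _.
rewrite -[X in index_iota X _]add0n big_addn mulSn addnK big_mkord.
by apply: eq_bigr => i _; rewrite addnC mulnC.
Qed.

(** [f] is Rankin's factor of a window divided by its block of Euler's product. When L w t lies in
    [1, 2], the monomial is at least e^(-(4 + L)) and every 1 - q^k at least 1 - e^-1, so the saving
    does not depend on [t] or [w]. *)
Lemma window_factor_bounds (l w : nat) (c t : R) : (0 < l)%N -> 0 <= c < 1 -> 0 < t <= 1 ->
  let q := expR (- t) in let L := (5 * l)%N in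
  let f : R := 1 - (1 - c) * q ^+ (10 * l * w + L - 1) * \prod_(i < L) (1 - q ^+ (L * w + i).+1) in
  0 <= f <= 1 /\ (1 <= L%:R * w%:R * t <= 2 ->
    f <= expR (- ((1 - c) * expR (- (4 + L%:R)) * (1 - expR (- 1)) ^+ L))).
Proof.
move=> l0 /andP[c0 c1] /andP[t0 t1] q L f.
have le1 : (10 * l * w + L - 1 <= 2 * (L * w) + L)%N by rewrite /L; lia.
have /andP[q0 q1] : 0 < q < 1 by exact: expRN_bounds.
have qb k : 0 <= q ^+ k <= 1 by rewrite exprn_ge0 ?exprn_ile1 ?(ltW q0) ?(ltW q1).
have [a0 a1] := andP (qb (10 * l * w + L - 1)%N).
have P01 : 0 <= \prod_(i < L) (1 - q ^+ (L * w + i).+1) <= 1.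
  have F01 i : 0 <= 1 - q ^+ (L * w + i).+1 <= 1.
    by have /andP[? ?] := qb (L * w + i).+1; apply/andP; split; lra.
  apply/andP; split; first by apply: prodr_ge0 => i _; case/andP: (F01 i).
  by apply: prodr_ile1 => i _; exact: F01.
split.
  rewrite /f; move: P01 => /andP[p0 p1].
  have : 0 <= (1 - c) * q ^+ (10 * l * w + L - 1) by rewrite mulr_ge0//; lra.
  have : (1 - c) * q ^+ (10 * l * w + L - 1) <= 1 by nra.
  move: (_ * q ^+ _) p0 p1; move: (\prod_(_ < _) _) => p a p0 p1 a2 a3.
  by apply/andP; split; nra.
move=> /andP[w1 w2]; apply: le_trans (expRN_ge _).
rewrite lerD2l lerN2.
have e1 : 0 < expR (- 1 : R) < 1 by exact: expRN_bounds.
apply: ler_pM.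
- by rewrite mulr_ge0 ?expR_ge0//; lra.
- by rewrite exprn_ge0//; lra.
- apply: ler_wpM2l; first lra.
  rewrite /q -expRM_natl ler_expR mulrN lerN2.
  apply: (@le_trans _ _ ((2 * (L%:R * w%:R) + L%:R) * t)).
    apply: ler_wpM2r; first exact: ltW.
    by rewrite -natrM -!natrM -natrD ler_nat.
  have Lt : L%:R * t <= L%:R by rewrite ler_piMr.
  rewrite mulrDl (_ : 2 * (L%:R * w%:R) * t = 2 * (L%:R * w%:R * t)); last by ring.
  by move: (L%:R * w%:R * t) w2 Lt => x; move: (L%:R * t) (L%:R) => y z; lra.
have -> : (1 - expR (- 1)) ^+ L = \prod_(i < L) (1 - expR (- 1)) :> R by rewrite prodr_const card_ord.
apply: ler_prod => i _; apply/andP; split; first lra.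
rewrite lerD2l lerN2 /q -expRM_natl ler_expR mulrN lerN2.
apply: le_trans w1 _; rewrite -natrM; apply: ler_wpM2r; first exact: ltW.
by rewrite ler_nat leqW// leq_addr.
Qed.

Lemma hooks_deviation_saddle (l b : nat) (a : int) : (0 < l)%N -> (0 < b)%N ->
  exists2 C : R, 0 < C & exists2 t0 : R, 0 < t0 & forall (n : nat) t,
  0 < t <= t0 -> n%:R = z2 / t ^+ 2 ->
  `|(npart_hooks l a b n)%:R - (npart n)%:R / b%:R| <= C * t * hr_main R n.
Proof.
move=> l0 b0; have [c c01 dev] := npart_hooks_deviation R a l0 b0.
have pi0 := pi_gt0 R; have z0 := zeta2_gt0 R.
pose L := (5 * l)%N; have L0 : 0 < L%:R :> R by rewrite ltr0n muln_gt0 l0.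
pose eta : R := (1 - c) * expR (- (4 + L%:R)) * (1 - expR (- 1)) ^+ L.
have eta0 : 0 < eta.
  have /andP[_ e1] : 0 < expR (- 1 : R) < 1 by exact: expRN_bounds.
  case/andP: c01 => _ c1.
  by rewrite /eta !mulr_gt0 ?expR_gt0 ?exprn_gt0//; lra.
pose k := Num.sqrt (pi / z2); have k0 : 0 < k by rewrite sqrtr_gt0 divr_gt0.
pose C := 2 * pi * expR 3 * (6 * (4 * L%:R / eta) ^+ 3) / k.
have C0 : 0 < C by rewrite /C !mulr_gt0 ?expR_gt0 ?invr_gt0 ?exprn_gt0// !mulr_gt0 ?invr_gt0.
exists C => //; exists (4 * L%:R)^-1 => [|n t /andP[t0 tL] nt]; first by rewrite invr_gt0 mulr_gt0.
have L1 : 1 <= L%:R :> R by rewrite ler1n muln_gt0 l0.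
have tL4 : t * (4 * L%:R) <= 1 by rewrite -ler_pdivlMr ?mulr_gt0// div1r.
have t1 : t <= 1 by nra.
have t01 : 0 < t <= 1 by rewrite t0.
have [N0 HN] := partition_sums_asymptotics t01.
pose u := (L%:R * t)^-1.
have Lt : 0 < L%:R * t by rewrite mulr_gt0.
have u0 : 0 < u by rewrite invr_gt0.
have uE : u * (L%:R * t) = 1 by rewrite mulVf// lt0r_neq0.
have u4 : 4 <= u by rewrite -[leRHS]div1r ler_pdivlMr//; lra.
(* The [M] windows from [k0'] on have index between u and 2 u, that is L w t in [1, 2]. [u >= 4]
   absorbs the rounding, so that M >= u / 4. *)
pose k0' := (Num.truncn u).+1; pose M := Num.truncn (u / 2).
have kb : u < k0'%:R <= u + 1.
  by rewrite truncnS_gt -natr1 lerD2r truncn_le// ltW.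
have Mb : u / 4 <= M%:R <= u / 2.
  have M1 : u / 2 < M.+1%:R by exact: truncnS_gt.
  have M2 : M%:R <= u / 2 by rewrite truncn_le//; lra.
  by move: M1; rewrite -[M.+1%:R]natr1 => M1; apply/andP; split; lra.
pose W := (k0' + M + (N0 + n))%N.
have LN : (0 < L)%N by rewrite muln_gt0 l0.
have WL : (N0 <= W * L)%N by apply: leq_trans (leq_pmulr _ LN); rewrite /W addnCA leq_addr.
have nW : (n <= W * L)%N by apply: leq_trans (leq_pmulr _ LN); rewrite /W addnA leq_addl.
have [hL _ _] := HN _ WL.
pose q := expR (- t).
have q01 : 0 < q < 1 by exact: expRN_bounds.
have c01' : 0 <= c <= 1 by case/andP: c01 => -> /ltW.
apply: le_trans (dev n W) _.
apply: le_trans (sum_pow_stateA_le l0 c01' q01 nW) _.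
pose f w := 1 - (1 - c) * q ^+ (10 * l * w + L - 1) * \prod_(i < L) (1 - q ^+ (L * w + i).+1).
have fP w := window_factor_bounds w l0 c01 t01.
have -> : \prod_(w < W) (\prod_(i < 5 * l) (1 - q ^+ (5 * l * w + i).+1)^-1
    - (1 - c) * q ^+ (10 * l * w + 5 * l - 1)) = gmax q (W * L) * \prod_(w < W) f w.
  rewrite /gmax (prod_blocks (fun j => (1 - q ^+ j.+1)^-1)) -big_split/=.
  apply: eq_bigr => w _; rewrite /f -/L mulrBr mulr1; congr (_ - _).
  rewrite [RHS]mulrCA -big_split/= big1 ?mulr1// => i _.
  by case/andP: q01 => q0 q1; rewrite mulVf// gt_eqF// subr_gt0 exprn_ilt1// ltW.
have fle : \prod_(w < W) f w <= expR (- (M%:R * eta)).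
  have -> : expR (- (M%:R * eta)) = expR (- eta) ^+ M by rewrite -expRM_natl mulrN.
  apply: (@prod_le_window f _ k0'); first exact: leq_addr.
    by move=> w; have [] := fP w.
  move=> w /andP[w1 w2]; have [_] := fP w; apply.
  have w1' : k0'%:R <= w%:R :> R by rewrite ler_nat.
  have w2' : w%:R <= k0'%:R + M%:R :> R by rewrite -natrD ler_nat ltnW.
  have -> : L%:R * w%:R * t = w%:R * (L%:R * t) by ring.
  case/andP: kb => kb1 kb2; case/andP: Mb => Mb1 Mb2.
  move: (w%:R) (k0'%:R) (M%:R) w1' w2' kb1 kb2 Mb1 Mb2 => w' k' M' w1' w2' kb1 kb2 Mb1 Mb2.
  have p1 : u * (L%:R * t) <= w' * (L%:R * t) by apply: ler_wpM2r; [exact: ltW|lra].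
  have p2 : w' * (L%:R * t) <= 2 * u * (L%:R * t) by apply: ler_wpM2r; [exact: ltW|lra].
  by move: p1 p2; rewrite -mulrA uE => p1 p2; rewrite p1/=; lra.
rewrite (gmaxE _ t0) mulrA -[q ^- n]exprVn -[q^-1]expRN opprK -expRM_natl.
rewrite (hr_mainE t0 nt).
set A := expR (_ + _ t); have A0 : 0 < A by exact: expR_gt0.
have le1 : expR (n%:R * t) * expR (logP (W * L) t) <= A * expR 3.
  rewrite -!expRD ler_expR -addrA lerD2l -lerBlDl.
  by have := ler_norml (logP (W * L) t - logP_main t) (3 * t); rewrite hL => /esym/andP[_]; lra.
(* Of the exponential saving only e^-y <= 6 / y^3 is used: it gives order t^3, below the t^(5/2)
   that is t times the saddle width. *)
pose y := eta * (u / 4).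
have y0 : 0 < y by rewrite mulr_gt0// divr_gt0.
have le2 : \prod_(w < W) f w <= 6 * (y ^+ 3)^-1.
  apply: le_trans fle _; apply: (@le_trans _ _ (expR (- y))).
    by rewrite ler_expR lerN2 /y mulrC ler_wpM2r ?(ltW eta0)//; case/andP: Mb.
  rewrite expRN -div1r ler_pdivrMr ?expR_gt0// mulrAC ler_pdivlMr ?exprn_gt0// mul1r.
  exact: cube_le_exp (ltW y0).
apply: le_trans (ler_pM _ _ le1 le2) _; first by rewrite mulr_ge0 ?expR_ge0.
  by apply: prodr_ge0 => w _; have [/andP[]] := fP w.
have -> : 6 * (y ^+ 3)^-1 = 6 * (4 * L%:R / eta) ^+ 3 * (t ^+ 2 * t).
  by rewrite /y /u; field; rewrite !lt0r_neq0.
have ts : t <= Num.sqrt t.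
  have h : t ^+ 2 <= t by rewrite expr2 ler_piMl ?(ltW t0).
  by rewrite -[leLHS](ger0_norm (ltW t0)) -sqrtr_sqr; exact: ler_wsqrtr.
have -> : C * t * (A * saddle_width t / (2 * pi)) =
    A * expR 3 * (6 * (4 * L%:R / eta) ^+ 3 * (t ^+ 2 * Num.sqrt t)).
  rewrite /C /saddle_width -/k; clear C C0.
  by move: (@pi R) pi0 (Num.sqrt t) k k0 => p p0 r k k0; field; rewrite !lt0r_neq0.
apply: ler_wpM2l; first by rewrite mulr_ge0 ?expR_ge0// ltW.
apply: ler_wpM2l.
  by apply: mulr_ge0 => //; apply: exprn_ge0; apply: divr_ge0; [exact: mulr_ge0|exact: ltW].
by apply: ler_wpM2l; rewrite ?sqr_ge0.
Qed.

End DeviationBound.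

(** * Relative errors in terms of n *)

Section Asymptotics.
Variable R : realType.
Notation z2 := (@zeta2 R).

Lemma npart_hooks_rel_error (l b : nat) (a : int) : (0 < l)%N -> (0 < b)%N ->
  exists2 C : R, 0 < C & \forall n \near \oo, let e := (Num.sqrt n%:R)^-1 in
    [/\ 0 < (npart n)%:R :> R, 0 < hr_main R n,
      `|(npart_hooks l a b n)%:R * b%:R / (npart n)%:R - 1| <= C * e
    & `|(npart_hooks l a b n)%:R * b%:R / hr_main R n - 1| <= C * e].
Proof.
move=> l0 b0; have z0 := zeta2_gt0 R.
have [C1 C10 [t1 t10 H1]] := hardy_ramanujan_saddle R.
have [C2 C20 [t2 t20 H2]] := hooks_deviation_saddle R a l0 b0.
have B0 : 0 < b%:R :> R by rewrite ltr0n.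
pose s := Num.sqrt z2; have s0 : 0 < s by rewrite sqrtr_gt0.
exists (2 * (b%:R * C2 + C1) * s); first by rewrite !mulr_gt0// addr_gt0// mulr_gt0.
(* The last bound makes p(n) at least half of the Hardy-Ramanujan main term, so that errors relative
   to the latter are also errors relative to p(n). *)
pose m := Num.min (Num.min t1 t2) (1 / (2 * C1)).
have m0 : 0 < m by rewrite !lt_min t10 t20/= divr_gt0// mulr_gt0.
exists (Num.truncn (z2 / m ^+ 2)).+1 => // n /= nm; set e := (Num.sqrt n%:R)^-1.
have nb : z2 / m ^+ 2 < n%:R.
  by apply: lt_le_trans (truncnS_gt _) _; rewrite ler_nat.
have n0 : 0 < n%:R :> R by apply: le_lt_trans nb; rewrite divr_ge0 ?sqr_ge0// ltW.
(* t = sqrt (zeta2 / n) solves n = zeta2 / t^2 and turns O(t) into O(n^(-1/2)). *)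
pose t := s * e.
have e0 : 0 < e by rewrite invr_gt0 sqrtr_gt0.
have t0 : 0 < t by rewrite mulr_gt0.
have t2E : t ^+ 2 = z2 / n%:R.
  by rewrite /t /e exprMn exprVn !sqr_sqrtr// ltW.
have nt : n%:R = z2 / t ^+ 2 by rewrite t2E invf_div mulrCA mulfV ?mulr1// lt0r_neq0.
have tm : t <= m.
  rewrite leNgt; apply/negP => mt; move: nb; apply/negP; rewrite -leNgt nt.
  apply: ler_wpM2l; first exact: ltW.
  by rewrite lef_pV2 ?posrE ?exprn_gt0// lerXn2r ?nnegrE ?(ltW m0) ?(ltW t0)// ltW.
move: tm; rewrite !le_min => /andP[/andP[tt1 tt2] tC].
have tC1 : C1 * t <= 1 / 2.
  by move: tC; rewrite ler_pdivlMr ?mulr_gt0//; lra.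
have h0 : 0 < hr_main R n by apply: hr_main_gt0; rewrite -(ltr0n R).
have {}H1 := H1 n t (introT andP (conj t0 tt1)) nt.
have {}H2 := H2 n t (introT andP (conj t0 tt2)) nt.
move: H1 H2 h0; move: (hr_main R n) (npart n)%:R (npart_hooks _ _ _ _)%:R => h p k H1 H2 h0.
have ph : h / 2 <= p.
  have : - (C1 * t) <= p / h - 1 by move: H1; rewrite ler_norml => /andP[].
  move=> H; have : 1 / 2 <= p / h by lra.
  by rewrite ler_pdivlMr//; lra.
have p0 : 0 < p by apply: lt_le_trans ph; rewrite divr_gt0.
have D : `|k * b%:R - p| <= b%:R * C2 * t * h.
  have -> : k * b%:R - p = b%:R * (k - p / b%:R) by field; exact: lt0r_neq0.
  rewrite normrM gtr0_norm// (_ : b%:R * C2 * t * h = b%:R * (C2 * t * h)); last by ring.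
  by apply: ler_wpM2l => //; exact: ltW.
have CtE : 2 * (b%:R * C2 + C1) * s * e = 2 * (b%:R * C2 * t) + 2 * (C1 * t) by rewrite /t; ring.
have x0 : 0 <= b%:R * C2 * t by rewrite !mulr_ge0// ltW.
have y0 : 0 <= C1 * t by rewrite mulr_ge0// ltW.
split=> //; rewrite CtE.
  have -> : k * b%:R / p - 1 = (k * b%:R - p) / p by field; exact: lt0r_neq0.
  rewrite normrM normfV (gtr0_norm p0) ler_pdivrMr//; apply: le_trans D _.
  by move: (b%:R * C2 * t) (C1 * t) x0 y0 => x y x0 y0; nra.
have -> : k * b%:R / h - 1 = (k * b%:R - p) / h + (p / h - 1) by field; exact: lt0r_neq0.
apply: le_trans (ler_normD _ _) _; apply: (@le_trans _ _ (b%:R * C2 * t + C1 * t)); last by lra.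
by apply: lerD => //; rewrite normrM normfV (gtr0_norm h0) ler_pdivrMr.
Qed.

End Asymptotics.

Theorem theorem1 (R : realType) (l b : nat) (a : int)
    (l_gt0 : (0 < l)%N) (b_gt0 : (0 < b)%N) :
  exists E1 E2 : nat -> R,
    [/\ E1 =O_\oo (fun n => n%:R `^ (- (1 / 2))),
        E2 =O_\oo (fun n => n%:R `^ (- (1 / 2))),
        \forall n \near \oo,
          (npart_hooks l a b n)%:R = (npart n)%:R / b%:R * (1 + E1 n)
      & \forall n \near \oo,
          (npart_hooks l a b n)%:R =
            1 / (4 * b%:R * n%:R * Num.sqrt 3)
            * expR (pi * Num.sqrt (2 * n%:R / 3)) * (1 + E2 n)].
Proof.
have [C C0 H] := npart_hooks_rel_error R a l_gt0 b_gt0.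
have b0 : 0 < b%:R :> R by rewrite ltr0n.
have powE (n : nat) : n%:R `^ (- (1 / 2)) = (Num.sqrt n%:R)^-1 :> R.
  by rewrite powRN div1r powR12_sqrt.
(* The error functions are the relative errors themselves, so both equations hold as soon as p(n)
   and the main term are nonzero. *)
exists (fun n => (npart_hooks l a b n)%:R * b%:R / (npart n)%:R - 1).
exists (fun n => (npart_hooks l a b n)%:R * b%:R / hr_main R n - 1).
split.
- apply/eqO_exP; exists C => //; near=> n.
  rewrite powE [`|_^-1|]ger0_norm ?invr_ge0 ?sqrtr_ge0//.
  by have [] := near H n.
- apply/eqO_exP; exists C => //; near=> n.
  rewrite powE [`|_^-1|]ger0_norm ?invr_ge0 ?sqrtr_ge0//.
  by have [] := near H n.
- near=> n; have [//|p0 _ _ _] := near H n.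
  by rewrite [1 + _]addrC subrK; field; rewrite !lt0r_neq0.
near=> n; have [//|_ h0 _ _] := near H n.
rewrite [1 + _]addrC subrK.
have -> : 1 / (4 * b%:R * n%:R * Num.sqrt 3) * expR (pi * Num.sqrt (2 * n%:R / 3)) = hr_main R n / b%:R.
  rewrite /hr_main [RHS]mulrAC; congr (_ * _).
  by rewrite !div1r -invfM; congr (_^-1); ring.
by move: (hr_main R n) h0 => h h0; field; rewrite !lt0r_neq0.
Unshelve. all: by end_near. Qed.
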